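(* (a) From a proof in $\mathsf P$ of the statement \[ (\star)\qquad(\forall\Gamma^3)\big[[\mathsf{GH}_{\mathrm{st}}(\Gamma)\wedge\mathsf{STP}\wedge\mathsf{NPC}]\to\mathsf{CA}(\Gamma)\big] \] one can extract closed terms $i^4,o^4$ of $\mathsf{E\text{-}PA}^{\omega*}$ such that $\mathsf{E\text{-}PA}^{\omega*}$ proves $\mathsf{HER}(i,o)$. (b) Conversely, if $i,o$ are closed terms of $\mathsf{E\text{-}PA}^{\omega*}$ such that $\mathsf{E\text{-}PA}^{\omega*}$ proves $\mathsf{HER}(i,o)$, then $\mathsf P$ proves $(\star)$.
   Context: Framework. $\mathsf{E\text{-}PA}^{\omega*}$ is Peano arithmetic in all finite types with the axiom of extensionality, with additional types $\rho^*$ of finite sequences. The language of $\mathsf P$ adds a predicate $\mathrm{st}$ for every type; $(\forall^{\mathrm{st}}x)\varphi\equiv(\forall x)(\mathrm{st}(x)\to\varphi)$, $(\exists^{\mathrm{st}}x)\varphi\equiv(\exists x)(\mathrm{st}(x)\wedge\varphi)$; internal = not containing $\mathrm{st}$. $\mathsf P$ is $\mathsf{E\text{-}PA}^{\omega*}$ plus: $\mathrm{st}(x)\wedge x=y\to\mathrm{st}(y)$; $\mathrm{st}(t)$ for each closed term $t$; $\mathrm{st}(f)\wedge\mathrm{st}(x)\to\mathrm{st}(f(x))$; external induction for all formulas; $\mathsf{HAC}_{\mathrm{int}}$: for internal $\varphi$, $(\forall^{\mathrm{st}}x^\rho)(\exists^{\mathrm{st}}y^\tau)\varphi(x,y)\to(\exists^{\mathrm{st}}F^{\rho\to\tau^*})(\forall^{\mathrm{st}}x)(\exists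 y\in F(x))\varphi(x,y)$; idealisation: for internal $\varphi$, $(\forall^{\mathrm{st}}x^{\sigma^*})(\exists y^\tau)(\forall z^\sigma\in x)\varphi(z,y)\to(\exists y^\tau)(\forall^{\mathrm{st}}x^\sigma)\varphi(x,y)$. $N\in\Omega$ means $\neg\mathrm{st}(N^0)$; $f\approx_1g$ means $(\forall^{\mathrm{st}}n)f(n)=g(n)$. Finite sequences of numbers coded as numbers; $|s|$, $*$, $\overline sM$, $\overline\alpha M$ (initial segments of length $M$), $s*00\dots$ as usual; $f\le_11$ means $(\forall n)f(n)\le1$; $T^1\le_11$ denotes a binary tree. $Y^2\in C$ means $(\forall f)(\exists N)(\forall g)(\overline gN=\overline fN\to Y(f)=Y(g))$. For a finite sequence $w$, $x\in w$ means $x$ is an entry of $w$. $\mathsf{STP}$: $(\forall f^1\le_11)(\exists^{\mathrm{st}}g^1\le_11)(f\approx_1g)$. $\mathsf{NPC}$: $(\forall^{\mathrm{st}}Y^2\in C,f^1)(\forall g^1)(f\approx_1g\to Y(f)=Y(g))$. $H(Y,s,M)=Y(\overline sM*00\dots)$ if $|s|\ge M$, else $Y(s*0*H(Y,s*1,M)*\dots*H(Y,s*M,M)*00\dots)$; $G(Y,s,N)=Y(s*00\dots)$ if $|s|\ge N$, else $Y(s*0*(\lambda n)G(Y,s*(n+1),N))$. $\mathsf{GH}(\Gamma,Z,t)$: $\Gamma(Z,t)=Z(t*0*(\lambda n)\Gamma(Z,t*(n+1)))$; $\mathsf{GH}_{\mathrm{st}}(\Gamma)$: $(\forall^{\mathrm{st}}Z^2\in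 C,t^0)\mathsf{GH}(\Gamma,Z,t)$. $\mathsf{CA}(\Gamma)$: $(\forall^{\mathrm{st}}Y^2\in C,s^0)(\forall N\in\Omega)(G(Y,s,N)=H(Y,s,N)=\Gamma(Y,s))$. $\mathsf{SCF}(\Theta,W)$: $(\forall T^1\le_11)\big[(\forall\alpha^1\in\Theta(W)(2))(\alpha\le_11\to\overline\alpha W(\alpha)\notin T)\to(\forall\beta\le_11)(\exists i\le\Theta(W)(1))(\overline\beta i\notin T)\big]$. $\mathsf{MPC}(\Psi,V,f)$: $(\forall g^1)(\overline f\Psi(V,f)=\overline g\Psi(V,f)\to V(f)=V(g))$. $\mathsf{HER}(i,o)$: for all $\Xi=(\Theta,\Psi)$ and all $\Gamma^3$, $Y^2\in C$, $s^0$: $\big[(\forall(Z^2\in C,t^0)\in i(Y,s,\Xi)(1))\mathsf{GH}(\Gamma,Z,t)\wedge(\forall W^2\in i(Y,s,\Xi)(2))\mathsf{SCF}(\Theta,W)\wedge(\forall(V^2\in C,f^1)\in i(Y,s,\Xi)(3))\mathsf{MPC}(\Psi,V,f)\big]\to(\forall M\ge o(Y,s,\Xi))(G(Y,s,M)=\Gamma(Y,s))$, where $i(Y,s,\Xi)(j)$, $j=1,2,3$, are finite sequences of the indicated objects. *)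

(* Defs.v *)
(* A deep embedding of E-PA^{omega*} and of the nonstandard
   system P, with intrinsically typed terms and formulas (de Bruijn). *)
From Stdlib Require Import List.
Import ListNotations.

Declare Scope ty_scope.
Delimit Scope ty_scope with ty.
Declare Scope tm_scope.
Delimit Scope tm_scope with tm.
Declare Scope fm_scope.
Delimit Scope fm_scope with fm.

Inductive ty : Type :=
| tyN : ty
| tyArr : ty -> ty -> ty
| tyStar : ty -> ty.
Bind Scope ty_scope with ty.

Notation "'ι'" := tyN : ty_scope.
Notation "σ ⇒ τ" := (tyArr σ τ) (at level 55, right associativity) : ty_scope.
Notation "σ ^*" := (tyStar σ) (at level 2, format "σ ^*") : ty_scope.

Notation ty1 := (ι ⇒ ι)%ty.
Notation ty2 := (ty1 ⇒ ι)%ty.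

Definition ctx : Type := list ty.

Inductive var : ctx -> ty -> Type :=
| vz : forall {c σ}, var (σ :: c) σ
| vs : forall {c σ τ}, var c τ -> var (σ :: c) τ.

(* [cRec] and [cLRec] are the recursors over ι and over σ^*; their equations
   are in [epa_ax] below. *)
Inductive cst : ty -> Type :=
| cZero : cst ι
| cSucc : cst (ι ⇒ ι)
| cK : forall σ τ, cst (σ ⇒ τ ⇒ σ)
| cS : forall ρ σ τ, cst ((ρ ⇒ σ ⇒ τ) ⇒ (ρ ⇒ σ) ⇒ ρ ⇒ τ)
| cRec : forall σ, cst (ι ⇒ σ ⇒ (σ ⇒ ι ⇒ σ) ⇒ σ)
| cNil : forall σ, cst (σ^*)
| cCons : forall σ, cst (σ ⇒ σ^* ⇒ σ^*)
| cLRec : forall σ ρ, cst (σ^* ⇒ ρ ⇒ (ρ ⇒ σ ⇒ ρ) ⇒ ρ).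

Inductive tm (c : ctx) : ty -> Type :=
| tVar : forall {σ}, var c σ -> tm c σ
| tCst : forall {σ}, cst σ -> tm c σ
| tApp : forall {σ τ}, tm c (σ ⇒ τ) -> tm c σ -> tm c τ.
Arguments tVar {c σ} x.
Arguments tCst {c σ} k.
Arguments tApp {c σ τ} & f a.
Bind Scope tm_scope with tm.

Notation "f · a" := (tApp f a) (at level 40, left associativity) : tm_scope.
Open Scope tm_scope.

Notation v0 := (tVar vz).
Notation v1 := (tVar (vs vz)).
Notation v2 := (tVar (vs (vs vz))).
Notation v3 := (tVar (vs (vs (vs vz)))).
Notation v4 := (tVar (vs (vs (vs (vs vz))))).
Notation v5 := (tVar (vs (vs (vs (vs (vs vz)))))).
Notation v6 := (tVar (vs (vs (vs (vs (vs (vs vz))))))).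

Definition tsub (c d : ctx) : Type := forall σ, var c σ -> tm d σ.

Fixpoint tsubst {c d τ} (θ : tsub c d) (t : tm c τ) : tm d τ :=
  match t with
  | tVar x => θ _ x
  | tCst k => tCst k
  | tApp f a => tApp (tsubst θ f) (tsubst θ a)
  end.

Definition shift {c σ} : tsub c (σ :: c) := fun _ x => tVar (vs x).
Definition wk {c σ τ} (t : tm c τ) : tm (σ :: c) τ := tsubst shift t.

Definition scons {c d σ} (t : tm d σ) (θ : tsub c d) : tsub (σ :: c) d :=
  fun τ x =>
    match x in var e τ
      return match e with
             | nil => unit
             | σ :: c => tm d σ -> tsub c d -> tm d τ
             end
    with
    | vz => fun t _ => t
    | vs y => fun _ θ => θ _ y
    end t θ.

Definition up {c d σ} (θ : tsub c d) : tsub (σ :: c) (σ :: d) :=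
  scons v0 (fun τ x => wk (θ τ x)).
Definition inst {c σ} (t : tm c σ) : tsub (σ :: c) c := scons t (fun _ x => tVar x).
Definition nosub {c} : tsub nil c :=
  fun τ x => match x in var e _ return match e with nil => tm c τ | _ => unit end with
             | vz => tt
             | vs _ => tt
             end.
Definition tclose {τ} (t : tm nil τ) {c} : tm c τ := tsubst nosub t.

Definition tI {c σ} : tm c (σ ⇒ σ) :=
  tCst (cS σ (σ ⇒ σ) σ) · tCst (cK σ (σ ⇒ σ)) · tCst (cK σ σ).

Definition vdrop {σ c τ} (x : var (σ :: c) τ) : option (var c τ) :=
  match x in var e τ return match e with nil => unit | _ :: c => option (var c τ) end with
  | vz => None
  | vs y => Some y
  end.

Fixpoint tdrop {σ c τ} (t : tm (σ :: c) τ) : option (tm c τ) :=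
  match t with
  | tVar x => option_map tVar (vdrop x)
  | tCst k => Some (tCst k)
  | tApp f a =>
      match tdrop f, tdrop a with
      | Some f', Some a' => Some (tApp f' a')
      | _, _ => None
      end
  end.

Definition vabs {σ c τ} (x : var (σ :: c) τ) : tm c (σ ⇒ τ) :=
  match x in var e τ return match e with nil => unit | σ :: c => tm c (σ ⇒ τ) end with
  | vz => tI
  | vs y => tCst (cK _ _) · tVar y
  end.

(* Bracket abstraction: the term language itself has only combinators. *)
Fixpoint lam {σ c τ} (t : tm (σ :: c) τ) : tm c (σ ⇒ τ) :=
  match tdrop t with
  | Some u => tCst (cK _ _) · u
  | None =>
      match t with
      | tVar x => vabs x
      | tCst k => tCst (cK _ _) · tCst k
      | tApp f a => tCst (cS _ _ _) · lam f · lam a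
      end
  end.
Arguments lam {σ c τ} & t.

Notation "'λ' t" := (lam t) (at level 200, right associativity) : tm_scope.

Definition zero {c} : tm c ι := tCst cZero.
Definition succ {c} : tm c (ι ⇒ ι) := tCst cSucc.
Definition Rec {c σ} : tm c (ι ⇒ σ ⇒ (σ ⇒ ι ⇒ σ) ⇒ σ) := tCst (cRec σ).
Definition nil' {c σ} : tm c (σ^*) := tCst (cNil σ).
Definition cons' {c σ} : tm c (σ ⇒ σ^* ⇒ σ^*) := tCst (cCons σ).
Definition LRec {c σ ρ} : tm c (σ^* ⇒ ρ ⇒ (ρ ⇒ σ ⇒ ρ) ⇒ ρ) := tCst (cLRec σ ρ).

Definition add {c} : tm c (ι ⇒ ι ⇒ ι) := λ λ Rec · v0 · v1 · (λ λ succ · v1).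
Definition pred {c} : tm c (ι ⇒ ι) := λ Rec · v0 · zero · (λ λ v0).
Definition monus {c} : tm c (ι ⇒ ι ⇒ ι) := λ λ Rec · v0 · v1 · (λ λ pred · v1).

(* [ifz n x y] is x if n = 0, and y otherwise. *)
Definition ifz {c σ} : tm c (ι ⇒ σ ⇒ σ ⇒ σ) := λ λ λ Rec · v2 · v1 · (λ λ v2).

(* Cantor's bijection (a, b) |-> tri (a + b) + b, where tri n = 0 + 1 + ... + n;
   [diag n] is the largest d such that tri d <= n. *)
Definition tri {c} : tm c (ι ⇒ ι) := λ Rec · v0 · zero · (λ λ add · v1 · (succ · v0)).
Definition pair {c} : tm c (ι ⇒ ι ⇒ ι) := λ λ add · (tri · (add · v1 · v0)) · v0.
Definition diag {c} : tm c (ι ⇒ ι) :=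
  λ Rec · v0 · zero ·
    (λ λ ifz · (monus · (tri · (succ · v1)) · (succ · v0)) · (succ · v1) · v1).
Definition psnd {c} : tm c (ι ⇒ ι) := λ monus · v0 · (tri · (diag · v0)).
Definition pfst {c} : tm c (ι ⇒ ι) := λ monus · (diag · v0) · (psnd · v0).

(* The bijective coding of finite sequences of numbers as numbers:
   the empty sequence is 0, and (a, s) is 1 + pair a (code s).  In [decode], n
   itself bounds the length of the sequence coded by n. *)
Definition code {c} : tm c (ι^* ⇒ ι) := λ LRec · v0 · zero · (λ λ succ · (pair · v0 · v1)).
Definition decode {c} : tm c (ι ⇒ ι^*) :=
  λ Rec · v0 · (λ nil') ·
      (λ λ λ ifz · v0 · nil' ·
               (cons' · (pfst · (pred · v0)) · (v2 · (psnd · (pred · v0)))))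
    · v0.

Definition len {c σ} : tm c (σ^* ⇒ ι) := λ LRec · v0 · zero · (λ λ succ · v1).
Definition append {c σ} : tm c (σ^* ⇒ σ^* ⇒ σ^*) :=
  λ λ LRec · v1 · v0 · (λ λ cons' · v0 · v1).

(* The infinite sequence w * f. *)
Definition catf {c σ} : tm c (σ^* ⇒ (ι ⇒ σ) ⇒ ι ⇒ σ) :=
  λ λ LRec · v1 · v0 · (λ λ λ Rec · v0 · v1 · (λ λ v4 · v0)).

Fixpoint dflt {c} (σ : ty) : tm c σ :=
  match σ with
  | tyN => zero
  | tyArr σ τ => tCst (cK τ σ) · dflt τ
  | tyStar σ => nil'
  end.

(* [nth' w k] is the k-th entry of w (counted from 0), or [dflt σ] if k >= len w. *)
Definition nth' {c σ} : tm c (σ^* ⇒ ι ⇒ σ) := λ catf · v0 · dflt (ι ⇒ σ).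

(* [seg f n] is the initial segment (f 0, ..., f (n - 1)). *)
Definition seg {c} : tm c (ty1 ⇒ ι ⇒ ι^*) :=
  λ λ Rec · v0 · nil' · (λ λ append · v1 · (cons' · (v3 · v0) · nil')).

(* The same operations on coded sequences s : ι.
   [segc f n] is the code of the initial segment of f of length n,
   [lh s] is |s|, [pad s] is s*00..., [snoc s n] is s*n, [ext s f] is s*f,
   and [initc s n] is the initial segment of s of length n (for n <= |s|). *)
Definition segc {c} : tm c (ty1 ⇒ ι ⇒ ι) := λ λ code · (seg · v1 · v0).
Definition lh {c} : tm c (ι ⇒ ι) := λ len · (decode · v0).
Definition pad {c} : tm c (ι ⇒ ty1) := λ nth' · (decode · v0).
Definition snoc {c} : tm c (ι ⇒ ι ⇒ ι) :=
  λ λ code · (append · (decode · v1) · (cons' · v0 · nil')).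
Definition ext {c} : tm c (ι ⇒ ty1 ⇒ ty1) := λ λ catf · (decode · v1) · v0.
Definition initc {c} : tm c (ι ⇒ ι ⇒ ι) := λ λ segc · (pad · v1) · v0.

(* G and H, by recursion on N - |s|:
     G Y s N = Y (s*00...)                                if |s| >= N,
             = Y (s*0*(fun n => G Y (s*(n+1)) N))          otherwise;
     H Y s M = Y (initc s M * 00...)                      if |s| >= M,
             = Y (s*0*H Y (s*1) M*...*H Y (s*M) M*00...)   otherwise.
   In the recursion step, v2 is the previous stage, as a function of the
   sequence, and v0 is the current sequence. *)
Definition Gfun {c} : tm c (ty2 ⇒ ι ⇒ ι ⇒ ι) :=
  λ λ λ
    Rec · (monus · v0 · (lh · v1))
        · (λ v3 · (pad · v0))
        · (λ λ λ v5 · (ext · (snoc · v0 · zero) · (λ v3 · (snoc · v1 · (succ · v0)))))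
    · v1.

Definition Hfun {c} : tm c (ty2 ⇒ ι ⇒ ι ⇒ ι) :=
  λ λ λ
    Rec · (monus · v0 · (lh · v1))
        · (λ v3 · (pad · (initc · v0 · v1)))
        · (λ λ λ v5 · (ext · (snoc · v0 · zero)
                           · (nth' · (seg · (λ v3 · (snoc · v1 · (succ · v0))) · v3))))
    · v1.

(* [GHstep Γ Z t] is the sequence t*0*(fun n => Γ Z (t*(n+1))). *)
Definition GHstep {c} : tm c ((ty2 ⇒ ι ⇒ ι) ⇒ ty2 ⇒ ι ⇒ ty1) :=
  λ λ λ ext · (snoc · v0 · zero) · (λ v3 · v2 · (snoc · v1 · (succ · v0))).

(* The internal language is that of E-PA^{omega*}; the external one adds st. *)
Inductive lang : Type := Int | Ext.
Definition is_ext (L : lang) : Prop := match L with Int => False | Ext => True end.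

Inductive fm (L : lang) (c : ctx) : Type :=
| fEq : forall {σ}, tm c σ -> tm c σ -> fm L c
| fSt : is_ext L -> forall {σ}, tm c σ -> fm L c
| fBot : fm L c
| fImp : fm L c -> fm L c -> fm L c
| fAll : forall σ, fm L (σ :: c) -> fm L c.
Arguments fEq {L c σ} t u.
Arguments fSt {L c} e {σ} t.
Arguments fBot {L c}.
Arguments fImp {L c} A B.
Arguments fAll {L c} σ A.
Bind Scope fm_scope with fm.

Definition st {c σ} (t : tm c σ) : fm Ext c := fSt (I : is_ext Ext) t.

(* Classical logic: the other connectives are the usual abbreviations. *)
Definition fNot {L c} (A : fm L c) : fm L c := fImp A fBot.
Definition fAnd {L c} (A B : fm L c) : fm L c := fNot (fImp A (fNot B)).
Definition fOr {L c} (A B : fm L c) : fm L c := fImp (fNot A) B.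
Definition fEx {L c} (σ : ty) (A : fm L (σ :: c)) : fm L c := fNot (fAll σ (fNot A)).
Definition fAllSt {c} (σ : ty) (A : fm Ext (σ :: c)) : fm Ext c :=
  fAll σ (fImp (st v0) A).
Definition fExSt {c} (σ : ty) (A : fm Ext (σ :: c)) : fm Ext c :=
  fEx σ (fAnd (st v0) A).

Notation "t ≡ u" := (fEq t%tm u%tm) (at level 70, no associativity) : fm_scope.
Notation "¬ A" := (fNot A) (at level 75, right associativity) : fm_scope.
Notation "A ∧ B" := (fAnd A B) (at level 80, right associativity) : fm_scope.
Notation "A ∨ B" := (fOr A B) (at level 85, right associativity) : fm_scope.
Notation "A ⊃ B" := (fImp A B) (at level 90, right associativity) : fm_scope.
Notation "∀[ σ ] A" := (fAll σ%ty A) (at level 10, A at level 95) : fm_scope.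
Notation "∃[ σ ] A" := (fEx σ%ty A) (at level 10, A at level 95) : fm_scope.
Notation "∀st[ σ ] A" := (fAllSt σ%ty A) (at level 10, A at level 95) : fm_scope.
Notation "∃st[ σ ] A" := (fExSt σ%ty A) (at level 10, A at level 95) : fm_scope.
Open Scope fm_scope.

Fixpoint fsubst {L c d} (θ : tsub c d) (A : fm L c) : fm L d :=
  match A with
  | fEq t u => fEq (tsubst θ t) (tsubst θ u)
  | fSt e t => fSt e (tsubst θ t)
  | fBot => fBot
  | fImp A B => fImp (fsubst θ A) (fsubst θ B)
  | fAll σ A => fAll σ (fsubst (up θ) A)
  end.

Fixpoint emb {c} (A : fm Int c) : fm Ext c :=
  match A with
  | fEq t u => fEq t u
  | fSt e t => match e with end
  | fBot => fBot
  | fImp A B => fImp (emb A) (emb B)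
  | fAll σ A => fAll σ (emb A)
  end.

Definition le {L c} (t u : tm c ι) : fm L c := monus · t · u ≡ zero.
Definition lt {L c} (t u : tm c ι) : fm L c := le (succ · t) u.

(* x ∈ w, and (x, y) ∈ (w, w').  There are no product types: a finite sequence
   of pairs is given by its two component sequences, read index by index. *)
Definition mem {L c σ} (x : tm c σ) (w : tm c (σ^*)) : fm L c :=
  ∃[ι] (lt v0 (len · wk w) ∧ nth' · wk w · v0 ≡ wk x).
Definition mem2 {L c σ τ} (x : tm c σ) (y : tm c τ) (w : tm c (σ^*)) (w' : tm c (τ^*))
  : fm L c :=
  ∃[ι] (lt v0 (len · wk w) ∧ lt v0 (len · wk w') ∧
        nth' · wk w · v0 ≡ wk x ∧ nth' · wk w' · v0 ≡ wk y).

Section Derivations.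
Context {L : lang} (Ax : forall c, fm L c -> Prop).

(* Natural deduction for classical many-sorted predicate logic; [c] lists the
   types of the free variables and [Δ] the open assumptions. *)
Inductive prv : forall c, list (fm L c) -> fm L c -> Prop :=
| p_ax : forall c Δ A, Ax c A -> prv c Δ A
| p_hyp : forall c Δ A, In A Δ -> prv c Δ A
| p_impI : forall c Δ A B, prv c (A :: Δ) B -> prv c Δ (A ⊃ B)
| p_impE : forall c Δ A B, prv c Δ (A ⊃ B) -> prv c Δ A -> prv c Δ B
| p_raa : forall c Δ A, prv c ((¬ A) :: Δ) fBot -> prv c Δ A
| p_allI : forall c Δ σ A,
    prv (σ :: c) (map (fsubst shift) Δ) A -> prv c Δ (∀[σ] A)
| p_allE : forall c Δ σ A (t : tm c σ),
    prv c Δ (∀[σ] A) -> prv c Δ (fsubst (inst t) A).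
End Derivations.

Inductive epa_ax : forall c, fm Int c -> Prop :=
| e_refl : forall c σ (t : tm c σ), epa_ax c (t ≡ t)
| e_sym : forall c σ (t u : tm c σ), epa_ax c (t ≡ u ⊃ u ≡ t)
| e_trans : forall c σ (t u v : tm c σ), epa_ax c (t ≡ u ⊃ u ≡ v ⊃ t ≡ v)
| e_cong : forall c σ τ (f g : tm c (σ ⇒ τ)) (t u : tm c σ),
    epa_ax c (f ≡ g ⊃ t ≡ u ⊃ f · t ≡ g · u)
| e_ext : forall c σ τ (f g : tm c (σ ⇒ τ)),
    epa_ax c ((∀[σ] wk f · v0 ≡ wk g · v0) ⊃ f ≡ g)
| e_K : forall c σ τ (x : tm c σ) (y : tm c τ),
    epa_ax c (tCst (cK σ τ) · x · y ≡ x)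
| e_S : forall c ρ σ τ (x : tm c (ρ ⇒ σ ⇒ τ)) (y : tm c (ρ ⇒ σ)) (z : tm c ρ),
    epa_ax c (tCst (cS ρ σ τ) · x · y · z ≡ x · z · (y · z))
| e_Rec0 : forall c σ (y : tm c σ) (z : tm c (σ ⇒ ι ⇒ σ)),
    epa_ax c (Rec · zero · y · z ≡ y)
| e_RecS : forall c σ (n : tm c ι) (y : tm c σ) (z : tm c (σ ⇒ ι ⇒ σ)),
    epa_ax c (Rec · (succ · n) · y · z ≡ z · (Rec · n · y · z) · n)
| e_succ0 : forall c (n : tm c ι), epa_ax c (¬ (succ · n ≡ zero))
| e_succ_inj : forall c (n m : tm c ι), epa_ax c (succ · n ≡ succ · m ⊃ n ≡ m)
| e_ind : forall c (A : fm Int (ι%ty :: c)),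
    epa_ax c (fsubst (inst zero) A
              ⊃ (∀[ι] (A ⊃ fsubst (scons (succ · v0) shift) A))
              ⊃ ∀[ι] A)
| e_seq : forall c σ (w : tm c (σ^*)),
    epa_ax c (w ≡ nil' ∨ ∃[σ] ∃[σ^*] wk (wk w) ≡ cons' · v1 · v0)
| e_LRec0 : forall c σ ρ (y : tm c ρ) (z : tm c (ρ ⇒ σ ⇒ ρ)),
    epa_ax c (LRec · nil' · y · z ≡ y)
| e_LRecS : forall c σ ρ (a : tm c σ) (w : tm c (σ^*)) (y : tm c ρ) (z : tm c (ρ ⇒ σ ⇒ ρ)),
    epa_ax c (LRec · (cons' · a · w) · y · z ≡ z · (LRec · w · y · z) · a).

(* In HAC the variables of φ are v0 = y and v1 = x, and [up (up shift)] makes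
   room for F; in idealisation they are v0 = z and v1 = y. *)
Inductive pst_ax : forall c, fm Ext c -> Prop :=
| P_epa : forall c A, epa_ax c A -> pst_ax c (emb A)
| P_st_eq : forall c σ (t u : tm c σ), pst_ax c (st t ∧ t ≡ u ⊃ st u)
| P_st_closed : forall c σ (t : tm nil σ), pst_ax c (st (tclose t))
| P_st_app : forall c σ τ (f : tm c (σ ⇒ τ)) (t : tm c σ),
    pst_ax c (st f ∧ st t ⊃ st (f · t))
| P_ind_st : forall c (A : fm Ext (ι%ty :: c)),
    pst_ax c (fsubst (inst zero) A
              ⊃ (∀st[ι] (A ⊃ fsubst (scons (succ · v0) shift) A))
              ⊃ ∀st[ι] A)
| P_HAC : forall c ρ τ (φ : fm Int (τ :: ρ :: c)),
    pst_ax c ((∀st[ρ] ∃st[τ] emb φ)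
              ⊃ ∃st[ρ ⇒ τ^*] ∀st[ρ] ∃[τ]
                  (mem v0 (v2 · v1) ∧ fsubst (up (up shift)) (emb φ)))
| P_ideal : forall c σ τ (φ : fm Int (σ :: τ :: c)),
    pst_ax c ((∀st[σ^*] ∃[τ] ∀[σ] (mem v0 v2 ⊃ fsubst (up (up shift)) (emb φ)))
              ⊃ ∃[τ] ∀st[σ] emb φ).

Definition EPA_proves (A : fm Int nil) : Prop := prv epa_ax nil nil A.
Definition P_proves (A : fm Ext nil) : Prop := prv pst_ax nil nil A.

Definition le1 {L c} (f : tm c ty1) : fm L c := ∀[ι] le (wk f · v0) (succ · zero).

Definition approx {c} (f g : tm c ty1) : fm Ext c := ∀st[ι] wk f · v0 ≡ wk g · v0.

(* bound variables: v2 = f, v1 = N, v0 = g *)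
Definition inC {L c} (Y : tm c ty2) : fm L c :=
  ∀[ty1] ∃[ι] ∀[ty1]
    (segc · v0 · v1 ≡ segc · v2 · v1 ⊃ wk (wk (wk Y)) · v2 ≡ wk (wk (wk Y)) · v0).

Definition STP {c} : fm Ext c := ∀[ty1] (le1 v0 ⊃ ∃st[ty1] (le1 v0 ∧ approx v1 v0)).

(* bound variables: v2 = Y, v1 = f, v0 = g *)
Definition NPC {c} : fm Ext c :=
  ∀st[ty2] (inC v0 ⊃ ∀st[ty1] ∀[ty1] (approx v1 v0 ⊃ v2 · v1 ≡ v2 · v0)).

Definition GH {L c} (Γ : tm c (ty2 ⇒ ι ⇒ ι)) (Z : tm c ty2) (t : tm c ι) : fm L c :=
  Γ · Z · t ≡ Z · (GHstep · Γ · Z · t).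

Definition GHst {c} (Γ : tm c (ty2 ⇒ ι ⇒ ι)) : fm Ext c :=
  ∀st[ty2] (inC v0 ⊃ ∀st[ι] GH (wk (wk Γ)) v1 v0).

(* bound variables: v2 = Y, v1 = s, v0 = N *)
Definition CA {c} (Γ : tm c (ty2 ⇒ ι ⇒ ι)) : fm Ext c :=
  ∀st[ty2] (inC v0 ⊃ ∀st[ι] ∀[ι] (¬ st v0 ⊃
    Gfun · v2 · v1 · v0 ≡ Hfun · v2 · v1 · v0 ∧
    Hfun · v2 · v1 · v0 ≡ wk (wk (wk Γ)) · v2 · v1)).

Definition star : fm Ext nil :=
  ∀[ty2 ⇒ ι ⇒ ι] (GHst v0 ∧ STP ∧ NPC ⊃ CA v0).

(* T is (the characteristic function of) a set of codes of binary sequences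
   that is closed under initial segments. *)
Definition inT {L c} (s : tm c ι) (T : tm c ty1) : fm L c := T · s ≡ succ · zero.
Definition bintree {L c} (T : tm c ty1) : fm L c :=
  le1 T ∧
  ∀[ι] (inT v0 (wk T) ⊃
    (∀[ι] (lt v0 (lh · v1) ⊃ le (pad · v1 · v0) (succ · zero))) ∧
    (∀[ι] (le v0 (lh · v1) ⊃ inT (initc · v1 · v0) (wk (wk T))))).

(* Θ1 W = Θ(W)(1) and Θ2 W = Θ(W)(2).  Bound variables: T, then α, and β, i. *)
Definition SCF {L c} (Θ1 : tm c (ty2 ⇒ ι)) (Θ2 : tm c (ty2 ⇒ ty1^*)) (W : tm c ty2)
  : fm L c :=
  ∀[ty1] (bintree v0 ⊃
    (∀[ty1] (mem v0 (wk (wk Θ2) · wk (wk W)) ⊃ le1 v0 ⊃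
               ¬ inT (segc · v0 · (wk (wk W) · v0)) v1)) ⊃
    (∀[ty1] (le1 v0 ⊃
       ∃[ι] (le v0 (wk (wk (wk Θ1)) · wk (wk (wk W))) ∧ ¬ inT (segc · v1 · v0) v2)))).

Definition MPC {L c} (Ψ : tm c (ty2 ⇒ ty1 ⇒ ι)) (V : tm c ty2) (f : tm c ty1) : fm L c :=
  ∀[ty1] (segc · wk f · (wk Ψ · wk V · wk f) ≡ segc · v0 · (wk Ψ · wk V · wk f)
          ⊃ wk V · wk f ≡ wk V · v0).

(* The type of a functional of Y, s and Ξ = (Θ, Ψ), where Θ = (Θ(.)(1), Θ(.)(2)). *)
Definition tyHER (τ : ty) : ty :=
  ty2 ⇒ ι ⇒ (ty2 ⇒ ι) ⇒ (ty2 ⇒ ty1^*) ⇒ (ty2 ⇒ ty1 ⇒ ι) ⇒ τ.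

(* The tuple of closed terms i: the components of i(1) (pairs Z, t), of i(2)
   (functionals W) and of i(3) (pairs V, f). *)
Record iterms : Type := ITerms {
  i1Z : tm nil (tyHER (ty2^*));
  i1t : tm nil (tyHER (ι^*));
  i2W : tm nil (tyHER (ty2^*));
  i3V : tm nil (tyHER (ty2^*));
  i3f : tm nil (tyHER (ty1^*))
}.

(* In [HERbody] the free variables are
   v5 = Θ1, v4 = Θ2, v3 = Ψ, v2 = Γ, v1 = Y, v0 = s. *)
Definition HERctx : ctx :=
  [ι; ty2; ty2 ⇒ ι ⇒ ι; ty2 ⇒ ty1 ⇒ ι; ty2 ⇒ ty1^*; ty2 ⇒ ι]%ty.

Definition atYsΞ {τ} (t : tm nil (tyHER τ)) : tm HERctx τ :=
  tclose t · v1 · v0 · v5 · v4 · v3.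

Definition HERbody (i : iterms) (o : tm nil (tyHER ι)) : fm Int HERctx :=
  (∀[ty2] ∀[ι] (mem2 v1 v0 (wk (wk (atYsΞ (i1Z i)))) (wk (wk (atYsΞ (i1t i)))) ⊃
                  inC v1 ⊃ GH v4 v1 v0)) ∧
  (∀[ty2] (mem v0 (wk (atYsΞ (i2W i))) ⊃ SCF v6 v5 v0)) ∧
  (∀[ty2] ∀[ty1] (mem2 v1 v0 (wk (wk (atYsΞ (i3V i)))) (wk (wk (atYsΞ (i3f i)))) ⊃
                    inC v1 ⊃ MPC v5 v1 v0))
  ⊃ ∀[ι] (le (wk (atYsΞ o)) v0 ⊃ Gfun · v2 · v1 · v0 ≡ v3 · v2 · v1).

Definition HER (i : iterms) (o : tm nil (tyHER ι)) : fm Int nil :=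
  ∀[ty2 ⇒ ι] ∀[ty2 ⇒ ty1^*] ∀[ty2 ⇒ ty1 ⇒ ι] ∀[ty2 ⇒ ι ⇒ ι]
    ∀[ty2] (inC v0 ⊃ ∀[ι] HERbody i o).

(* Main.v *)
(** Everything is proved in models, and Henkin's construction turns validity into derivability.

    (a) Suppose that no [i], [o] work. By compactness there are a model of E-PA and Y, s, Θ, Ψ, Γ, N in
    it such that GH, SCF and MPC hold at all entries of all finite sequences named by closed terms in
    Y, s, Θ, Ψ, such that N exceeds all such entries, and G(Y,s,N) <> Γ(Y,s). This is extended to a
    generic model of P in which exactly the entries of named finite sequences are standard. The
    conditions are finite sets of internal facts and of requirements "θ(y) for all standard y". If a
    condition does not admit a new standard x with the requirement ¬φ(x,y), then compactness yields a
    term w(x), one of whose entries y satisfies φ(x,y), and F = λx.w(x) witnesses HAC; idealisation is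
    similar. External formulas then have ∀st∃st normal forms, for which external induction is forced
    with the recursor. In the generic model SCF gives STP and MPC gives NPC, but CA(Γ) fails.

    (b) In a model of P, STP and NPC give standard Θ and Ψ by idealisation and HAC, so HER yields
    G(Y,s,N) = Γ(Y,s) for nonstandard N, with standard value g(s). If H(Y,s,N) <> g(s), then NPC gives a
    standard n with H(Y,s*(n+1),N) <> g(s*(n+1)). By STP the set of these sequences agrees with a standard
    set, so iteration yields a standard path α, and the continuity of Y at α is contradicted. *)
From Stdlib Require Import List Classical ClassicalEpsilon FunctionalExtensionality PropExtensionality ProofIrrelevance Eqdep_dec Arith Lia Cantor.
Require Import Defs.
Import ListNotations.

(** A classical consistency argument never singles out a witness: it yields a term for a finite list
    with a witness among its entries. Defining standardness in the generic model by lists makes all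
    candidates standard at once, and flattening lists keeps it closed under application and under
    taking entries.

    The parity of a parameter records its role. Even parameters name standard objects; odd ones name
    arbitrary objects, such as Henkin witnesses, elements given by idealisation, Γ and N. A term for
    a standard list mentions no odd parameter. This is the uniformity that idealisation needs, and
    it is why the extracted lists depend on Y, s, Θ and Ψ only.

    A requirement quantifies over the standard objects and is not an internal sentence; compactness
    is applied to its internal instances, one for each standard list.

    In (b), neither Γ nor H(Y,.,N) is standard, so neither may occur in the recursion for a standard
    path. Γ is replaced by G at the bound given by o, and the comparison with H by the standard set
    from STP, which is correct at standard arguments only. Each step of the path must therefore
    search below a standard bound, which the modulus Ψ provides. *)

Arguments lam : simpl never.

(** * Substitution *)

Lemma var_nil {σ} (x : var nil σ) : False.
Proof.
  exact (match x in var c _ return match c with nil => False | _ => True end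
         with vz => I | vs _ => I end).
Qed.

Lemma scons_ext {c d σ} (θ θ' : tsub (σ :: c) d) :
  θ σ vz = θ' σ vz -> (forall τ (x : var c τ), θ τ (vs x) = θ' τ (vs x)) -> θ = θ'.
Proof.
  intros H0 HS. extensionality τ. extensionality x.
  revert θ θ' H0 HS.
  refine (match x in var e τ return
    match e as e return var e τ -> Prop with
    | nil => fun _ => True
    | σ :: c => fun x => forall θ θ' : tsub (σ :: c) d, θ σ vz = θ' σ vz ->
         (forall τ (x : var c τ), θ τ (vs x) = θ' τ (vs x)) -> θ τ x = θ' τ x end x
    with vz => _ | vs y => _ end); auto.
Qed.

Lemma tsub_nil {d} (θ θ' : tsub nil d) : θ = θ'.
Proof.
  extensionality τ. extensionality x.
  destruct (var_nil x).
Qed.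

Definition tcomp {c d e} (θ' : tsub d e) (θ : tsub c d) : tsub c e :=
  fun τ x => tsubst θ' (θ τ x).
Definition tid {c} : tsub c c := fun _ x => tVar x.

Lemma tsubst_comp {c d e τ} (θ' : tsub d e) (θ : tsub c d) (t : tm c τ) :
  tsubst θ' (tsubst θ t) = tsubst (tcomp θ' θ) t.
Proof. induction t; cbn; [reflexivity | reflexivity | congruence]. Qed.

Lemma tsubst_id {c τ} (t : tm c τ) : tsubst tid t = t.
Proof. induction t; cbn; [reflexivity | reflexivity | congruence]. Qed.

Lemma up_comp {c d e σ} (θ' : tsub d e) (θ : tsub c d) :
  tcomp (up θ') (@up _ _ σ θ) = up (tcomp θ' θ).
Proof.
  apply scons_ext; [reflexivity|]. intros τ x. unfold tcomp, up; cbn.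
  unfold wk. rewrite !tsubst_comp. reflexivity.
Qed.

Lemma up_id {c σ} : @up c c σ tid = tid.
Proof. apply scons_ext; reflexivity. Qed.

Lemma fsubst_comp {L c} (A : fm L c) : forall d e (θ' : tsub d e) (θ : tsub c d),
  fsubst θ' (fsubst θ A) = fsubst (tcomp θ' θ) A.
Proof.
  induction A; intros; cbn; rewrite ?tsubst_comp; try congruence.
  rewrite IHA, up_comp. reflexivity.
Qed.

Lemma fsubst_id {L c} (A : fm L c) : fsubst tid A = A.
Proof.
  induction A; cbn; rewrite ?tsubst_id; try congruence. rewrite up_id. congruence.
Qed.

Lemma tsubst_up_wk {c d σ τ} (θ : tsub c d) (t : tm c τ) :
  tsubst (@up _ _ σ θ) (wk t) = wk (tsubst θ t).
Proof. unfold wk. rewrite !tsubst_comp. reflexivity. Qed.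

Lemma tdrop_wk {c σ τ} (t : tm c τ) : tdrop (@wk c σ τ t) = Some t.
Proof.
  induction t; [reflexivity | reflexivity |].
  unfold wk in *. cbn. rewrite IHt1, IHt2. reflexivity.
Qed.

Lemma lam_wk {c σ τ} (t : tm c τ) : lam (@wk c σ τ t) = tCst (cK _ _) · t.
Proof.
  pose proof (@tdrop_wk c σ τ t) as H. destruct t; [reflexivity | reflexivity |].
  unfold lam. cbn in H |- *. rewrite H. reflexivity.
Qed.

Lemma tdrop_up {c d σ τ} (θ : tsub c d) (t : tm (σ :: c) τ) :
  tdrop (tsubst (up θ) t) = option_map (tsubst θ) (tdrop t).
Proof.
  induction t; cbn.
  - revert d θ.
    refine (match v in var e τ return
    match e as e return var e τ -> Prop with
    | nil => fun _ => True
    | σ :: c => fun x => forall d (θ : tsub c d),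
      tdrop (up θ _ x) = option_map (tsubst θ) (option_map tVar (vdrop x)) end v
    with vz => _ | vs y => _ end); [reflexivity|].
    intros d θ. apply tdrop_wk.
  - reflexivity.
  - rewrite IHt1, IHt2. destruct (tdrop t1), (tdrop t2); reflexivity.
Qed.

(** The equality is syntactic because [lam] tests with [tdrop] whether the variable occurs. When a
    compound term replaces another variable, the result is still a single [cK], where plain bracket
    abstraction would produce a nest of [cS]. *)
Lemma tsubst_lam {c d σ τ} (θ : tsub c d) (t : tm (σ :: c) τ) :
  tsubst θ (lam t) = lam (tsubst (up θ) t).
Proof.
  induction t.
  - revert d θ.
    refine (match v in var e τ return
    match e as e return var e τ -> Prop with
    | nil => fun _ => True
    | σ :: c => fun x => forall d (θ : tsub c d),
      tsubst θ (lam (tVar x)) = lam (tsubst (up θ) (tVar x)) end v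
    with vz => _ | vs y => _ end); [reflexivity|].
    intros d θ. symmetry. apply lam_wk.
  - reflexivity.
  - pose proof (tdrop_up θ (t1 · t2)) as H. cbn in H |- *. unfold lam; fold @lam. cbn.
    rewrite H. destruct (tdrop t1), (tdrop t2); cbn; auto;
    rewrite <- IHt1, <- IHt2; reflexivity.
Qed.

Lemma tsubst_dflt {c d} (θ : tsub c d) σ : tsubst θ (dflt σ) = dflt σ.
Proof. induction σ; cbn; [reflexivity | congruence | reflexivity]. Qed.

Lemma emb_fsubst {c} (A : fm Int c) : forall d (θ : tsub c d), emb (fsubst θ A) = fsubst θ (emb A).
Proof. induction A; intros; cbn; try congruence. destruct i. Qed.

(** * Structures *)

Record structure : Type := Structure {
  D : ty -> Type;
  ap : forall {σ τ}, D (σ ⇒ τ) -> D σ -> D τ;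
  kc : forall {σ}, cst σ -> D σ
}.
Arguments ap {s σ τ} f a.
Arguments kc {s σ} k.

Definition env (M : structure) (c : ctx) : Type := forall σ, var c σ -> D M σ.
Definition spred (M : structure) : Type := forall σ, D M σ -> Prop.

Section Evaluation.
Context {M : structure} {c : ctx} (e : env M c).
Fixpoint ev {τ} (t : tm c τ) : D M τ :=
  match t with
  | tVar x => e _ x
  | tCst k => kc k
  | tApp f a => ap (ev f) (ev a)
  end.
End Evaluation.

Definition enil {M} : env M nil :=
  fun τ x => match x in var e _ return match e with nil => D M τ | _ => unit end with
             | vz => tt
             | vs _ => tt
             end.

Definition econs {M c σ} (a : D M σ) (e : env M c) : env M (σ :: c) :=
  fun τ x =>
    match x in var e τ
      return match e with
             | nil => unit
             | σ :: c => D M σ -> env M c -> D M τ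
             end
    with
    | vz => fun a _ => a
    | vs y => fun _ e => e _ y
    end a e.

Definition etl {M c σ} (e : env M (σ :: c)) : env M c := fun τ x => e τ (vs x).

Section Satisfaction.
Context {M : structure} (S : spred M) {L : lang}.
Fixpoint sat {c} (A : fm L c) (e : env M c) : Prop :=
  match A with
  | fEq t u => ev e t = ev e u
  | fSt _ t => S _ (ev e t)
  | fBot => False
  | fImp A B => sat A e -> sat B e
  | fAll σ A => forall a : D M σ, sat A (econs a e)
  end.
End Satisfaction.

(** The truth of internal formulas does not depend on the predicate ([sat_emb]); this is a fixed
    choice for them. *)
Definition nost {M} : spred M := fun _ _ => False.
Notation isat := (sat nost).

Lemma env_ext {M c σ} (e e' : env M (σ :: c)) :
  e σ vz = e' σ vz -> etl e = etl e' -> e = e'.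
Proof.
  intros H0 HS. extensionality τ. extensionality x.
  revert e e' H0 HS.
  refine (match x in var e τ return
    match e as e return var e τ -> Prop with
    | nil => fun _ => True
    | σ :: c => fun x => forall θ θ' : env M (σ :: c), θ σ vz = θ' σ vz ->
         etl θ = etl θ' -> θ τ x = θ' τ x end x
    with vz => _ | vs y => _ end); auto.
  intros θ θ' _ E. exact (f_equal (fun f => f _ y) E).
Qed.

Lemma env_nil {M} (e e' : env M nil) : e = e'.
Proof.
  extensionality τ. extensionality x.
  destruct (var_nil x).
Qed.

Lemma econs_eta {M c σ} (e : env M (σ :: c)) : econs (e σ vz) (etl e) = e.
Proof. apply env_ext; reflexivity. Qed.

Definition esub {M c d} (θ : tsub c d) (e : env M d) : env M c := fun σ x => ev e (θ σ x).

Lemma ev_subst {M c d τ} (θ : tsub c d) (t : tm c τ) (e : env M d) :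
  ev e (tsubst θ t) = ev (esub θ e) t.
Proof. induction t; cbn; [reflexivity | reflexivity | congruence]. Qed.

Lemma ev_wk {M c σ τ} (t : tm c τ) (a : D M σ) (e : env M c) : ev (econs a e) (wk t) = ev e t.
Proof. unfold wk. rewrite ev_subst. reflexivity. Qed.

Lemma esub_up {M c d σ} (θ : tsub c d) (a : D M σ) (e : env M d) :
  esub (up θ) (econs a e) = econs a (esub θ e).
Proof.
  apply env_ext; [reflexivity|]. extensionality τ. extensionality x.
  unfold etl, esub, up; cbn. apply ev_wk.
Qed.

(** Satisfaction is compared by equality of propositions, not by equivalence, so that plain
    rewriting applies to it throughout. *)
Lemma sat_subst {M} (S : spred M) {L c} (A : fm L c) : forall d (θ : tsub c d) (e : env M d),
  sat S (fsubst θ A) e = sat S A (esub θ e).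
Proof.
  induction A; intros; cbn; rewrite ?ev_subst; try congruence.
  enough (H : (fun a => sat S (fsubst (up θ) A) (econs a e))
            = (fun a => sat S A (econs a (esub θ e)))).
  { change ((forall a, (fun a => sat S (fsubst (up θ) A) (econs a e)) a) =
      (forall a, (fun a => sat S A (econs a (esub θ e))) a)). rewrite H. reflexivity. }
  extensionality a. rewrite IHA, esub_up. reflexivity.
Qed.

Lemma esub_scons {M c d σ} (t : tm d σ) (θ : tsub c d) (e : env M d) :
  esub (scons t θ) e = econs (ev e t) (esub θ e).
Proof. apply env_ext; reflexivity. Qed.

Lemma sat_inst {M} (S : spred M) {L c σ} (A : fm L (σ :: c)) (t : tm c σ) (e : env M c) :
  sat S (fsubst (inst t) A) e = sat S A (econs (ev e t) e).
Proof. rewrite sat_subst. unfold inst. rewrite esub_scons. reflexivity. Qed.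

Lemma sat_emb {M} (S S' : spred M) {c} (A : fm Int c) (e : env M c) :
  sat S (emb A) e = sat S' A e.
Proof.
  induction A; cbn; try congruence. { destruct i. }
  enough (H : (fun a => sat S (emb A) (econs a e)) = (fun a => sat S' A (econs a e))).
  { change ((forall a, (fun a => sat S (emb A) (econs a e)) a) =
      (forall a, (fun a => sat S' A (econs a e)) a)). rewrite H. reflexivity. }
  extensionality a. apply IHA.
Qed.

Lemma sat_imp {M} (S : spred M) {L c} (A B : fm L c) e :
  sat S (fImp A B) e = (sat S A e -> sat S B e).
Proof. reflexivity. Qed.

Lemma sat_all {M} (S : spred M) {L c σ} (A : fm L (σ :: c)) e :
  sat S (fAll σ A) e = (forall a, sat S A (econs a e)).
Proof. reflexivity. Qed.

Lemma sat_allst {M} (S : spred M) {c σ} (A : fm Ext (σ :: c)) e :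
  sat S (fAllSt σ A) e = (forall a, S σ a -> sat S A (econs a e)).
Proof. reflexivity. Qed.

Lemma sat_not {M} (S : spred M) {L c} (A : fm L c) e : sat S (fNot A) e = ~ sat S A e.
Proof. reflexivity. Qed.

Lemma sat_and {M} (S : spred M) {L c} (A B : fm L c) e :
  sat S (fAnd A B) e = (sat S A e /\ sat S B e).
Proof. apply propositional_extensionality. cbn. split; [|tauto]. intro. apply NNPP. tauto. Qed.

Lemma sat_or {M} (S : spred M) {L c} (A B : fm L c) e :
  sat S (fOr A B) e = (sat S A e \/ sat S B e).
Proof. apply propositional_extensionality. cbn. split; [|tauto]. intro. apply NNPP. tauto. Qed.

Lemma sat_ex {M} (S : spred M) {L c σ} (A : fm L (σ :: c)) e :
  sat S (fEx σ A) e = (exists a, sat S A (econs a e)).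
Proof.
  apply propositional_extensionality. cbn. split.
  - intro H. apply NNPP. intro K. apply H. intros a Ha. apply K. eauto.
  - intros [a Ha] K. exact (K a Ha).
Qed.

Lemma sat_exst {M} (S : spred M) {c σ} (A : fm Ext (σ :: c)) e :
  sat S (fExSt σ A) e = (exists a, S σ a /\ sat S A (econs a e)).
Proof.
  unfold fExSt. rewrite sat_ex. f_equal. extensionality a. rewrite sat_and. reflexivity.
Qed.

(** * Soundness, and models of the two systems *)

Lemma prv_sound {L} (Ax : forall c, fm L c -> Prop) {M} (S : spred M) :
  (forall c A, Ax c A -> forall e, sat S A e) ->
  forall c Δ A, prv Ax c Δ A -> forall e, (forall B, In B Δ -> sat S B e) -> sat S A e.
Proof.
  intros HAx c Δ A H. induction H; intros e HΔ; cbn.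
  - exact (HAx _ _ H e).
  - exact (HΔ _ H).
  - intro. apply IHprv. intros C [<- | HC]; auto.
  - exact (IHprv1 e HΔ (IHprv2 e HΔ)).
  - apply NNPP. intro HA. refine (IHprv e _). intros C [<- | HC]; auto.
  - intro a. apply IHprv. intros B HB. apply in_map_iff in HB as [C [<- HC]].
    rewrite sat_subst. apply HΔ, HC.
  - rewrite sat_inst. apply (IHprv e HΔ).
Qed.

Definition epa_model (M : structure) : Prop :=
  forall c A, epa_ax c A -> forall e : env M c, isat A e.

Definition pst_model (M : structure) (S : spred M) : Prop :=
  forall c A, pst_ax c A -> forall e : env M c, sat S A e.

Lemma ty_eq_dec (σ τ : ty) : {σ = τ} + {σ <> τ}.
Proof. decide equality. Defined.

Definition upd {F : ty -> Type} (m : forall τ, nat -> F τ) (σ : ty) (k : nat) (a : F σ) :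
    forall τ, nat -> F τ :=
  fun τ j => match ty_eq_dec σ τ with
             | left E => if Nat.eq_dec j k then eq_rect σ F a τ E else m τ j
             | right _ => m τ j
             end.

Lemma upd_same {F : ty -> Type} (m : forall τ, nat -> F τ) σ k (a : F σ) : upd m σ k a σ k = a.
Proof.
  unfold upd. destruct (ty_eq_dec σ σ); [|congruence]. destruct (Nat.eq_dec k k); [|congruence].
  symmetry. apply eq_rect_eq_dec, ty_eq_dec.
Qed.

Lemma upd_other {F : ty -> Type} (m : forall τ, nat -> F τ) σ k (a : F σ) τ j :
  (τ <> σ \/ j <> k) -> upd m σ k a τ j = m τ j.
Proof.
  unfold upd. intros H. destruct (ty_eq_dec σ τ); auto. destruct (Nat.eq_dec j k); auto.
  destruct H; congruence.
Qed.

Lemma inj_ty (F : ty -> Type) σ (x y : F σ) : existT F σ x = existT F σ y -> x = y.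
Proof. apply inj_pair2_eq_dec, ty_eq_dec. Qed.

(** * Closures over named parameters *)

Inductive ptm : ty -> Type :=
| pPar : forall σ, nat -> ptm σ
| pCst : forall {σ}, cst σ -> ptm σ
| pApp : forall {σ τ}, ptm (σ ⇒ τ) -> ptm σ -> ptm τ.

(** With terms as the elements of a structure, evaluation doubles as substitution: an [env PT c]
    replaces variables by terms with parameters, and an [assign (TM d)] replaces parameters by terms
    in context [d]. *)
Definition PT : structure := Structure ptm (@pApp) (@pCst).
Definition TM (d : ctx) : structure := Structure (tm d) (@tApp d) (@tCst d).

Definition assign (M : structure) : Type := forall σ, nat -> D M σ.

Fixpoint pe {M : structure} (ρ : assign M) {τ} (t : ptm τ) : D M τ :=
  match t with
  | pPar σ k => ρ σ k
  | pCst k => kc k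
  | pApp f a => ap (pe ρ f) (pe ρ a)
  end.

Definition penv {M c} (ρ : assign M) (e : env PT c) : env M c := fun σ x => pe ρ (e σ x).

Lemma pe_ev {M c τ} (ρ : assign M) (e : env PT c) (t : tm c τ) :
  pe ρ (ev e t : ptm τ) = ev (penv ρ e) t.
Proof. induction t; cbn; [reflexivity | reflexivity | congruence]. Qed.

Lemma penv_econs {M c σ} (ρ : assign M) (t : ptm σ) (e : env PT c) :
  penv ρ (econs (t : D PT σ) e) = econs (pe ρ t) (penv ρ e).
Proof. apply env_ext; reflexivity. Qed.

(** A sentence about parameters, kept as a formula with a delayed substitution, since the term
    language itself has no constants for parameters. *)
Record closure (L : lang) : Type := Cl { cc : ctx; cA : fm L cc; ce : env PT cc }.
Arguments Cl {L cc} cA ce.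
Arguments cc {L} c.
Arguments cA {L} c.
Arguments ce {L} c.

Definition ctrue {M} (S : spred M) (ρ : assign M) {L} (x : closure L) : Prop :=
  sat S (cA x) (penv ρ (ce x)).

Fixpoint pfresh (k : nat) {τ} (t : ptm τ) : Prop :=
  match t with
  | pPar _ j => j <> k
  | pCst _ => True
  | pApp f a => pfresh k f /\ pfresh k a
  end.
Definition efresh (k : nat) {c} (e : env PT c) : Prop := forall σ x, pfresh k (e σ x : ptm σ).

Lemma pfresh_ex {τ} (t : ptm τ) : exists N, forall k, N <= k -> pfresh k t.
Proof.
  induction t as [σ j|σ k|σ τ f [N HN] a [N' HN']].
  - exists (S j). cbn. lia.
  - exists 0. cbn. auto.
  - exists (N + N'). cbn. intros. split; [apply HN|apply HN']; lia.
Qed.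

Lemma efresh_ex {c} (e : env PT c) : exists N, forall k, N <= k -> efresh k e.
Proof.
  induction c as [|σ c IH].
  - exists 0. intros k _ σ x. destruct (var_nil x).
  - destruct (IH (etl e)) as [N HN], (pfresh_ex (e σ vz)) as [N' HN'].
    exists (N + N'). intros k Hk τ x.
    assert (H1 : pfresh k (e σ vz : ptm σ)) by (apply HN'; lia).
    assert (H2 : efresh k (etl e)) by (apply HN; lia). clear - H1 H2. revert e H1 H2.
    refine (match x in var e τ return
    match e as e return var e τ -> Prop with
    | nil => fun _ => True
    | σ :: c => fun x => forall e : env PT (σ :: c), pfresh k (e σ vz : ptm σ) -> efresh k (etl e) ->
         pfresh k (e τ x : ptm τ) end x
    with vz => _ | vs y => _ end); auto. intros e _ H. exact (H _ y).
Qed.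

Lemma cfresh_ex {L} (l : list (closure L)) :
  exists N, forall k, N <= k -> forall x, In x l -> efresh k (ce x).
Proof.
  induction l as [|x l [N HN]].
  - exists 0. cbn. tauto.
  - destruct (efresh_ex (ce x)) as [N' HN']. exists (N + N').
    intros k Hk y [<- | Hy]; [apply HN'; lia | apply HN; auto; lia].
Qed.

Lemma pe_fresh {M τ} (ρ : assign M) σ k a (t : ptm τ) : pfresh k t -> pe (upd ρ σ k a) t = pe ρ t.
Proof.
  induction t; cbn; intros H.
  - apply upd_other. auto.
  - reflexivity.
  - destruct H. f_equal; auto.
Qed.

Lemma penv_fresh {M c} (ρ : assign M) σ k a (e : env PT c) :
  efresh k e -> penv (upd ρ σ k a) e = penv ρ e.
Proof. intros H. extensionality τ. extensionality x. apply pe_fresh, H. Qed.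

(** * Closures are countable *)

Definition p2 (a b : nat) : nat := to_nat (a, b).
Lemma p2_inj a b a' b' : p2 a b = p2 a' b' -> a = a' /\ b = b'.
Proof. unfold p2. intros H. apply to_nat_inj in H. injection H. auto. Qed.

Arguments p2 : simpl never.

Ltac p2inv := repeat match goal with H : p2 _ _ = p2 _ _ |- _ => apply p2_inj in H; destruct H end.

Fixpoint enc_ty (σ : ty) : nat :=
  match σ with
  | tyN => p2 0 0
  | tyArr σ τ => p2 1 (p2 (enc_ty σ) (enc_ty τ))
  | tyStar σ => p2 2 (enc_ty σ)
  end.
Lemma enc_ty_inj σ : forall τ, enc_ty σ = enc_ty τ -> σ = τ.
Proof.
  induction σ; destruct τ; cbn; intros H; p2inv; try discriminate; auto.
  - f_equal; auto.
  - f_equal; auto.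
Qed.

Fixpoint enc_ctx (c : ctx) : nat :=
  match c with nil => p2 0 0 | σ :: c => p2 1 (p2 (enc_ty σ) (enc_ctx c)) end.
Lemma enc_ctx_inj c : forall d, enc_ctx c = enc_ctx d -> c = d.
Proof.
  induction c; destruct d; cbn; intros H; p2inv; try discriminate; auto.
  f_equal; auto using enc_ty_inj.
Qed.

Fixpoint enc_var {c τ} (x : var c τ) : nat := match x with vz => 0 | vs y => S (enc_var y) end.
Lemma enc_var_inj c τ (x : var c τ) : forall τ' (y : var c τ'), enc_var x = enc_var y ->
  existT (var c) τ x = existT (var c) τ' y.
Proof.
  induction x; intros τ'' y.
  - refine (match y in var c' τ' return
      match c' as c' return var c' τ' -> Prop with nil => fun _ => True
      | σ :: c => fun y => enc_var (@vz c σ) = enc_var y -> existT (var (σ :: c)) σ vz = existT _ τ' y end y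
      with vz => _ | vs y => _ end); cbn; [reflexivity|discriminate].
  - revert x IHx.
    refine (match y in var c' τ' return
      match c' as c' return var c' τ' -> Prop with nil => fun _ => True
      | σ :: c => fun y => forall x : var c τ, (forall τ' (y : var c τ'), enc_var x = enc_var y ->
           existT (var c) τ x = existT (var c) τ' y) ->
         enc_var (@vs c σ τ x) = enc_var y -> existT (var (σ :: c)) τ (vs x) = existT _ τ' y end y
      with vz => _ | vs y => _ end); cbn; [discriminate|].
    intros x IH H. injection H as H. apply IH in H.
    pose proof (f_equal (@projT1 _ _) H) as E. cbn in E. subst. apply inj_ty in H. subst. reflexivity.
Qed.

Definition enc_cst {τ} (k : cst τ) : nat :=
  match k with
  | cZero => p2 0 0
  | cSucc => p2 1 0
  | cK σ τ => p2 2 (p2 (enc_ty σ) (enc_ty τ))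
  | cS ρ σ τ => p2 3 (p2 (enc_ty ρ) (p2 (enc_ty σ) (enc_ty τ)))
  | cRec σ => p2 4 (enc_ty σ)
  | cNil σ => p2 5 (enc_ty σ)
  | cCons σ => p2 6 (enc_ty σ)
  | cLRec σ ρ => p2 7 (p2 (enc_ty σ) (enc_ty ρ))
  end.
Ltac tyinv := repeat match goal with H : enc_ty _ = enc_ty _ |- _ => apply enc_ty_inj in H end; subst.
Lemma enc_cst_inj τ (k : cst τ) τ' (k' : cst τ') : enc_cst k = enc_cst k' ->
  existT cst τ k = existT cst τ' k'.
Proof. destruct k, k'; cbn; intros H; p2inv; try discriminate; tyinv; reflexivity. Qed.

Ltac exinv H := let E := fresh in
  pose proof (f_equal (@projT1 _ _) H) as E; cbn in E;
  first [injection E as ? ?|idtac]; subst; apply inj_ty in H; subst.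

Fixpoint enc_tm {c τ} (t : tm c τ) : nat :=
  match t with
  | tVar x => p2 0 (enc_var x)
  | tCst k => p2 1 (enc_cst k)
  | tApp f a => p2 2 (p2 (enc_tm f) (enc_tm a))
  end.
Lemma enc_tm_inj c τ (t : tm c τ) : forall τ' (u : tm c τ'), enc_tm t = enc_tm u ->
  existT (tm c) τ t = existT (tm c) τ' u.
Proof.
  induction t; intros τ' u; destruct u; cbn; intros H; p2inv; try discriminate.
  - apply enc_var_inj in H0. exinv H0. reflexivity.
  - apply enc_cst_inj in H0. exinv H0. reflexivity.
  - apply IHt1 in H0. apply IHt2 in H1. exinv H0. exinv H1. reflexivity.
Qed.

Fixpoint enc_ptm {τ} (t : ptm τ) : nat :=
  match t with
  | pPar σ k => p2 0 (p2 (enc_ty σ) k)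
  | pCst k => p2 1 (enc_cst k)
  | pApp f a => p2 2 (p2 (enc_ptm f) (enc_ptm a))
  end.
Lemma enc_ptm_inj τ (t : ptm τ) : forall τ' (u : ptm τ'), enc_ptm t = enc_ptm u ->
  existT ptm τ t = existT ptm τ' u.
Proof.
  induction t; intros τ' u; destruct u; cbn; intros H; p2inv; try discriminate.
  - tyinv. reflexivity.
  - apply enc_cst_inj in H0. exinv H0. reflexivity.
  - apply IHt1 in H0. apply IHt2 in H1. exinv H0. exinv H1. reflexivity.
Qed.

Fixpoint enc_fm {L c} (A : fm L c) : nat :=
  match A with
  | @fEq _ _ σ t u => p2 0 (p2 (enc_tm t) (enc_tm u))
  | fSt _ t => p2 1 (enc_tm t)
  | fBot => p2 2 0
  | fImp A B => p2 3 (p2 (enc_fm A) (enc_fm B))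
  | fAll σ A => p2 4 (p2 (enc_ty σ) (enc_fm A))
  end.
Lemma enc_fm_inj L c (A : fm L c) : forall B, enc_fm A = enc_fm B -> A = B.
Proof.
  induction A; destruct B; cbn; intros H; p2inv; try discriminate.
  - apply enc_tm_inj in H0. exinv H0. apply enc_tm_inj in H1. exinv H1. reflexivity.
  - apply enc_tm_inj in H0. exinv H0. f_equal. apply proof_irrelevance.
  - reflexivity.
  - f_equal; auto.
  - tyinv. f_equal; auto.
Qed.

Fixpoint enc_env {c} : env PT c -> nat :=
  match c with
  | nil => fun _ => 0
  | σ :: c => fun e => p2 (enc_ptm (e σ vz : ptm σ)) (enc_env (etl e))
  end.
Lemma enc_env_inj c : forall e e' : env PT c, enc_env e = enc_env e' -> e = e'.
Proof.
  induction c; cbn; intros e e' H.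
  - apply env_nil.
  - p2inv. apply enc_ptm_inj in H. exinv H. apply env_ext; auto.
Qed.

Definition enc_cl {L} (x : closure L) : nat := p2 (enc_ctx (cc x)) (p2 (enc_fm (cA x)) (enc_env (ce x))).
Lemma enc_cl_inj L (x y : closure L) : enc_cl x = enc_cl y -> x = y.
Proof.
  destruct x as [c A e], y as [c' A' e']; unfold enc_cl; cbn; intros H; p2inv.
  apply enc_ctx_inj in H. subst. apply enc_fm_inj in H0. apply enc_env_inj in H1. subst. reflexivity.
Qed.

Lemma chain {C : Type} (R : C -> C -> Prop) (task : nat -> C -> Prop) (p0 : C) :
  (forall n p, exists q, R p q /\ task n q) ->
  exists f : nat -> C, f 0 = p0 /\ forall n, R (f n) (f (S n)) /\ task n (f (S n)).
Proof.
  intros H.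
  set (g := fun n p => proj1_sig (constructive_indefinite_description _ (H n p))).
  exists (fix f n := match n with 0 => p0 | S n => g n (f n) end).
  split; [reflexivity|]. intros n.
  exact (proj2_sig (constructive_indefinite_description _ (H n _))).
Qed.

(* Every closure is handled by one task, so a chain of conditions meets countably many
   density requirements. *)
Lemma generic {C L} (R : C -> C -> Prop) (task : closure L -> C -> Prop) (p0 : C) :
  (forall p, R p p) ->
  (forall x p, exists q, R p q /\ task x q) ->
  exists f : nat -> C, f 0 = p0 /\ (forall n, R (f n) (f (S n))) /\
    forall x, exists n, task x (f n).
Proof.
  intros HR H.
  destruct (chain R (fun n p => forall x, enc_cl x = n -> task x p) p0) as [f [H0 Hf]].
  { intros n p. destruct (classic (exists x : closure L, enc_cl x = n)) as [[x Hx]|Hn].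
    - destruct (H x p) as [q [Hq Hx']]. exists q. split; auto.
      intros y Hy. assert (y = x) by (apply enc_cl_inj; congruence). congruence.
    - exists p. split; auto. intros x Hx. exfalso. eauto. }
  exists f. split; [auto|]. split.
  - intros n. apply Hf.
  - intros x. exists (S (enc_cl x)). apply Hf. reflexivity.
Qed.

(** * Henkin models *)

Section Henkin.
Context {L : lang} (Con : list (closure L) -> Prop) (Th : closure L -> Prop).

Hypothesis Th_con : forall l, (forall x, In x l -> Th x) -> Con l.
Hypothesis Th_dec : forall c (A : fm L c) e, Th (Cl A e) \/ Th (Cl (fNot A) e).
Hypothesis Th_wit : forall c σ (A : fm L (σ :: c)) e, Th (Cl (fNot (fAll σ A)) e) ->
  exists t : D PT σ, Th (Cl (fNot A) (econs t e)).

(** All that the term model needs to know about consistency. The rules are verified for two notions: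
    underivability of falsity ([SCon_rules]) and satisfiability in a model of E-PA
    ([sat_con_rules]). *)
Record con_rules : Prop := {
  r_neg : forall c (A : fm L c) e, ~ Con [Cl A e; Cl (fNot A) e];
  r_bot : forall c e, ~ Con [Cl (@fBot L c) e];
  r_imp : forall c (A B : fm L c) e, ~ Con [Cl (fImp A B) e; Cl A e; Cl (fNot B) e];
  r_nimp1 : forall c (A B : fm L c) e, ~ Con [Cl (fNot (fImp A B)) e; Cl (fNot A) e];
  r_nimp2 : forall c (A B : fm L c) e, ~ Con [Cl (fNot (fImp A B)) e; Cl B e];
  r_all : forall c σ (A : fm L (σ :: c)) e (t : D PT σ),
    ~ Con [Cl (fAll σ A) e; Cl (fNot A) (econs t e)];
  r_eq : forall c d σ (t u : tm c σ) (t' u' : tm d σ) (e : env PT c) e', ev e t = ev e' t' -> ev e u = ev e' u' ->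
    ~ Con [Cl (fEq t u) e; Cl (fNot (fEq t' u')) e'];
  r_st : forall c d i i' σ (t : tm c σ) (t' : tm d σ) (e : env PT c) e', ev e t = ev e' t' ->
    ~ Con [Cl (fSt i t) e; Cl (fNot (fSt i' t')) e'];
  r_refl : forall c σ (t : tm c σ) e, ~ Con [Cl (fNot (fEq t t)) e];
  r_sym : forall c σ (t u : tm c σ) e, ~ Con [Cl (fEq t u) e; Cl (fNot (fEq u t)) e];
  r_trans : forall c σ (t u v : tm c σ) e,
    ~ Con [Cl (fEq t u) e; Cl (fEq u v) e; Cl (fNot (fEq t v)) e];
  r_cong : forall c σ τ (f g : tm c (σ ⇒ τ)) (t u : tm c σ) e,
    ~ Con [Cl (fEq f g) e; Cl (fEq t u) e; Cl (fNot (fEq (f · t) (g · u))) e];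
  r_stcong : forall c i σ (t u : tm c σ) e,
    ~ Con [Cl (fSt i t) e; Cl (fEq t u) e; Cl (fNot (fSt i u)) e]
}.
Hypothesis rules : con_rules.

Ltac thcon H := exfalso; refine (H (Th_con _ _)); cbn; intros ? Hin;
  repeat (destruct Hin as [<- | Hin]; [assumption|]); destruct Hin.

Lemma Th_not c (A : fm L c) e : Th (Cl (fNot A) e) <-> ~ Th (Cl A e).
Proof.
  split.
  - intros H1 H2. thcon (r_neg rules _ A e).
  - intros H. destruct (Th_dec _ A e); tauto.
Qed.

Lemma Th_imp c (A B : fm L c) e : Th (Cl (fImp A B) e) <-> (Th (Cl A e) -> Th (Cl B e)).
Proof.
  split.
  - intros H1 H2. apply NNPP. rewrite <- Th_not. intros H3. thcon (r_imp rules _ A B e).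
  - intros H. apply NNPP. rewrite <- Th_not. intros H3. destruct (Th_dec _ A e) as [HA|HA].
    + apply H in HA. thcon (r_nimp2 rules _ A B e).
    + thcon (r_nimp1 rules _ A B e).
Qed.

Lemma Th_all c σ (A : fm L (σ :: c)) e :
  Th (Cl (fAll σ A) e) <-> forall t : D PT σ, Th (Cl A (econs t e)).
Proof.
  split.
  - intros H1 t. apply NNPP. rewrite <- Th_not. intros H3. thcon (r_all rules _ _ A e t).
  - intros H. apply NNPP. rewrite <- Th_not. intros H3. apply Th_wit in H3 as [t Ht].
    apply Th_not in Ht. apply Ht, H.
Qed.

Definition thEq {σ} (t u : ptm σ) : Prop :=
  Th (Cl (@fEq L [σ; σ] _ v0 v1) (econs (t : D PT σ) (econs (u : D PT σ) enil))).

Lemma Th_eq c σ (t u : tm c σ) e : Th (Cl (fEq t u) e) <-> thEq (ev e t) (ev e u).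
Proof.
  split; intros H; apply NNPP; unfold thEq; rewrite <- Th_not; intros H'.
  - refine (_ (r_eq rules _ _ _ t u v0 v1 e (econs (ev e t) (econs (ev e u) enil)) eq_refl eq_refl)).
    intros K. thcon K.
  - refine (_ (r_eq rules _ _ _ v0 v1 t u (econs (ev e t) (econs (ev e u) enil)) e eq_refl eq_refl)).
    intros K. unfold thEq in H. thcon K.
Qed.

Lemma thEq_refl σ (t : ptm σ) : thEq t t.
Proof.
  change t with (ev (econs (t : D PT σ) enil) v0 : ptm σ) at 1 2. rewrite <- Th_eq. apply NNPP. rewrite <- Th_not.
  intros H. thcon (r_refl rules _ _ (v0 : tm [σ] σ) (econs (t : D PT σ) enil)).
Qed.
Lemma thEq_sym σ (t u : ptm σ) : thEq t u -> thEq u t.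
Proof.
  set (e := econs (t : D PT σ) (econs (u : D PT σ) enil)).
  change t with (ev e v0 : ptm σ). change u with (ev e v1 : ptm σ). rewrite <- !Th_eq.
  intros H. apply NNPP. rewrite <- Th_not. intros H'. thcon (r_sym rules _ _ v0 v1 e).
Qed.
Lemma thEq_trans σ (t u v : ptm σ) : thEq t u -> thEq u v -> thEq t v.
Proof.
  set (e := econs (t : D PT σ) (econs (u : D PT σ) (econs (v : D PT σ) enil))).
  change t with (ev e v0 : ptm σ). change u with (ev e v1 : ptm σ).
  change v with (ev e v2 : ptm σ). rewrite <- !Th_eq.
  intros H1 H2. apply NNPP. rewrite <- Th_not. intros H'. thcon (r_trans rules _ _ v0 v1 v2 e).
Qed.
Lemma thEq_app σ τ (f g : ptm (σ ⇒ τ)) (t u : ptm σ) :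
  thEq f g -> thEq t u -> thEq (pApp f t) (pApp g u).
Proof.
  set (e := econs (f : D PT (σ ⇒ τ)) (econs (g : D PT (σ ⇒ τ)) (econs (t : D PT σ) (econs (u : D PT σ) enil)))).
  change (pApp f t) with (ev e (v0 · v2) : ptm τ). change (pApp g u) with (ev e (v1 · v3) : ptm τ).
  change f with (ev e v0 : ptm (σ ⇒ τ)). change g with (ev e v1 : ptm (σ ⇒ τ)).
  change t with (ev e v2 : ptm σ). change u with (ev e v3 : ptm σ). rewrite <- !Th_eq.
  intros H1 H2. apply NNPP. rewrite <- Th_not. intros H'. thcon (r_cong rules _ _ _ v0 v1 v2 v3 e).
Qed.

(** Replaces a quotient: provably equal terms define extensionally equal predicates, from which
    [epsilon] picks the same representative. The domain of the term model consists of the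
    representatives. *)
Definition trep {σ} (t : ptm σ) : ptm σ := epsilon (inhabits (pPar σ 0)) (fun u => thEq t u).
Lemma trep_eq σ (t : ptm σ) : thEq t (trep t).
Proof. apply (epsilon_spec (inhabits (pPar σ 0)) (fun u => thEq t u)). exists t. apply thEq_refl. Qed.
Lemma trep_eqv σ (t u : ptm σ) : thEq t u -> trep t = trep u.
Proof.
  intros H. unfold trep. f_equal. extensionality v. apply propositional_extensionality.
  split; intros K; eauto using thEq_trans, thEq_sym.
Qed.
Lemma trep_idem σ (t : ptm σ) : trep (trep t) = trep t.
Proof. apply trep_eqv, thEq_sym, trep_eq. Qed.

Definition hcl {σ} (t : ptm σ) : {t : ptm σ | trep t = t} := exist _ (trep t) (trep_idem _ t).
Definition HM : structure :=
  Structure (fun σ => {t : ptm σ | trep t = t})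
    (fun σ τ f a => hcl (pApp (proj1_sig f) (proj1_sig a))) (fun σ k => hcl (pCst k)).
(** The witness [i] of [is_ext L] is quantified away; in the internal language there is none and the
    predicate is empty. *)
Definition hS : spred HM := fun σ x => exists i, Th (Cl (@fSt L [σ] i σ v0) (econs (proj1_sig x : D PT σ) enil)).

Lemma hcl_eq σ (t u : ptm σ) : hcl t = hcl u <-> thEq t u.
Proof.
  split.
  - intros H. injection H as H. eapply thEq_trans; [apply trep_eq|]. rewrite H. apply thEq_sym, trep_eq.
  - intros H. unfold hcl. apply trep_eqv in H. apply subset_eq_compat, H.
Qed.
Lemma hcl_surj σ (x : D HM σ) : x = hcl (proj1_sig x).
Proof. destruct x as [t Ht]. apply subset_eq_compat. cbn. auto. Qed.
Lemma hcl_app σ τ (f : ptm (σ ⇒ τ)) (a : ptm σ) : hcl (pApp f a) = @ap HM _ _ (hcl f) (hcl a).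
Proof. apply hcl_eq, thEq_app; apply trep_eq. Qed.

Definition hρ : assign HM := fun σ k => hcl (pPar σ k).
Lemma pe_hcl τ (t : ptm τ) : @pe HM hρ τ t = hcl t.
Proof. induction t; cbn; auto. rewrite IHt1, IHt2. symmetry. apply hcl_app. Qed.

Lemma Th_st c i σ (t : tm c σ) e : Th (Cl (fSt i t) e) <-> hS σ (hcl (ev e t)).
Proof.
  unfold hS. split.
  - intros H. exists i. apply NNPP. rewrite <- Th_not. intros H'. cbn in H'.
    (* [r_stcong] compares two terms in one environment, so the term and its representative are
       placed in a common one. *)
    set (e' := econs (trep (ev e t) : D PT σ) (econs (ev e t) enil)).
    assert (K1 : Th (Cl (@fEq L _ σ v1 v0) e')). { apply Th_eq. apply trep_eq. }
    assert (K2 : Th (Cl (@fSt L _ i σ v1) e')).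
    { apply NNPP. rewrite <- Th_not. intros K. thcon (r_st rules _ _ i i σ t v1 e e' eq_refl). }
    assert (K3 : Th (Cl (fNot (@fSt L _ i σ v0)) e')).
    { apply Th_not. intros K. thcon (r_st rules _ _ i i σ v0 v0 e' (econs (trep (ev e t) : D PT σ) enil) eq_refl). }
    thcon (r_stcong rules _ i σ v1 v0 e').
  - intros [j H]. apply NNPP. rewrite <- Th_not. intros H'. cbn in H.
    set (e' := econs (trep (ev e t) : D PT σ) (econs (ev e t) enil)).
    assert (K1 : Th (Cl (@fEq L _ σ v0 v1) e')). { apply Th_eq. apply thEq_sym, trep_eq. }
    assert (K2 : Th (Cl (@fSt L _ j σ v0) e')).
    { apply NNPP. rewrite <- Th_not. intros K.
      thcon (r_st rules _ _ j j σ v0 v0 (econs (trep (ev e t) : D PT σ) enil) e' eq_refl). }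
    assert (K3 : Th (Cl (fNot (@fSt L _ j σ v1)) e')).
    { apply Th_not. intros K. thcon (r_st rules _ _ j i σ v1 t e' e eq_refl). }
    thcon (r_stcong rules _ j σ v0 v1 e').
Qed.

Lemma truth c (A : fm L c) : forall e, sat hS A (penv hρ e) <-> Th (Cl A e).
Proof.
  induction A; intros e; cbn.
  - rewrite <- !pe_ev, !pe_hcl, hcl_eq. symmetry. apply Th_eq.
  - rewrite <- !pe_ev, !pe_hcl. symmetry. apply Th_st.
  - split; [tauto|]. intros H. thcon (r_bot rules _ e).
  - rewrite IHA1, IHA2. symmetry. apply Th_imp.
  - rewrite Th_all. split.
    + intros H t. rewrite <- IHA, penv_econs. apply H.
    + intros H a. specialize (H (proj1_sig a)). rewrite <- IHA, penv_econs, pe_hcl, <- hcl_surj in H. exact H.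
Qed.

Lemma penv_surj c (e : env HM c) : exists e', e = penv hρ e'.
Proof.
  exists (fun σ x => proj1_sig (e σ x)). extensionality σ. extensionality x.
  unfold penv. rewrite pe_hcl. apply hcl_surj.
Qed.

Theorem henkin_model : exists (M : structure) (S : spred M) (ρ : assign M),
  (forall c (e : env M c), exists e', e = penv ρ e') /\
  forall c (A : fm L c) e, sat S A (penv ρ e) <-> Th (Cl A e).
Proof. exists HM, hS, hρ. split; [exact penv_surj | exact truth]. Qed.

End Henkin.

(** * Completeness *)

Definition ax_closed {L} (Ax : forall c, fm L c -> Prop) : Prop :=
  forall c A, Ax c A -> forall d (θ : tsub c d), Ax d (fsubst θ A).

Lemma prv_weak {L} (Ax : forall c, fm L c -> Prop) c Δ A :
  prv Ax c Δ A -> forall Δ', incl Δ Δ' -> prv Ax c Δ' A.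
Proof.
  induction 1; intros Δ' HΔ.
  - apply p_ax, H.
  - apply p_hyp. auto.
  - apply p_impI, IHprv. intros C [<- | HC]; [left | right]; auto.
  - eapply p_impE; eauto.
  - apply p_raa, IHprv. intros C [<- | HC]; [left | right]; auto.
  - apply p_allI, IHprv. apply incl_map, HΔ.
  - apply p_allE. auto.
Qed.

Definition cinst {d L} (m : assign (TM d)) (x : closure L) : fm L d :=
  fsubst (penv m (ce x)) (cA x).

Lemma psub_shift {d σ τ} (m : assign (TM d)) (t : ptm τ) :
  @pe (TM (σ :: d)) (fun τ j => wk (m τ j)) _ t = wk (@pe (TM d) m _ t).
Proof.
  induction t; cbn; [reflexivity | reflexivity |].
  unfold wk in *. cbn. rewrite IHt1, IHt2. reflexivity.
Qed.

Section Completeness.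
Context {L : lang} (Ax : forall c, fm L c -> Prop) (Ax_closed : ax_closed Ax).
Hypothesis Ax_refl : forall c σ (t : tm c σ), Ax c (fEq t t).
Hypothesis Ax_sym : forall c σ (t u : tm c σ), Ax c (fImp (fEq t u) (fEq u t)).
Hypothesis Ax_trans : forall c σ (t u v : tm c σ), Ax c (fImp (fEq t u) (fImp (fEq u v) (fEq t v))).
Hypothesis Ax_cong : forall c σ τ (f g : tm c (σ ⇒ τ)) (t u : tm c σ),
  Ax c (fImp (fEq f g) (fImp (fEq t u) (fEq (f · t) (g · u)))).
Hypothesis Ax_st : forall c i σ (t u : tm c σ),
  prv Ax c [] (fImp (fSt i t) (fImp (fEq t u) (fSt i u))).

(* Only odd parameters serve as Henkin witnesses, so the theory [T0] may use all even ones. *)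
Context (T0 : closure L -> Prop) (b : nat).
Hypothesis T0_fresh : forall x k, T0 x -> b <= k -> Nat.Odd k -> efresh k (ce x).

(** Derivations know only variables, so parameters are read as terms of some context [d]. Letting
    [d] and [m] depend on the finite part [l0] of the theory is what builds compactness in. *)
Definition SCon (l : list (closure L)) : Prop :=
  forall l0, (forall x, In x l0 -> T0 x) ->
  exists d (m : assign (TM d)), ~ prv Ax d (map (cinst m) (l ++ l0)) fBot.

Hypothesis T0_con : SCon [].

Lemma SCon_contr l : (forall d (m : assign (TM d)), prv Ax d (map (cinst m) l) fBot) -> ~ SCon l.
Proof.
  intros H HC. destruct (HC []) as [d [m Hm]]; [cbn; tauto|]. rewrite app_nil_r in Hm. auto.
Qed.

Lemma hyp_nth c Δ (A : fm L c) n : nth_error Δ n = Some A -> prv Ax c Δ A.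
Proof. intros H. apply p_hyp. eapply nth_error_In, H. Qed.

Ltac hyp n := apply (hyp_nth _ _ _ n); reflexivity.
Ltac mp n := eapply p_impE; [hyp n|].

Lemma SCon_rules : con_rules SCon.
Proof.
  split; intros; apply SCon_contr; intros d' m; cbn.
  - mp 1. hyp 0.
  - hyp 0.
  - mp 2. eapply p_impE; [hyp 0 | hyp 1].
  - mp 0. apply p_impI. apply p_raa. mp 3. hyp 1.
  - mp 0. apply p_impI. hyp 2.
  - mp 1. unfold cinst; cbn. replace (fsubst (penv m (econs t e)) A)
      with (fsubst (inst (@pe (TM d') m _ t)) (fsubst (up (penv m e)) A)).
    + apply p_allE. hyp 0.
    + rewrite fsubst_comp. f_equal. apply scons_ext; [reflexivity|].
      intros τ x. unfold tcomp, up; cbn. unfold wk. rewrite tsubst_comp. apply tsubst_id.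
  - mp 1. unfold cinst; cbn.
    assert (E1 : forall c (t : tm c σ) (e : env PT c),
      tsubst (penv m e) t = @pe (TM d') m _ (ev e t : ptm σ)).
    { clear. intros c t e. induction t; cbn; [reflexivity|reflexivity|congruence]. }
    rewrite !E1, H, H0. hyp 0.
  - mp 1. unfold cinst; cbn.
    assert (E1 : forall c (t : tm c σ) (e : env PT c),
      tsubst (penv m e) t = @pe (TM d') m _ (ev e t : ptm σ)).
    { clear. intros c t e. induction t; cbn; [reflexivity|reflexivity|congruence]. }
    rewrite !E1, H, (proof_irrelevance _ i' i). hyp 0.
  - mp 0. apply p_ax, Ax_refl.
  - mp 1. eapply p_impE; [apply p_ax, Ax_sym | hyp 0].
  - mp 2. eapply p_impE; [eapply p_impE; [apply p_ax, Ax_trans | hyp 0] | hyp 1].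
  - mp 2. eapply p_impE; [eapply p_impE; [apply p_ax, Ax_cong | hyp 0] | hyp 1].
  - mp 2. eapply p_impE; [eapply p_impE; [eapply prv_weak; [apply Ax_st|intros ? []] | hyp 0] | hyp 1].
Qed.

Lemma SCon_dec l c (A : fm L c) e : SCon l -> SCon (Cl A e :: l) \/ SCon (Cl (fNot A) e :: l).
Proof.
  intros H. apply NNPP. intros K. apply not_or_and in K as [K1 K2].
  apply not_all_ex_not in K1 as [l1 K1]. apply not_all_ex_not in K2 as [l2 K2].
  apply imply_to_and in K1 as [T1 K1]. apply imply_to_and in K2 as [T2 K2].
  destruct (H (l1 ++ l2)) as [d [m Hm]].
  { intros x Hx. apply in_app_or in Hx. firstorder. }
  apply K1. exists d, m. intros P1. apply K2. exists d, m. intros P2.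
  apply Hm. cbn in P1, P2. eapply p_impE.
  - apply p_impI. eapply prv_weak; [exact P2|].
    intros B [<- | HB]; [left; reflexivity | right]. revert HB. apply incl_map.
    intros y Hy. rewrite in_app_iff in Hy |- *. rewrite in_app_iff. tauto.
  - apply p_impI. eapply prv_weak; [exact P1|].
    intros B [<- | HB]; [left; reflexivity | right]. revert HB. apply incl_map.
    intros y Hy. rewrite in_app_iff in Hy |- *. rewrite in_app_iff. tauto.
Qed.

Lemma cinst_fresh d σ (m : assign (TM d)) k (x : closure L) : efresh k (ce x) ->
  cinst (d := σ :: d) (upd (F := tm (σ :: d)) (fun τ j => wk (m τ j)) σ k v0) x = fsubst shift (cinst m x).
Proof.
  intros H. unfold cinst. rewrite fsubst_comp. f_equal.
  extensionality τ. extensionality y. unfold penv, tcomp.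
  etransitivity; [exact (@pe_fresh (TM (σ :: d)) _ _ σ k _ _ (H _ y)) | apply psub_shift].
Qed.

(** A fresh parameter can be read as a new variable, so a refutation of its being a counterexample
    to [A] generalises to a proof of the universal formula. *)
Lemma SCon_wit l c σ (A : fm L (σ :: c)) e : SCon l -> In (Cl (fNot (fAll σ A)) e) l ->
  exists k, SCon (Cl (fNot A) (econs (pPar σ k : D PT σ) e) :: l).
Proof.
  intros H Hin. destruct (cfresh_ex l) as [N HN].
  (* Beyond [N] it is fresh for [l]; odd and beyond [b] it is fresh for [T0]. *)
  set (k := 2 * (N + b) + 1). exists k.
  assert (Hl : forall x, In x l -> efresh k (ce x)) by (apply HN; unfold k; lia).
  intros l0 Hl0. destruct (H l0 Hl0) as [d [m Hm]].
  exists (σ :: d), (upd (F := tm (σ :: d)) (fun τ j => wk (m τ j)) σ k v0).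
  intros P. apply Hm. apply (p_impE Ax _ _ (cinst m (Cl (fAll σ A) e))).
  - apply p_hyp. change (In (cinst m (Cl (fNot (fAll σ A)) e)) (map (cinst m) (l ++ l0))).
    apply in_map, in_or_app. left. exact Hin.
  - apply p_allI. apply p_raa. cbn [map app] in P.
    eapply prv_weak; [exact P|]. intros B [<- | HB].
    + left. unfold cinst. cbn [cA ce fNot fsubst]. apply (f_equal (fun θ => fImp (fsubst θ A) fBot)). symmetry.
      apply scons_ext; [apply (upd_same (F := tm (σ :: d)))|].
      intros τ x.
      etransitivity; [exact (@pe_fresh (TM (σ :: d)) _ _ σ k _ _ (Hl _ Hin _ x)) | apply psub_shift].
    + right. apply in_map_iff in HB as [x [<- Hx]]. rewrite map_map. apply in_map_iff.
      exists x. split; auto. symmetry. apply cinst_fresh.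
      apply in_app_or in Hx as [Hx|Hx]; auto. apply T0_fresh; auto.
      * unfold k. lia.
      * exists (N + b). reflexivity.
Qed.

Theorem model_existence : exists (M : structure) (S : spred M) (ρ : assign M),
  (forall c A, Ax c A -> forall e : env M c, sat S A e) /\ (forall x, T0 x -> ctrue S ρ x).
Proof.
  (* The task of a closure is to decide it and, if it is a refuted universal formula, to name a
     counterexample as well. *)
  destruct (@generic {l | SCon l} L (fun p q => incl (proj1_sig p) (proj1_sig q))
    (fun x q => In x (proj1_sig q) \/ In (Cl (fNot (cA x)) (ce x)) (proj1_sig q) /\
       match cA x with fAll σ A => fun e => exists t : D PT σ, In (Cl (fNot A) (econs t e)) (proj1_sig q)
       | _ => fun _ => True end (ce x)) (exist _ [] T0_con)) as [f [Hf0 [Hf Ht]]].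
  { intros p; apply incl_refl. }
  { intros [c A e] [l Hl]. cbn [cA ce proj1_sig]. destruct (SCon_dec l c A e Hl) as [H|H].
    - exists (exist _ _ H). cbn. split; [apply incl_tl, incl_refl | tauto].
    - destruct A.
      5:{ destruct (SCon_wit _ _ _ A e H (or_introl eq_refl)) as [k Hk].
          exists (exist _ _ Hk). cbn. split; [repeat apply incl_tl; apply incl_refl|].
          right. split; [tauto|]. eexists. left. reflexivity. }
      all: exists (exist _ _ H); cbn; split; [apply incl_tl, incl_refl | tauto]. }
  set (Th := fun x => exists n, In x (proj1_sig (f n))).
  assert (Hmono : forall n m, n <= m -> incl (proj1_sig (f n)) (proj1_sig (f m))).
  { induction 1; [apply incl_refl | eapply incl_tran; eauto]. }
  assert (Hall : forall l, (forall x, In x l -> Th x) -> exists n, incl l (proj1_sig (f n))).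
  { induction l as [|x l IH]; intros H.
    - exists 0. intros ? [].
    - destruct IH as [n Hn]; [intros; apply H; right; auto|]. destruct (H x (or_introl eq_refl)) as [n' Hn'].
      exists (n + n'). intros y [<- | Hy].
      + apply (Hmono n'); [lia|auto].
      + apply (Hmono n); [lia|auto]. }
  assert (Th_con : forall l, (forall x, In x l -> Th x) -> SCon l).
  { intros l H. destruct (Hall l H) as [n Hn]. intros l0 Hl0.
    destruct (proj2_sig (f n) l0 Hl0) as [d [m Hm]]. exists d, m. intros P. apply Hm.
    eapply prv_weak; [exact P|]. apply incl_map, incl_app_app; [exact Hn|apply incl_refl]. }
  assert (Th_dec : forall c (A : fm L c) e, Th (Cl A e) \/ Th (Cl (fNot A) e)).
  { intros c A e. destruct (Ht (Cl A e)) as [n [H|[H _]]]; [left|right]; exists n; auto. }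
  assert (Th_wit : forall c σ (A : fm L (σ :: c)) e, Th (Cl (fNot (fAll σ A)) e) ->
    exists t : D PT σ, Th (Cl (fNot A) (econs t e))).
  { intros c σ A e H. destruct (Ht (Cl (fAll σ A) e)) as [n [H'|[_ [t H']]]].
    - exfalso. refine (r_neg _ SCon_rules _ (fAll σ A) e (Th_con _ _)).
      intros x [<- | [<- | []]]; [exists n|]; auto.
    - exists t, n. exact H'. }
  destruct (henkin_model SCon Th Th_con Th_dec Th_wit SCon_rules) as [M [S [ρ [Hsurj Htruth]]]].
  exists M, S, ρ. split.
  - intros c A HA e. destruct (Hsurj c e) as [e' ->]. apply Htruth.
    destruct (Th_dec c A e') as [|H]; auto. exfalso.
    refine (SCon_contr [Cl (fNot A) e'] _ (Th_con _ _)).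
    + intros d m. cbn. mp 0. apply p_ax, Ax_closed, HA.
    + intros x [<- | []]; auto.
  - intros [c A e] Hx. unfold ctrue; cbn. apply Htruth. destruct (Th_dec c A e) as [|H]; auto. exfalso.
    assert (HC : SCon [Cl (fNot A) e]) by (apply Th_con; intros x [<- | []]; auto).
    destruct (HC [Cl A e]) as [d [m Hm]]; [intros x [<- | []]; auto|].
    apply Hm. cbn. mp 0. hyp 1.
Qed.
End Completeness.

Lemma fsubst_inst {L c d σ} (θ : tsub c d) (t : tm c σ) (A : fm L (σ :: c)) :
  fsubst θ (fsubst (inst t) A) = fsubst (inst (tsubst θ t)) (fsubst (up θ) A).
Proof.
  rewrite !fsubst_comp. f_equal. apply scons_ext; [reflexivity|].
  intros τ x. unfold tcomp, up, inst; cbn. unfold wk. rewrite tsubst_comp. symmetry. apply tsubst_id.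
Qed.

Lemma fsubst_succ {L c d} (θ : tsub c d) (A : fm L (ι%ty :: c)) :
  fsubst (up θ) (fsubst (scons (succ · v0) shift) A) =
  fsubst (scons (succ · v0) shift) (fsubst (up θ) A).
Proof.
  rewrite !fsubst_comp. f_equal. apply scons_ext; [reflexivity|].
  intros τ x. unfold tcomp, up, inst; cbn. unfold wk. rewrite tsubst_comp. reflexivity.
Qed.

Lemma fsubst_upupshift {L c d σ τ ρ} (θ : tsub c d) (A : fm L (σ :: τ :: c)) :
  fsubst (up (up (up θ))) (fsubst (up (up (@shift c ρ))) A) =
  fsubst (up (up shift)) (fsubst (up (up θ)) A).
Proof. rewrite !fsubst_comp, !up_comp. reflexivity. Qed.

(** Unlike the other closed terms of the language, [nth'] contains [dflt σ], which does not reduce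
    for a variable [σ]; computation alone does not prove the equation. *)
Lemma tsubst_nth {c d σ} (θ : tsub c d) : tsubst θ (@nth' c σ) = nth'.
Proof.
  unfold nth'. rewrite tsubst_lam. cbn [tsubst]. rewrite tsubst_dflt. reflexivity.
Qed.

Lemma fsubst_mem {L c d σ} (θ : tsub c d) (x : tm c σ) (w : tm c (σ^*)) :
  fsubst θ (@mem L _ _ x w) = mem (tsubst θ x) (tsubst θ w).
Proof.
  unfold mem, fEx, fAnd, fNot, lt, le. cbn [fsubst tsubst].
  rewrite tsubst_nth, !tsubst_up_wk. reflexivity.
Qed.

Lemma epa_closed : ax_closed epa_ax.
Proof.
  intros c A H d θ. destruct H; cbn [fsubst tsubst fNot fOr fEx];
    rewrite ?tsubst_up_wk; try solve [constructor].
  - rewrite fsubst_inst, fsubst_succ. apply e_ind.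
Qed.

Lemma pst_closed : ax_closed pst_ax.
Proof.
  intros c A H d θ. destruct H.
  - rewrite <- emb_fsubst. apply P_epa, epa_closed, H.
  - apply P_st_eq.
  - unfold tclose. cbn. rewrite tsubst_comp. rewrite (tsub_nil (tcomp θ nosub) nosub).
    apply (P_st_closed d σ t).
  - apply (P_st_app d σ τ (tsubst θ f) (tsubst θ t)).
  - cbn [fsubst fAllSt]. rewrite fsubst_inst, fsubst_succ. apply (P_ind_st d (fsubst (up θ) A)).
  - pose proof (P_HAC d ρ τ (fsubst (up (up θ)) φ)) as H.
    cbn [fsubst fAllSt fExSt fEx fNot fAnd] in H |- *.
    rewrite fsubst_mem, fsubst_upupshift. rewrite <- emb_fsubst. exact H.
  - pose proof (P_ideal d σ τ (fsubst (up (up θ)) φ)) as H.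
    cbn [fsubst fAllSt fExSt fEx fNot fAnd] in H |- *.
    rewrite fsubst_mem, fsubst_upupshift. rewrite <- emb_fsubst. exact H.
Qed.

Lemma epa_st c (i : is_ext Int) σ (t u : tm c σ) :
  prv epa_ax c [] (fImp (fSt i t) (fImp (fEq t u) (fSt i u))).
Proof. destruct i. Qed.

Lemma pst_st c (i : is_ext Ext) σ (t u : tm c σ) :
  prv pst_ax c [] (fImp (fSt i t) (fImp (fEq t u) (fSt i u))).
Proof.
  destruct i. apply p_impI, p_impI. eapply p_impE; [apply p_ax, P_st_eq with (t := t)|].
  apply p_impI. eapply p_impE; [eapply p_impE|]; apply p_hyp; cbn; tauto.
Qed.

Lemma ev_pe {M d τ} (m : assign (TM d)) (e : env M d) (t : ptm τ) :
  ev e (@pe (TM d) m τ t : tm d τ) = pe (fun σ k => ev e (m σ k : tm d σ)) t.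
Proof. induction t; cbn; [reflexivity | reflexivity |]. f_equal; assumption. Qed.

Lemma cinst_sat {M} (S : spred M) {L d} (m : assign (TM d)) (e : env M d) (x : closure L) :
  sat S (cinst m x) e = ctrue S (fun σ k => ev e (m σ k : tm d σ)) x.
Proof.
  unfold cinst, ctrue. rewrite sat_subst. f_equal.
  extensionality τ. extensionality y. apply ev_pe.
Qed.

(** * Compactness for E-PA and completeness of both systems *)

Fixpoint pars {τ} (t : ptm τ) : list (ty * nat) :=
  match t with pPar σ k => [(σ, k)] | pCst _ => [] | pApp f a => pars f ++ pars a end.

Lemma pe_pars {M τ} (ρ ρ' : assign M) (t : ptm τ) :
  (forall σ k, In (σ, k) (pars t) -> ρ σ k = ρ' σ k) -> pe ρ t = pe ρ' t.
Proof.
  induction t; cbn; intros H; auto.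
  f_equal; [apply IHt1 | apply IHt2]; intros; apply H, in_or_app; auto.
Qed.

Lemma env_pars {c} (e : env PT c) : exists l, forall σ (x : var c σ), incl (pars (e σ x : ptm σ)) l.
Proof.
  induction c as [|σ c IH].
  - exists []. intros σ x. destruct (var_nil x).
  - destruct (IH (etl e)) as [l Hl]. exists (pars (e σ vz : ptm σ) ++ l). intros τ x. revert e Hl.
    refine (match x in var e τ return
    match e as e return var e τ -> Prop with
    | nil => fun _ => True
    | σ :: c => fun x => forall e : env PT (σ :: c), (forall σ0 x, incl (pars (etl e σ0 x : ptm σ0)) l) ->
         incl (pars (e τ x : ptm τ)) (pars (e σ vz : ptm σ) ++ l) end x
    with vz => _ | vs y => _ end); intros e Hl.
    + apply incl_appl, incl_refl.
    + apply incl_appr, Hl.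
Qed.

(** Finitely many parameters can be turned into variables of a finite context whose values are those
    of the parameters. This brings an assignment in a model into the scope of soundness. *)
Lemma assign_realize {M} (ρ : assign M) (l : list (ty * nat)) :
  exists d (m : assign (TM d)) (e : env M d),
    forall σ k, In (σ, k) l -> ev e (m σ k : tm d σ) = ρ σ k.
Proof.
  induction l as [|[σ k] l [d [m [e H]]]].
  - exists [], (fun σ _ => dflt σ), enil. intros ? ? [].
  - exists (σ :: d), (upd (F := tm (σ :: d)) (fun τ j => wk (m τ j)) σ k v0), (econs (ρ σ k) e).
    intros τ j Hin.
    destruct (ty_eq_dec τ σ) as [->|Hτ]; [destruct (Nat.eq_dec j k) as [->|Hk]|].
    + rewrite (upd_same (F := tm (σ :: d))). reflexivity.
    + rewrite (upd_other (F := tm (σ :: d))) by auto. rewrite ev_wk. apply H.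
      destruct Hin; [congruence|auto].
    + rewrite (upd_other (F := tm (σ :: d))) by auto. rewrite ev_wk. apply H.
      destruct Hin; [congruence|auto].
Qed.

(** By soundness, a finite part that is true in a model derives no contradiction; so [SCon []] holds
    and [model_existence] applies. The odd parameters from [b] on are reserved for its Henkin
    witnesses. *)
Theorem epa_compact (T0 : closure Int -> Prop) (b : nat) :
  (forall x k, T0 x -> b <= k -> Nat.Odd k -> efresh k (ce x)) ->
  (forall l, (forall x, In x l -> T0 x) ->
     exists (M : structure) (ρ : assign M), epa_model M /\ forall x, In x l -> ctrue nost ρ x) ->
  exists (M : structure) (ρ : assign M), epa_model M /\ forall x, T0 x -> ctrue nost ρ x.
Proof.
  intros Hb H.
  destruct (@model_existence Int epa_ax epa_closed e_refl e_sym e_trans e_cong epa_st T0 b Hb)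
    as [M [S [ρ [HM HT]]]].
  - intros l0 Hl0. destruct (H l0 Hl0) as [M [ρ [HM Hρ]]].
    assert (Hp : exists l, forall x, In x l0 -> forall σ (y : var (cc x) σ), incl (pars (ce x σ y : ptm σ)) l).
    { clear. induction l0 as [|x l0 [l Hl]].
      - exists []. intros ? [].
      - destruct (env_pars (ce x)) as [l' Hl']. exists (l' ++ l). intros z [<- | Hz] σ y.
        + apply incl_appl, Hl'.
        + apply incl_appr, Hl, Hz. }
    destruct Hp as [l Hl]. destruct (assign_realize ρ l) as [d [m [e He]]].
    exists d, m. intros P. refine (@prv_sound Int epa_ax M nost HM _ _ _ P e _).
    intros B HB. apply in_map_iff in HB as [x [<- Hx]]. rewrite cinst_sat.
    specialize (Hρ x Hx). unfold ctrue in *. enough (E : penv (fun σ k => ev e (m σ k : tm d σ)) (ce x) = penv ρ (ce x))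
      by (rewrite E; exact Hρ).
    extensionality σ. extensionality y. apply pe_pars. intros τ k Hk. apply He. eapply Hl; eauto.
  - exists M, ρ. assert (E : forall c (A : fm Int c) e, sat S A e = isat A e).
    { intros. rewrite <- (sat_emb S), <- (sat_emb S nost). reflexivity. }
    split.
    + intros c A HA e. rewrite <- E. auto.
    + intros x Hx. unfold ctrue. rewrite <- E. apply HT, Hx.
Qed.

Lemma complete {L} (Ax : forall c, fm L c -> Prop) (A : fm L nil) :
  ax_closed Ax ->
  (forall c σ (t : tm c σ), Ax c (fEq t t)) ->
  (forall c σ (t u : tm c σ), Ax c (fImp (fEq t u) (fEq u t))) ->
  (forall c σ (t u v : tm c σ), Ax c (fImp (fEq t u) (fImp (fEq u v) (fEq t v)))) ->
  (forall c σ τ (f g : tm c (σ ⇒ τ)) (t u : tm c σ),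
     Ax c (fImp (fEq f g) (fImp (fEq t u) (fEq (f · t) (g · u))))) ->
  (forall c i σ (t u : tm c σ), prv Ax c [] (fImp (fSt i t) (fImp (fEq t u) (fSt i u)))) ->
  (forall (M : structure) (S : spred M),
     (forall c B, Ax c B -> forall e : env M c, sat S B e) -> sat S A enil) ->
  prv Ax nil nil A.
Proof.
  intros H1 H2 H3 H4 H5 H6 H. apply NNPP. intros HA.
  destruct (@model_existence L Ax H1 H2 H3 H4 H5 H6 (fun x => x = Cl (fNot A) enil) 0) as [M [S [ρ [HM HT]]]].
  - intros x k -> _ _ σ y. destruct (var_nil y).
  - intros l0 Hl0. exists [], (fun σ _ => dflt σ). intros P. apply HA, p_raa.
    eapply prv_weak; [exact P|]. intros B HB. apply in_map_iff in HB as [x [<- Hx]].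
    apply Hl0 in Hx as ->. left. unfold cinst; cbn [cA ce].
    rewrite <- (fsubst_id (fNot A)) at 1. f_equal. apply (@tsub_nil nil).
  - refine (HT _ eq_refl _). rewrite (env_nil (penv _ _) enil). apply H, HM.
Qed.

Corollary epa_complete (A : fm Int nil) :
  (forall M, epa_model M -> isat A (@enil M)) -> EPA_proves A.
Proof.
  intros H. apply complete; auto using epa_closed, epa_st.
  1-4: constructor.
  intros M S HM. rewrite <- (sat_emb S), (sat_emb S nost). apply H.
  intros c B HB e. rewrite <- (sat_emb S), (sat_emb S S). apply HM, HB.
Qed.

Corollary pst_complete (A : fm Ext nil) :
  (forall M S, pst_model M S -> sat S A enil) -> P_proves A.
Proof.
  intros H. apply complete; auto using pst_closed, pst_st.
  - intros. apply (P_epa c (fEq t t)), e_refl.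
  - intros. apply (P_epa c (fImp (fEq t u) (fEq u t))), e_sym.
  - intros. apply (P_epa c (fImp (fEq t u) (fImp (fEq u v) (fEq t v)))), e_trans.
  - intros. apply (P_epa c (fImp (fEq f g) (fImp (fEq t u) (fEq (f · t) (g · u))))), e_cong.
Qed.

Lemma tdrop_ev {M c σ τ} (t : tm (σ :: c) τ) : forall u, tdrop t = Some u ->
  forall (e : env M c) a, ev (econs a e) t = ev e u.
Proof.
  induction t; cbn.
  - refine (match v in var e τ return
    match e as e return var e τ -> Prop with
    | nil => fun _ => True
    | σ :: c => fun v => forall u, option_map tVar (vdrop v) = Some u -> forall (e : env M c) (a : D M σ),
        econs a e _ v = ev e u end v
    with vz => _ | vs y => _ end); cbn; [discriminate|].
    intros u H e a. injection H as <-. reflexivity.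
  - intros u H. injection H as <-. reflexivity.
  - destruct (tdrop t1) as [u1|], (tdrop t2) as [u2|]; try discriminate.
    intros u H e a. injection H as <-. cbn. f_equal; auto.
Qed.

(** * Internal definability in a structure *)

Section Definability.
Context {M : structure}.

Fixpoint eapp {c d} : env M c -> env M d -> env M (c ++ d) :=
  match c with
  | nil => fun _ e' => e'
  | σ :: c => fun e e' => econs (e σ vz) (eapp (etl e) e')
  end.

Fixpoint vinl {c d τ} (x : var c τ) : var (c ++ d) τ :=
  match x with vz => vz | vs y => vs (vinl y) end.
Fixpoint vinr c {d τ} (x : var d τ) : var (c ++ d) τ :=
  match c with nil => x | _ :: c => vs (vinr c x) end.

Lemma eapp_inl c d τ (x : var c τ) : forall (e : env M c) (e' : env M d), eapp e e' τ (vinl x) = e τ x.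
Proof. induction x; intros; cbn; auto. Qed.
Lemma eapp_inr c d τ (x : var d τ) : forall (e : env M c) (e' : env M d), eapp e e' τ (vinr c x) = e' τ x.
Proof. induction c; intros; cbn; auto. Qed.

Fixpoint upn c {d d'} (θ : tsub d d') : tsub (c ++ d) (c ++ d') :=
  match c with nil => θ | _ :: c => up (upn c θ) end.

Lemma esub_upn c d d' (θ : tsub d d') : forall (e : env M c) (e' : env M d'),
  esub (upn c θ) (eapp e e') = eapp e (esub θ e').
Proof.
  induction c as [|σ c IH]; intros e e'; cbn; [reflexivity|].
  rewrite esub_up, IH. reflexivity.
Qed.

(** Lets the schemes of the theory be used for predicates written directly in Rocq: the tactic [dfn]
    below builds the formula. The values of the parameters sit behind the variables in the context,
    so that quantifiers act on the front part. *)
Definition dfn c (P : env M c -> Prop) : Prop :=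
  exists d (A : fm Int (c ++ d)) (e' : env M d), forall e, P e <-> isat A (eapp e e').
Definition rep c σ (f : env M c -> D M σ) : Prop :=
  exists d (t : tm (c ++ d) σ) (e' : env M d), forall e, f e = ev (eapp e e') t.

Lemma rep_var c σ (x : var c σ) : rep c σ (fun e => e σ x).
Proof. exists nil, (tVar (vinl x)), enil. intros e. cbn. symmetry. apply eapp_inl. Qed.

Lemma rep_const c σ (a : D M σ) : rep c σ (fun _ => a).
Proof.
  exists [σ], (tVar (vinr c vz)), (econs a enil). intros e. cbn. symmetry.
  exact (eapp_inr c [σ] σ vz e (econs a enil)).
Qed.

Let ren1 (d d' : ctx) : tsub d (d ++ d') := fun _ x => tVar (vinl x).
Let ren2 (d d' : ctx) : tsub d' (d ++ d') := fun _ x => tVar (vinr d x).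
Let esub_ren1 d d' (e : env M d) (e' : env M d') : esub (ren1 d d') (eapp e e') = e.
Proof. extensionality τ. extensionality x. apply eapp_inl. Qed.
Let esub_ren2 d d' (e : env M d) (e' : env M d') : esub (ren2 d d') (eapp e e') = e'.
Proof. extensionality τ. extensionality x. apply eapp_inr. Qed.

Lemma rep_app c σ τ (f : env M c -> D M (σ ⇒ τ)) (a : env M c -> D M σ) :
  rep c _ f -> rep c _ a -> rep c _ (fun e => ap (f e) (a e)).
Proof.
  intros [d [t [e1 H1]]] [d' [u [e2 H2]]].
  exists (d ++ d'), (tsubst (upn c (ren1 d d')) t · tsubst (upn c (ren2 d d')) u), (eapp e1 e2).
  intros e. cbn. rewrite !ev_subst, !esub_upn, esub_ren1, esub_ren2. congruence.
Qed.

Lemma dfn_eq c σ (f g : env M c -> D M σ) : rep c _ f -> rep c _ g -> dfn c (fun e => f e = g e).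
Proof.
  intros [d [t [e1 H1]]] [d' [u [e2 H2]]].
  exists (d ++ d'), (fEq (tsubst (upn c (ren1 d d')) t) (tsubst (upn c (ren2 d d')) u)), (eapp e1 e2).
  intros e. cbn. rewrite !ev_subst, !esub_upn, esub_ren1, esub_ren2, H1, H2. reflexivity.
Qed.

Lemma dfn_imp c (P Q : env M c -> Prop) : dfn c P -> dfn c Q -> dfn c (fun e => P e -> Q e).
Proof.
  intros [d [t [e1 H1]]] [d' [u [e2 H2]]].
  exists (d ++ d'), (fImp (fsubst (upn c (ren1 d d')) t) (fsubst (upn c (ren2 d d')) u)), (eapp e1 e2).
  intros e. cbn. rewrite !sat_subst, !esub_upn, esub_ren1, esub_ren2, H1, H2. reflexivity.
Qed.

Lemma dfn_False c : dfn c (fun _ => False).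
Proof. exists nil, fBot, enil. cbn. tauto. Qed.

Lemma dfn_iff c (P Q : env M c -> Prop) : dfn c P -> (forall e, P e <-> Q e) -> dfn c Q.
Proof. intros [d [A [e' H]]] HQ. exists d, A, e'. intros e. rewrite <- HQ. apply H. Qed.

Lemma dfn_not c (P : env M c -> Prop) : dfn c P -> dfn c (fun e => ~ P e).
Proof. intros H. apply dfn_imp; auto using dfn_False. Qed.

Lemma dfn_and c (P Q : env M c -> Prop) : dfn c P -> dfn c Q -> dfn c (fun e => P e /\ Q e).
Proof.
  intros HP HQ. apply dfn_iff with (fun e => ~ (P e -> ~ Q e)).
  - apply dfn_not, dfn_imp; auto using dfn_not.
  - intros e. split; [|tauto]. intros. apply NNPP. tauto.
Qed.

Lemma dfn_or c (P Q : env M c -> Prop) : dfn c P -> dfn c Q -> dfn c (fun e => P e \/ Q e).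
Proof.
  intros HP HQ. apply dfn_iff with (fun e => ~ P e -> Q e).
  - apply dfn_imp; auto using dfn_not.
  - intros e. split; [|tauto]. intros. apply NNPP. tauto.
Qed.

Lemma dfn_all c σ (P : env M c -> D M σ -> Prop) :
  dfn (σ :: c) (fun e => P (etl e) (e σ vz)) -> dfn c (fun e => forall x, P e x).
Proof.
  intros [d [A [e' H]]]. exists d, (fAll σ A), e'. intros e. cbn. split.
  - intros K a. apply (H (econs a e)), K.
  - intros K a. apply (H (econs a e)), K.
Qed.

Lemma dfn_ex c σ (P : env M c -> D M σ -> Prop) :
  dfn (σ :: c) (fun e => P (etl e) (e σ vz)) -> dfn c (fun e => exists x, P e x).
Proof.
  intros H. apply dfn_iff with (fun e => ~ forall x, ~ P e x).
  - apply dfn_not, (dfn_all c σ (fun e x => ~ P e x)), dfn_not, H.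
  - intros e. split; [|firstorder]. intros K. apply NNPP. firstorder.
Qed.

(** Serves predicates that contain a given formula [A] as an opaque component. *)
Lemma dfn_sat c d (A : fm Int c) (g : env M d -> env M c) :
  (forall σ (x : var c σ), rep d σ (fun e => g e σ x)) -> dfn d (fun e => isat A (g e)).
Proof.
  intros Hg.
  assert (K : exists k (θ : tsub c (d ++ k)) (e' : env M k), forall e, g e = esub θ (eapp e e')).
  { clear A. revert g Hg. induction c as [|σ c IH]; intros g Hg.
    - exists nil, (fun σ x => match var_nil x with end), enil. intros. apply env_nil.
    - destruct (IH (fun e => etl (g e))) as [k [θ [e1 H1]]]; [intros; apply (Hg _ (vs x))|].
      destruct (Hg _ vz) as [k' [t [e2 H2]]].
      exists (k' ++ k), (scons (tsubst (upn d (ren1 k' k)) t) (tcomp (upn d (ren2 k' k)) θ)), (eapp e2 e1).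
      intros e. rewrite esub_scons, <- (econs_eta (g e)), H2, H1. f_equal.
      + rewrite ev_subst, esub_upn, esub_ren1. reflexivity.
      + extensionality τ. extensionality x. unfold esub at 2, tcomp.
        rewrite ev_subst, esub_upn, esub_ren2. reflexivity. }
  destruct K as [k [θ [e' K]]].
  exists k, (fsubst θ A), e'. intros e. rewrite sat_subst, K. reflexivity.
Qed.

Lemma rep_econs c d σ (a : env M d -> D M σ) (g : env M d -> env M c) :
  rep d σ a -> (forall τ (x : var c τ), rep d τ (fun e => g e τ x)) ->
  forall τ (x : var (σ :: c) τ), rep d τ (fun e => econs (a e) (g e) τ x).
Proof.
  intros Ha Hg τ x. revert a g Ha Hg.
  refine (match x in var c' τ return
      match c' as c' return var c' τ -> Prop with nil => fun _ => True
      | σ :: c => fun x => forall (a : env M d -> D M σ) (g : env M d -> env M c),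
         rep d σ a -> (forall τ (x : var c τ), rep d τ (fun e => g e τ x)) ->
         rep d τ (fun e => econs (a e) (g e) τ x) end x
      with vz => _ | vs y => _ end); intros a g Ha Hg; [exact Ha | exact (Hg _ y)].
Qed.

End Definability.

Ltac dfn_step := first
  [ apply dfn_False | apply dfn_eq | apply dfn_imp | apply dfn_not | apply dfn_and | apply dfn_or
  | apply dfn_all | apply dfn_ex ].
Ltac rep_step := first [ apply rep_const | apply rep_var | apply rep_app ].

(** * Arithmetic and finite sequences in models of E-PA *)

Existing Class epa_model.

Section Combinators.
Context {M : structure} {HM : epa_model M}.

Lemma K_eq σ τ (x : D M σ) (y : D M τ) : ap (ap (kc (cK σ τ)) x) y = x.
Proof. exact (HM _ _ (e_K [σ; τ] σ τ v0 v1) (econs x (econs y enil))). Qed.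

Lemma S_eq ρ σ τ (x : D M (ρ ⇒ σ ⇒ τ)) (y : D M (ρ ⇒ σ)) (z : D M ρ) :
  ap (ap (ap (kc (cS ρ σ τ)) x) y) z = ap (ap x z) (ap y z).
Proof.
  exact (HM _ _ (e_S [(ρ ⇒ σ ⇒ τ)%ty; (ρ ⇒ σ)%ty; ρ] ρ σ τ v0 v1 v2) (econs x (econs y (econs z enil)))).
Qed.

Lemma M_ext σ τ (f g : D M (σ ⇒ τ)) : (forall x, ap f x = ap g x) -> f = g.
Proof.
  intros H. exact (HM _ _ (e_ext [(σ ⇒ τ)%ty; (σ ⇒ τ)%ty] σ τ v0 v1) (econs f (econs g enil)) H).
Qed.

Lemma ev_lam {c σ τ} (t : tm (σ :: c) τ) (e : env M c) (x : D M σ) :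
  ap (ev e (lam t)) x = ev (econs x e) t.
Proof.
  revert e x. induction t; intros e x.
  - revert e x. refine (match v in var c' τ return
    match c' as c' return var c' τ -> Prop with
    | nil => fun _ => True
    | σ :: c => fun v => forall (e : env M c) (x : D M σ), ap (ev e (lam (tVar v))) x = econs x e _ v end v
    with vz => _ | vs y => _ end); intros e x; unfold lam; cbn.
    + rewrite S_eq, K_eq. reflexivity.
    + apply K_eq.
  - apply K_eq.
  - destruct (tdrop (t1 · t2)) as [u|] eqn:E.
    + rewrite (tdrop_ev _ _ E). unfold lam; cbn in E |- *. rewrite E. cbn. apply K_eq.
    + unfold lam; fold @lam; cbn in E |- *. rewrite E. cbn. rewrite S_eq.
      rewrite <- IHt1, <- IHt2. reflexivity.
Qed.

Lemma Rec_0 σ (y : D M σ) z : ap (ap (ap (kc (cRec σ)) (kc cZero)) y) z = y.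
Proof. exact (HM _ _ (e_Rec0 [σ; (σ ⇒ ι ⇒ σ)%ty] σ v0 v1) (econs y (econs z enil))). Qed.

Lemma Rec_S σ n (y : D M σ) z :
  ap (ap (ap (kc (cRec σ)) (ap (kc cSucc) n)) y) z = ap (ap z (ap (ap (ap (kc (cRec σ)) n) y) z)) n.
Proof.
  exact (HM _ _ (e_RecS [ι%ty; σ; (σ ⇒ ι ⇒ σ)%ty] σ v0 v1 v2) (econs n (econs y (econs z enil)))).
Qed.

Lemma LRec_nil σ ρ (y : D M ρ) z : ap (ap (ap (kc (cLRec σ ρ)) (kc (cNil σ))) y) z = y.
Proof. exact (HM _ _ (e_LRec0 [ρ; (ρ ⇒ σ ⇒ ρ)%ty] σ ρ v0 v1) (econs y (econs z enil))). Qed.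

Lemma LRec_cons σ ρ a w (y : D M ρ) z :
  ap (ap (ap (kc (cLRec σ ρ)) (ap (ap (kc (cCons σ)) a) w)) y) z
  = ap (ap z (ap (ap (ap (kc (cLRec σ ρ)) w) y) z)) a.
Proof.
  exact (HM _ _ (e_LRecS [σ; (σ^*)%ty; ρ; (ρ ⇒ σ ⇒ ρ)%ty] σ ρ v0 v1 v2 v3)
    (econs a (econs w (econs y (econs z enil))))).
Qed.

Lemma succ_0 (n : D M ι) : ap (kc cSucc) n <> kc cZero.
Proof. exact (HM _ _ (e_succ0 [ι%ty] v0) (econs n enil)). Qed.

Lemma succ_inj (n m : D M ι) : ap (kc cSucc) n = ap (kc cSucc) m -> n = m.
Proof. exact (HM _ _ (e_succ_inj [ι%ty; ι%ty] v0 v1) (econs n (econs m enil))). Qed.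

Lemma seq_case σ (w : D M (σ^*)) : w = kc (cNil σ) \/ exists a v, w = ap (ap (kc (cCons σ)) a) v.
Proof.
  pose proof (HM _ _ (e_seq [(σ^*)%ty] σ v0) (econs w enil)) as H.
  rewrite sat_or, sat_ex in H. destruct H as [H|[a H]]; [left; exact H|right].
  rewrite sat_ex in H. destruct H as [v H]. exists a, v. exact H.
Qed.

Lemma M_ind (P : D M ι -> Prop) : dfn [ι%ty] (fun e => P (e _ vz)) ->
  P (kc cZero) -> (forall n, P n -> P (ap (kc cSucc) n)) -> forall n, P n.
Proof.
  intros [d [A [e' H]]] H0 HS.
  pose proof (HM _ _ (e_ind d A) e') as K. cbn [sat] in K.
  rewrite sat_inst in K. intros n. apply (H (econs n enil)), K.
  - apply (H (econs _ enil)), H0.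
  - intros m Hm. rewrite sat_subst, esub_scons. apply (H (econs (ap (kc cSucc) m) enil)), HS.
    apply (H (econs m enil)), Hm.
Qed.

End Combinators.

Notation zM := (kc cZero).
Notation sM n := (ap (kc cSucc) n).
Notation nilM := (kc (cNil _)).
Notation consM a w := (ap (ap (kc (cCons _)) a) w).

Definition addM {M} : D M (ι ⇒ ι ⇒ ι) := ev enil add.
Definition predM {M} : D M (ι ⇒ ι) := ev enil pred.
Definition monM {M} : D M (ι ⇒ ι ⇒ ι) := ev enil monus.
Definition ifzM {M σ} : D M (ι ⇒ σ ⇒ σ ⇒ σ) := ev enil ifz.
Definition triM {M} : D M (ι ⇒ ι) := ev enil tri.
Definition pairM {M} : D M (ι ⇒ ι ⇒ ι) := ev enil pair.
Definition diagM {M} : D M (ι ⇒ ι) := ev enil diag.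
Definition psndM {M} : D M (ι ⇒ ι) := ev enil psnd.
Definition pfstM {M} : D M (ι ⇒ ι) := ev enil pfst.
Definition codeM {M} : D M (ι^* ⇒ ι) := ev enil code.
Definition decM {M} : D M (ι ⇒ ι^*) := ev enil decode.
Definition lenM {M σ} : D M (σ^* ⇒ ι) := ev enil len.
Definition appM {M σ} : D M (σ^* ⇒ σ^* ⇒ σ^*) := ev enil append.
Definition catM {M σ} : D M (σ^* ⇒ (ι ⇒ σ) ⇒ ι ⇒ σ) := ev enil catf.
Definition nthM {M σ} : D M (σ^* ⇒ ι ⇒ σ) := ev enil nth'.
Definition segM {M} : D M (ty1 ⇒ ι ⇒ ι^*) := ev enil seg.
Definition segcM {M} : D M (ty1 ⇒ ι ⇒ ι) := ev enil segc.
Definition lhM {M} : D M (ι ⇒ ι) := ev enil lh.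
Definition padM {M} : D M (ι ⇒ ty1) := ev enil pad.
Definition snocM {M} : D M (ι ⇒ ι ⇒ ι) := ev enil snoc.
Definition extM {M} : D M (ι ⇒ ty1 ⇒ ty1) := ev enil ext.
Definition inicM {M} : D M (ι ⇒ ι ⇒ ι) := ev enil initc.
Definition GfM {M} : D M (ty2 ⇒ ι ⇒ ι ⇒ ι) := ev enil Gfun.
Definition HfM {M} : D M (ty2 ⇒ ι ⇒ ι ⇒ ι) := ev enil Hfun.
Definition GHM {M} : D M ((ty2 ⇒ ι ⇒ ι) ⇒ ty2 ⇒ ι ⇒ ty1) := ev enil GHstep.
Definition dfltM {M} σ : D M σ := ev enil (dflt σ).

Lemma ev_closed {M c τ} (e : env M c) (t : tm nil τ) : ev e (tsubst nosub t) = ev enil t.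
Proof. rewrite ev_subst. f_equal. apply env_nil. Qed.

Section Constants.
Context {M : structure} {c : ctx} (e : env M c).
Lemma ev_add : ev e add = addM. Proof. reflexivity. Qed.
Lemma ev_pred : ev e pred = predM. Proof. reflexivity. Qed.
Lemma ev_mon : ev e monus = monM. Proof. reflexivity. Qed.
Lemma ev_ifz σ : ev e (@ifz c σ) = ifzM. Proof. reflexivity. Qed.
Lemma ev_tri : ev e tri = triM. Proof. reflexivity. Qed.
Lemma ev_pair : ev e pair = pairM. Proof. reflexivity. Qed.
Lemma ev_diag : ev e diag = diagM. Proof. reflexivity. Qed.
Lemma ev_psnd : ev e psnd = psndM. Proof. reflexivity. Qed.
Lemma ev_pfst : ev e pfst = pfstM. Proof. reflexivity. Qed.
Lemma ev_code : ev e code = codeM. Proof. reflexivity. Qed.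
Lemma ev_dec : ev e decode = decM. Proof. reflexivity. Qed.
Lemma ev_len σ : ev e (@len c σ) = lenM. Proof. reflexivity. Qed.
Lemma ev_app σ : ev e (@append c σ) = appM. Proof. reflexivity. Qed.
Lemma ev_cat σ : ev e (@catf c σ) = catM. Proof. reflexivity. Qed.
Lemma ev_seg : ev e seg = segM. Proof. reflexivity. Qed.
Lemma ev_segc : ev e segc = segcM. Proof. reflexivity. Qed.
Lemma ev_lh : ev e lh = lhM. Proof. reflexivity. Qed.
Lemma ev_pad : ev e pad = padM. Proof. reflexivity. Qed.
Lemma ev_snoc : ev e snoc = snocM. Proof. reflexivity. Qed.
Lemma ev_ext : ev e ext = extM. Proof. reflexivity. Qed.
Lemma ev_inic : ev e initc = inicM. Proof. reflexivity. Qed.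
Lemma ev_Gf : ev e Gfun = GfM. Proof. reflexivity. Qed.
Lemma ev_Hf : ev e Hfun = HfM. Proof. reflexivity. Qed.
Lemma ev_GH : ev e GHstep = GHM. Proof. reflexivity. Qed.
Lemma ev_nth σ : ev e (@nth' c σ) = nthM.
Proof. unfold nthM. rewrite <- (ev_closed e), tsubst_nth. reflexivity. Qed.
Lemma ev_dflt σ : ev e (dflt σ) = dfltM σ.
Proof. unfold dfltM. rewrite <- (ev_closed e), tsubst_dflt. reflexivity. Qed.
End Constants.

(* [rewrite] would compare the closed terms of the language up to conversion. *)
Ltac rw_at t E := pattern t; refine (eq_ind_r _ _ E); cbv beta.
Ltac evs := repeat first
  [ progress cbn [ev econs Rec LRec succ zero nil' cons'] | match goal with
  | |- context [ap (ev ?e (lam ?t)) ?x] => rw_at (ap (ev e (lam t)) x) (ev_lam t e x)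
  | |- context [ev (econs ?a ?e) (wk ?t)] => rw_at (ev (econs a e) (wk t)) (ev_wk t a e)
  | |- context [ev ?e (@add ?c)] => rw_at (ev e (@add c)) (ev_add e)
  | |- context [ev ?e (@pred ?c)] => rw_at (ev e (@pred c)) (ev_pred e)
  | |- context [ev ?e (@monus ?c)] => rw_at (ev e (@monus c)) (ev_mon e)
  | |- context [ev ?e (@ifz ?c ?σ)] => rw_at (ev e (@ifz c σ)) (ev_ifz e σ)
  | |- context [ev ?e (@tri ?c)] => rw_at (ev e (@tri c)) (ev_tri e)
  | |- context [ev ?e (@pair ?c)] => rw_at (ev e (@pair c)) (ev_pair e)
  | |- context [ev ?e (@diag ?c)] => rw_at (ev e (@diag c)) (ev_diag e)
  | |- context [ev ?e (@psnd ?c)] => rw_at (ev e (@psnd c)) (ev_psnd e)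
  | |- context [ev ?e (@pfst ?c)] => rw_at (ev e (@pfst c)) (ev_pfst e)
  | |- context [ev ?e (@code ?c)] => rw_at (ev e (@code c)) (ev_code e)
  | |- context [ev ?e (@decode ?c)] => rw_at (ev e (@decode c)) (ev_dec e)
  | |- context [ev ?e (@len ?c ?σ)] => rw_at (ev e (@len c σ)) (ev_len e σ)
  | |- context [ev ?e (@append ?c ?σ)] => rw_at (ev e (@append c σ)) (ev_app e σ)
  | |- context [ev ?e (@catf ?c ?σ)] => rw_at (ev e (@catf c σ)) (ev_cat e σ)
  | |- context [ev ?e (@seg ?c)] => rw_at (ev e (@seg c)) (ev_seg e)
  | |- context [ev ?e (@segc ?c)] => rw_at (ev e (@segc c)) (ev_segc e)
  | |- context [ev ?e (@lh ?c)] => rw_at (ev e (@lh c)) (ev_lh e)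
  | |- context [ev ?e (@pad ?c)] => rw_at (ev e (@pad c)) (ev_pad e)
  | |- context [ev ?e (@snoc ?c)] => rw_at (ev e (@snoc c)) (ev_snoc e)
  | |- context [ev ?e (@ext ?c)] => rw_at (ev e (@ext c)) (ev_ext e)
  | |- context [ev ?e (@initc ?c)] => rw_at (ev e (@initc c)) (ev_inic e)
  | |- context [ev ?e (@Gfun ?c)] => rw_at (ev e (@Gfun c)) (ev_Gf e)
  | |- context [ev ?e (@Hfun ?c)] => rw_at (ev e (@Hfun c)) (ev_Hf e)
  | |- context [ev ?e (@GHstep ?c)] => rw_at (ev e (@GHstep c)) (ev_GH e)
  | |- context [ev ?e (@nth' ?c ?σ)] => rw_at (ev e (@nth' c σ)) (ev_nth e σ)
  | |- context [ev ?e (dflt ?σ)] => rw_at (ev e (dflt σ)) (ev_dflt e σ)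
  end ].

Definition leM {M} (x y : D M ι) : Prop := ap (ap monM x) y = zM.
Definition ltM {M} (x y : D M ι) : Prop := leM (sM x) y.
Definition memM {M σ} (x : D M σ) (w : D M (σ^*)) : Prop :=
  exists j, ltM j (ap lenM w) /\ ap (ap nthM w) j = x.

Ltac dfn := unfold ltM, leM, memM; repeat dfn_step; repeat rep_step.

Section Arith.
Context {M : structure} {HM : epa_model M}.
Implicit Types (x y z n m k : D M ι).

Ltac ind n := pattern n; revert n; apply M_ind; [dfn | | ].

Lemma num_case n : n = zM \/ exists m, n = sM m.
Proof. ind n; [left; reflexivity | intros; right; eauto]. Qed.

Lemma add_0 x : ap (ap addM x) zM = x.
Proof. unfold addM, add. evs. apply Rec_0. Qed.
Lemma add_S x y : ap (ap addM x) (sM y) = sM (ap (ap addM x) y).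
Proof. unfold addM, add. evs. rewrite Rec_S. evs. reflexivity. Qed.
Lemma add_0l x : ap (ap addM zM) x = x.
Proof. ind x; [apply add_0|]. intros n H. rewrite add_S. congruence. Qed.
Lemma add_Sl x y : ap (ap addM (sM x)) y = sM (ap (ap addM x) y).
Proof. ind y; [rewrite !add_0; reflexivity|]. intros n H. rewrite !add_S. congruence. Qed.
Lemma add_comm x y : ap (ap addM x) y = ap (ap addM y) x.
Proof. ind y; [rewrite add_0, add_0l; reflexivity|]. intros n H. rewrite add_S, add_Sl. congruence. Qed.

Lemma pred_0 : ap predM zM = zM :> D M ι.
Proof. unfold predM, pred. evs. apply Rec_0. Qed.
Lemma pred_S x : ap predM (sM x) = x.
Proof. unfold predM, pred. evs. rewrite Rec_S. evs. reflexivity. Qed.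
Lemma mon_0 x : ap (ap monM x) zM = x.
Proof. unfold monM, monus. evs. apply Rec_0. Qed.
Lemma mon_S x y : ap (ap monM x) (sM y) = ap predM (ap (ap monM x) y).
Proof. unfold monM, monus. evs. rewrite Rec_S. evs. reflexivity. Qed.
Lemma mon_SS x y : ap (ap monM (sM x)) (sM y) = ap (ap monM x) y.
Proof.
  ind y; [rewrite mon_S, !mon_0; apply pred_S|]. intros n H. rewrite mon_S, H, mon_S. reflexivity.
Qed.
Lemma mon_0l x : ap (ap monM zM) x = zM.
Proof. ind x; [apply mon_0|]. intros n H. rewrite mon_S, H. apply pred_0. Qed.
Lemma mon_add x y : ap (ap monM (ap (ap addM x) y)) x = y.
Proof. ind x; [rewrite add_0l; apply mon_0|]. intros n H. rewrite add_Sl, mon_SS. exact H. Qed.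
Lemma mon_addl x y z : ap (ap monM (ap (ap addM x) y)) (ap (ap addM x) z) = ap (ap monM y) z.
Proof. ind x; [rewrite !add_0l; reflexivity|]. intros n H. rewrite !add_Sl, mon_SS. exact H. Qed.

Lemma ifz_0 σ (a b : D M σ) : ap (ap (ap ifzM zM) a) b = a.
Proof. unfold ifzM, ifz. evs. apply Rec_0. Qed.
Lemma ifz_S σ n (a b : D M σ) : ap (ap (ap ifzM (sM n)) a) b = b.
Proof. unfold ifzM, ifz. evs. rewrite Rec_S. evs. reflexivity. Qed.

Lemma le_SS x y : leM (sM x) (sM y) <-> leM x y.
Proof. unfold leM. rewrite mon_SS. tauto. Qed.
Lemma le_0 x : leM zM x.
Proof. apply mon_0l. Qed.
Lemma le_S0 x : ~ leM (sM x) zM.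
Proof. unfold leM. rewrite mon_0. apply succ_0. Qed.
Lemma le_0_inv x : leM x zM -> x = zM.
Proof. unfold leM. rewrite mon_0. auto. Qed.
Lemma le_refl x : leM x x.
Proof. ind x; [apply le_0|]. intros n H. apply le_SS, H. Qed.

Lemma le_trans x y z : leM x y -> leM y z -> leM x z.
Proof.
  revert y z. ind x; [intros; apply le_0|]. intros n IH y z.
  destruct (num_case y) as [->|[y' ->]]; [intros H; destruct (le_S0 _ H)|].
  destruct (num_case z) as [->|[z' ->]]; [intros _ H; destruct (le_S0 _ H)|].
  rewrite !le_SS. apply IH.
Qed.
Lemma le_antisym x y : leM x y -> leM y x -> x = y.
Proof.
  revert y. ind x; [intros y _ H; symmetry; apply le_0_inv, H|]. intros n IH y.
  destruct (num_case y) as [->|[y' ->]]; [intros H; destruct (le_S0 _ H)|].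
  rewrite !le_SS. intros. f_equal. auto.
Qed.
Lemma le_or_lt x y : leM x y \/ ltM y x.
Proof.
  unfold ltM. revert y. ind x; [left; apply le_0|]. intros n IH y.
  destruct (num_case y) as [->|[y' ->]]; [right; apply le_SS, le_0|].
  rewrite !le_SS. apply IH.
Qed.
Lemma le_Sr x y : leM x y -> leM x (sM y).
Proof.
  revert y. ind x; [intros; apply le_0|]. intros n IH y.
  destruct (num_case y) as [->|[y' ->]]; [intros H; destruct (le_S0 _ H)|].
  rewrite !le_SS. apply IH.
Qed.
Lemma lt_le x y : ltM x y -> leM x y.
Proof. intros H. apply le_trans with (sM x); auto. apply le_Sr, le_refl. Qed.
Lemma lt_irrefl x : ~ ltM x x.
Proof. unfold ltM. ind x; [apply le_S0|]. intros n H. rewrite le_SS. exact H. Qed.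
Lemma lt_S x y : ltM x (sM y) <-> leM x y.
Proof. apply le_SS. Qed.
Lemma lt_le_trans x y z : ltM x y -> leM y z -> ltM x z.
Proof. apply le_trans. Qed.
Lemma le_lt_trans x y z : leM x y -> ltM y z -> ltM x z.
Proof. intros H1 H2. apply le_trans with (sM y); [apply le_SS, H1|exact H2]. Qed.
Lemma le_lt_eq x y : leM x y -> x = y \/ ltM x y.
Proof. intros H. destruct (le_or_lt y x); [left; apply le_antisym; auto | auto]. Qed.
Lemma le_add x y : leM x (ap (ap addM x) y).
Proof. ind y; [rewrite add_0; apply le_refl|]. intros n H. rewrite add_S. apply le_Sr, H. Qed.
Lemma le_addr x y : leM x (ap (ap addM y) x).
Proof. rewrite add_comm. apply le_add. Qed.
Lemma add_mon x y : leM x y -> ap (ap addM x) (ap (ap monM y) x) = y.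
Proof.
  revert y. ind x; [intros y _; rewrite add_0l, mon_0; reflexivity|]. intros n IH y.
  destruct (num_case y) as [->|[y' ->]]; [intros H; destruct (le_S0 _ H)|].
  rewrite le_SS, add_Sl, mon_SS. intros. f_equal. auto.
Qed.
(** The form needed to unfold recursions on a difference such as [N - |s|]. *)
Lemma lt_mon x y : ltM x y -> exists z, ap (ap monM y) x = sM z /\ ap (ap monM y) (sM x) = z.
Proof.
  intros H. rewrite mon_S. destruct (num_case (ap (ap monM y) x)) as [E|[z E]].
  - exfalso. apply (lt_irrefl x), lt_le_trans with y; auto.
  - exists z. rewrite E, pred_S. auto.
Qed.

(** * The coding of finite sequences *)

Lemma tri_0 : ap triM (zM : D M ι) = zM.
Proof. unfold triM, tri. evs. apply Rec_0. Qed.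
Lemma tri_S n : ap triM (sM n) = ap (ap addM (ap triM n)) (sM n).
Proof. unfold triM, tri. evs. rewrite Rec_S. evs. reflexivity. Qed.
Lemma diag_0 : ap diagM (zM : D M ι) = zM.
Proof. unfold diagM, diag. evs. apply Rec_0. Qed.
Lemma diag_S n : ap diagM (sM n) =
  ap (ap (ap ifzM (ap (ap monM (ap triM (sM (ap diagM n)))) (sM n))) (sM (ap diagM n))) (ap diagM n).
Proof. unfold diagM, diag. evs. rewrite Rec_S. evs. reflexivity. Qed.

(** Induction on [d], and on [r] within a diagonal: [diag] keeps its value while the argument runs
    from [tri d] to [tri d + d] and jumps at the next number, which is [tri (d + 1)]. *)
Lemma diag_tri (d r : D M ι) : leM r d -> ap diagM (ap (ap addM (ap triM d)) r) = d.
Proof.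
  revert r. ind d.
  - intros r H. apply le_0_inv in H as ->. rewrite tri_0, add_0. apply diag_0.
  - intros d IH.
    assert (H0 : ap diagM (ap triM (sM d)) = sM d).
    { rewrite tri_S, add_S, diag_S, IH by apply le_refl.
      (* [leM] is by definition an equation, and its reflexivity reads x - x = 0. *)
      rewrite tri_S, add_S, mon_SS, (le_refl _ : _ = _). apply ifz_0. }
    intros r. ind r.
    + intros _. rewrite add_0. exact H0.
    + intros r IHr Hr. rewrite add_S, diag_S, IHr by (apply lt_le, Hr).
      rewrite (tri_S (sM d)), add_S, mon_SS, mon_addl.
      destruct (num_case (ap (ap monM (sM d)) r)) as [E|[k ->]].
      * exfalso. apply (lt_irrefl r), lt_le_trans with (sM d); auto.
      * apply ifz_S.
Qed.

Lemma pair_eq x y : ap (ap pairM x) y = ap (ap addM (ap triM (ap (ap addM x) y))) y.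
Proof. unfold pairM, pair. evs. reflexivity. Qed.
Lemma diag_pair x y : ap diagM (ap (ap pairM x) y) = ap (ap addM x) y.
Proof. rewrite pair_eq. apply diag_tri, le_addr. Qed.
Lemma psnd_pair x y : ap psndM (ap (ap pairM x) y) = y.
Proof. unfold psndM, psnd. evs. rewrite diag_pair, pair_eq. apply mon_add. Qed.
Lemma pfst_pair x y : ap pfstM (ap (ap pairM x) y) = x.
Proof. unfold pfstM, pfst. evs. rewrite diag_pair, psnd_pair, add_comm. apply mon_add. Qed.

End Arith.

Ltac ind n := pattern n; revert n; apply M_ind; [dfn | | ].

Section Lists.
Context {M : structure} {HM : epa_model M}.
Implicit Types (n m k s i : D M ι).

Lemma len_nil σ : ap lenM (kc (cNil σ) : D M _) = zM.
Proof. unfold lenM, len. evs. apply LRec_nil. Qed.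
Lemma len_cons σ (a : D M σ) w : ap lenM (consM a w) = sM (ap lenM w).
Proof. unfold lenM, len. evs. rewrite LRec_cons. evs. reflexivity. Qed.

(** The theory has induction for numbers only. Induction on the length suffices, because by
    [seq_case] every sequence is empty or a cons. *)
Lemma seq_ind σ (P : D M (σ^*) -> Prop) : dfn [(σ^*)%ty] (fun e => P (e _ vz)) ->
  P nilM -> (forall a w, P w -> P (consM a w)) -> forall w, P w.
Proof.
  intros Hd H0 HS.
  assert (H : forall n w, ap lenM w = n -> P w).
  { apply (M_ind (fun n => forall w, ap lenM w = n -> P w)).
    - apply dfn_all, dfn_imp; [dfn|]. destruct Hd as [d [A [e' H]]].
      assert (E : forall e : env M [(σ^*)%ty; ι%ty], P (e _ vz) <-> isat A (econs (e _ vz) e'))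
        by (intros e; apply (H (econs (e _ vz) enil))).
      eapply dfn_iff; [|intros e; symmetry; apply E].
      apply dfn_sat. apply rep_econs; intros; apply rep_var || apply rep_const.
    - intros w Hw. destruct (seq_case _ w) as [->|[a [v ->]]]; auto.
      rewrite len_cons in Hw. destruct (succ_0 _ Hw).
    - intros n IH w Hw. destruct (seq_case _ w) as [->|[a [v ->]]]; auto.
      apply HS, IH. rewrite len_cons in Hw. apply succ_inj, Hw. }
  intros w. exact (H _ w eq_refl).
Qed.

Lemma app_nil σ (w : D M (σ^*)) : ap (ap appM nilM) w = w.
Proof. unfold appM, append. evs. apply LRec_nil. Qed.
Lemma app_cons σ a (v w : D M (σ^*)) : ap (ap appM (consM a v)) w = consM a (ap (ap appM v) w).
Proof. unfold appM, append. evs. rewrite LRec_cons. evs. reflexivity. Qed.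

Lemma cat_nil σ (f : D M (ι ⇒ σ)) : ap (ap catM nilM) f = f.
Proof. unfold catM, catf. evs. apply LRec_nil. Qed.
Lemma cat_cons0 σ a w (f : D M (ι ⇒ σ)) : ap (ap (ap catM (consM a w)) f) zM = a.
Proof. unfold catM, catf. evs. rewrite LRec_cons. evs. apply Rec_0. Qed.
Lemma cat_consS σ a w (f : D M (ι ⇒ σ)) n :
  ap (ap (ap catM (consM a w)) f) (sM n) = ap (ap (ap catM w) f) n.
Proof. unfold catM, catf. evs. rewrite LRec_cons. evs. rewrite Rec_S. evs. reflexivity. Qed.

Lemma nth_cat σ (w : D M (σ^*)) : ap nthM w = ap (ap catM w) (dfltM (ι ⇒ σ)).
Proof. unfold nthM, nth'. evs. reflexivity. Qed.
Lemma nth_cons0 σ a (w : D M (σ^*)) : ap (ap nthM (consM a w)) zM = a.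
Proof. rewrite nth_cat. apply cat_cons0. Qed.
Lemma nth_consS σ a (w : D M (σ^*)) n : ap (ap nthM (consM a w)) (sM n) = ap (ap nthM w) n.
Proof. rewrite !nth_cat. apply cat_consS. Qed.

Lemma mem_nil σ (x : D M σ) : ~ memM x nilM.
Proof. intros [j [H _]]. rewrite len_nil in H. exact (le_S0 _ H). Qed.
Lemma mem_cons σ (x a : D M σ) w : memM x (consM a w) <-> x = a \/ memM x w.
Proof.
  unfold memM. rewrite len_cons. split.
  - intros [j [H Hj]]. destruct (num_case j) as [->|[i ->]].
    + rewrite nth_cons0 in Hj. auto.
    + right. exists i. rewrite nth_consS in Hj. split; auto. apply le_SS, H.
  - intros [->|[j [H Hj]]].
    + exists zM. rewrite nth_cons0. split; auto. apply le_SS, le_0.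
    + exists (sM j). rewrite nth_consS. split; auto. apply le_SS, H.
Qed.

Ltac lind w := pattern w; revert w; apply seq_ind; [dfn | | ].

Lemma mem_app σ (x : D M σ) v w : memM x (ap (ap appM v) w) <-> memM x v \/ memM x w.
Proof.
  enough (H : (memM x (ap (ap appM v) w) -> memM x v \/ memM x w) /\
              (memM x v \/ memM x w -> memM x (ap (ap appM v) w))) by tauto.
  lind v.
  - rewrite app_nil. pose proof (@mem_nil _ x). tauto.
  - intros a v H. rewrite app_cons, !mem_cons. tauto.
Qed.

Lemma len_app σ (v w : D M (σ^*)) : ap lenM (ap (ap appM v) w) = ap (ap addM (ap lenM v)) (ap lenM w).
Proof.
  lind v.
  - rewrite app_nil, len_nil, add_0l. reflexivity.
  - intros a v H. rewrite app_cons, !len_cons, add_Sl, H. reflexivity.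
Qed.

Lemma cat_app σ (v w : D M (σ^*)) f :
  ap (ap catM (ap (ap appM v) w)) f = ap (ap catM v) (ap (ap catM w) f).
Proof.
  lind v.
  - rewrite app_nil, cat_nil. reflexivity.
  - intros a v H. rewrite app_cons. apply M_ext. intros n.
    destruct (num_case n) as [->|[m ->]]; rewrite ?cat_cons0, ?cat_consS; congruence.
Qed.

Lemma cat_lt σ (w : D M (σ^*)) f g n : ltM n (ap lenM w) ->
  ap (ap (ap catM w) f) n = ap (ap (ap catM w) g) n.
Proof.
  revert n. lind w.
  - intros n H. rewrite len_nil in H. destruct (le_S0 _ H).
  - intros a w IH n. rewrite len_cons. destruct (num_case n) as [->|[m ->]]; rewrite ?cat_cons0, ?cat_consS; auto.
    unfold ltM. rewrite le_SS. apply IH.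
Qed.

Lemma cat_ge σ (w : D M (σ^*)) f n : ap (ap (ap catM w) f) (ap (ap addM (ap lenM w)) n) = ap f n.
Proof.
  lind w.
  - rewrite len_nil, cat_nil, add_0l. reflexivity.
  - intros a w IH. rewrite len_cons, add_Sl, cat_consS. exact IH.
Qed.

Lemma list_ext σ (v w : D M (σ^*)) : ap lenM v = ap lenM w ->
  (forall n, ltM n (ap lenM v) -> ap (ap nthM v) n = ap (ap nthM w) n) -> v = w.
Proof.
  revert w. lind v.
  - intros w H _. destruct (seq_case _ w) as [->|[b [w' ->]]]; auto.
    rewrite len_nil, len_cons in H. symmetry in H. destruct (succ_0 _ H).
  - intros a v IH w. destruct (seq_case _ w) as [->|[b [w' ->]]]; rewrite ?len_cons, ?len_nil; intros Hl Hn.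
    + destruct (succ_0 _ Hl).
    + f_equal; [f_equal|].
      * specialize (Hn zM). rewrite !nth_cons0 in Hn. apply Hn, le_SS, le_0.
      * apply IH; [apply succ_inj, Hl|]. intros n H. specialize (Hn (sM n)).
        rewrite !nth_consS in Hn. apply Hn, le_SS, H.
Qed.

Lemma code_nil : ap codeM (nilM : D M _) = zM.
Proof. unfold codeM, code. evs. apply LRec_nil. Qed.
Lemma code_cons (a : D M ι) w : ap codeM (consM a w) = sM (ap (ap pairM a) (ap codeM w)).
Proof. unfold codeM, code. evs. rewrite LRec_cons. evs. reflexivity. Qed.

(** [decode] uses its argument also as fuel for the recursion; [F] separates the two, so that the
    fuel may vary in inductions. *)
Lemma dec_fuel : exists F : D M (ι ⇒ ι ⇒ ι^*),
  (forall n, ap decM n = ap (ap F n) n) /\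
  (forall x, ap (ap F zM) x = nilM) /\
  (forall m, ap (ap F (sM m)) zM = nilM) /\
  (forall m x, ap (ap F (sM m)) (sM x) = consM (ap pfstM x) (ap (ap F m) (ap psndM x))).
Proof.
  exists (ev enil (λ Rec · v0 · (λ nil') ·
      (λ λ λ ifz · v0 · nil' ·
               (cons' · (pfst · (pred · v0)) · (v2 · (psnd · (pred · v0))))))).
  repeat split; intros.
  - unfold decM, decode. evs. reflexivity.
  - evs. rewrite Rec_0. evs. reflexivity.
  - evs. rewrite Rec_S. evs. apply ifz_0.
  - evs. rewrite Rec_S. evs. rewrite ifz_S, !pred_S. reflexivity.
Qed.

(** Any fuel of at least [code w] is enough: a pair is at least its second component, so the code of
    the tail is below the code of the whole. *)
Lemma dec_code (w : D M (ι^*)) : ap decM (ap codeM w) = w.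
Proof.
  destruct dec_fuel as [F [F1 [F2 [F3 F4]]]]. rewrite F1.
  enough (H : forall m, leM (ap codeM w) m -> ap (ap F m) (ap codeM w) = w) by (apply H, le_refl).
  lind w.
  - intros m _. rewrite code_nil. destruct (num_case m) as [->|[k ->]]; auto.
  - intros a w IH m. rewrite code_cons. destruct (num_case m) as [->|[k ->]]; intros H.
    + destruct (le_S0 _ H).
    + rewrite F4, pfst_pair, psnd_pair, IH; auto. rewrite le_SS in H.
      eapply le_trans; [|exact H]. rewrite pair_eq. apply le_addr.
Qed.

Lemma seg_0 (f : D M ty1) : ap (ap segM f) zM = nilM.
Proof. unfold segM, seg. evs. apply Rec_0. Qed.
Lemma seg_S (f : D M ty1) n :
  ap (ap segM f) (sM n) = ap (ap appM (ap (ap segM f) n)) (consM (ap f n) nilM).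
Proof. unfold segM, seg. evs. rewrite Rec_S. evs. reflexivity. Qed.
Lemma len_seg (f : D M ty1) n : ap lenM (ap (ap segM f) n) = n.
Proof.
  ind n; [rewrite seg_0; apply len_nil|]. intros n H.
  rewrite seg_S, len_app, H, len_cons, len_nil, add_S, add_0. reflexivity.
Qed.
Lemma nth_seg (f : D M ty1) n i : ltM i n -> ap (ap nthM (ap (ap segM f) n)) i = ap f i.
Proof.
  rewrite nth_cat. ind n; [intros H; destruct (le_S0 _ H)|]. intros n IH H.
  rewrite seg_S, cat_app. rewrite lt_S in H. destruct (le_lt_eq _ _ H) as [->|H'].
  - pose proof (cat_ge _ (ap (ap segM f) n) (ap (ap catM (consM (ap f n) nilM)) (dfltM (ι ⇒ ι))) zM) as K.
    rewrite add_0, len_seg, cat_cons0 in K. exact K.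
  - rewrite <- (IH H'). apply cat_lt. rewrite len_seg. exact H'.
Qed.
Lemma seg_ext (f g : D M ty1) n : (forall i, ltM i n -> ap f i = ap g i) <-> ap (ap segM f) n = ap (ap segM g) n.
Proof.
  split.
  - intros H. apply list_ext; rewrite !len_seg; auto. intros i Hi. rewrite !nth_seg; auto.
  - intros H i Hi. rewrite <- (nth_seg f n i Hi), <- (nth_seg g n i Hi), H. reflexivity.
Qed.

Lemma segc_eq (f : D M ty1) n : ap (ap segcM f) n = ap codeM (ap (ap segM f) n).
Proof. unfold segcM, segc. evs. reflexivity. Qed.
Lemma lh_eq s : ap lhM s = ap lenM (ap decM s).
Proof. unfold lhM, lh. evs. reflexivity. Qed.
Lemma pad_eq s : ap padM s = ap nthM (ap decM s).
Proof. unfold padM, pad. evs. reflexivity. Qed.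
Lemma snoc_eq s (a : D M ι) : ap (ap snocM s) a = ap codeM (ap (ap appM (ap decM s)) (consM a nilM)).
Proof. unfold snocM, snoc. evs. reflexivity. Qed.
Lemma ext_eq s (f : D M ty1) : ap (ap extM s) f = ap (ap catM (ap decM s)) f.
Proof. unfold extM, ext. evs. reflexivity. Qed.
Lemma inic_eq s n : ap (ap inicM s) n = ap (ap segcM (ap padM s)) n.
Proof. unfold inicM, initc. evs. reflexivity. Qed.

Lemma segc_ext (f g : D M ty1) n :
  ap (ap segcM f) n = ap (ap segcM g) n <-> (forall i, ltM i n -> ap f i = ap g i).
Proof.
  rewrite seg_ext, !segc_eq. split; [|congruence].
  intros H. rewrite <- (dec_code (ap (ap segM f) n)), H. apply dec_code.
Qed.
Lemma lh_segc (f : D M ty1) n : ap lhM (ap (ap segcM f) n) = n.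
Proof. rewrite lh_eq, segc_eq, dec_code. apply len_seg. Qed.
Lemma pad_segc (f : D M ty1) n i : ltM i n -> ap (ap padM (ap (ap segcM f) n)) i = ap f i.
Proof. rewrite pad_eq, segc_eq, dec_code. apply nth_seg. Qed.
Lemma inic_segc (f : D M ty1) n m : leM m n -> ap (ap inicM (ap (ap segcM f) n)) m = ap (ap segcM f) m.
Proof.
  intros H. rewrite inic_eq. apply segc_ext. intros i Hi. apply pad_segc. eapply lt_le_trans; eauto.
Qed.
Lemma dec_snoc s (a : D M ι) : ap decM (ap (ap snocM s) a) = ap (ap appM (ap decM s)) (consM a nilM).
Proof. rewrite snoc_eq. apply dec_code. Qed.
Lemma lh_snoc s (a : D M ι) : ap lhM (ap (ap snocM s) a) = sM (ap lhM s).
Proof. rewrite !lh_eq, dec_snoc, len_app, len_cons, len_nil, add_S, add_0. reflexivity. Qed.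

(** The recursion in [Hfun] runs over the number of remaining stages [n - |s|]. Here that number is
    a successor, and appending one entry to [s] lowers it by one. *)
Lemma H_step (Y : D M ty2) s n : ltM (ap lhM s) n ->
  ap (ap (ap HfM Y) s) n = ap Y (ap (ap extM (ap (ap snocM s) zM))
    (ap nthM (ap (ap segM
      (ev (econs n (econs s (econs Y enil))) (λ Hfun · v3 · (snoc · v2 · (succ · v0)) · v1))) n))).
Proof.
  intros H. destruct (lt_mon _ _ H) as [z [E1 E2]].
  unfold HfM at 1, Hfun. evs. rewrite E1, Rec_S. evs. do 5 f_equal. apply M_ext. intros k. evs.
  unfold HfM, Hfun. evs. rewrite lh_snoc, E2. reflexivity.
Qed.

Lemma GHstep_eq (Γ : D M (ty2 ⇒ ι ⇒ ι)) Z t :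
  ap (ap (ap GHM Γ) Z) t = ap (ap extM (ap (ap snocM t) zM))
    (ev (econs t (econs Z (econs Γ enil))) (λ v3 · v2 · (snoc · v1 · (succ · v0)))).
Proof. unfold GHM, GHstep. evs. reflexivity. Qed.

End Lists.
Ltac lind w := pattern w; revert w; apply seq_ind; [dfn | | ].

(** * Mapping, flattening, sums and bounded search on finite sequences *)

Definition lmap {c σ τ} : tm c ((σ ⇒ τ) ⇒ σ^* ⇒ τ^*) := λ λ LRec · v0 · nil' · (λ λ cons' · (v3 · v0) · v1).
Definition lbind {c σ τ} : tm c ((σ ⇒ τ^*) ⇒ σ^* ⇒ τ^*) :=
  λ λ LRec · v0 · nil' · (λ λ append · (v3 · v0) · v1).
Definition lsum {c} : tm c (ι^* ⇒ ι) := λ LRec · v0 · zero · (λ λ add · v1 · v0).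
Definition upto {c} : tm c (ι ⇒ ι^*) := λ Rec · v0 · nil' · (λ λ cons' · v0 · v1).
(* The last n < k with f n <> 0, or 0 if there is none. *)
Definition srch {c} : tm c (ty1 ⇒ ι ⇒ ι) := λ λ Rec · v0 · zero · (λ λ ifz · (v3 · v0) · v1 · v0).

Definition lmapM {M σ τ} : D M ((σ ⇒ τ) ⇒ σ^* ⇒ τ^*) := ev enil lmap.
Definition lbindM {M σ τ} : D M ((σ ⇒ τ^*) ⇒ σ^* ⇒ τ^*) := ev enil lbind.
Definition lsumM {M} : D M (ι^* ⇒ ι) := ev enil lsum.
Definition uptoM {M} : D M (ι ⇒ ι^*) := ev enil upto.
Definition srchM {M} : D M (ty1 ⇒ ι ⇒ ι) := ev enil srch.

Section ListOps.
Context {M : structure} {HM : epa_model M}.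

Lemma map_nil σ τ (f : D M (σ ⇒ τ)) : ap (ap lmapM f) nilM = nilM.
Proof. unfold lmapM, lmap. evs. apply LRec_nil. Qed.
Lemma map_cons σ τ (f : D M (σ ⇒ τ)) a w : ap (ap lmapM f) (consM a w) = consM (ap f a) (ap (ap lmapM f) w).
Proof. unfold lmapM, lmap. evs. rewrite LRec_cons. evs. reflexivity. Qed.
Lemma len_map σ τ (f : D M (σ ⇒ τ)) w : ap lenM (ap (ap lmapM f) w) = ap lenM w.
Proof.
  lind w; [rewrite map_nil, !len_nil; reflexivity|].
  intros a w H. rewrite map_cons, !len_cons, H. reflexivity.
Qed.
Lemma nth_map σ τ (f : D M (σ ⇒ τ)) w j : ltM j (ap lenM w) ->
  ap (ap nthM (ap (ap lmapM f) w)) j = ap f (ap (ap nthM w) j).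
Proof.
  revert j. lind w.
  - intros j H. rewrite len_nil in H. destruct (le_S0 _ H).
  - intros a w IH j. rewrite len_cons, map_cons.
    destruct (num_case j) as [->|[i ->]]; rewrite ?nth_cons0, ?nth_consS; auto.
    unfold ltM. rewrite le_SS. apply IH.
Qed.
Lemma mem_map σ τ (f : D M (σ ⇒ τ)) x w : memM x w -> memM (ap f x) (ap (ap lmapM f) w).
Proof. intros [j [Hj <-]]. exists j. rewrite len_map, nth_map; auto. Qed.

Lemma bind_cons σ τ (f : D M (σ ⇒ τ^*)) a w :
  ap (ap lbindM f) (consM a w) = ap (ap appM (ap f a)) (ap (ap lbindM f) w).
Proof. unfold lbindM, lbind. evs. rewrite LRec_cons. evs. reflexivity. Qed.
Lemma mem_bind σ τ (f : D M (σ ⇒ τ^*)) x y w : memM x w -> memM y (ap f x) -> memM y (ap (ap lbindM f) w).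
Proof.
  intros H1 H2. revert H1. lind w.
  - intros H. destruct (mem_nil _ _ H).
  - intros a w IH. rewrite mem_cons, bind_cons, mem_app. intros [<-|H]; auto.
Qed.
Lemma le_sum (x : D M ι) w : memM x w -> leM x (ap lsumM w).
Proof.
  lind w; [intros H; destruct (mem_nil _ _ H)|]. intros a w IH. rewrite mem_cons.
  assert (E : ap lsumM (consM a w) = ap (ap addM (ap lsumM w)) a).
  { unfold lsumM, lsum. evs. rewrite LRec_cons. evs. reflexivity. }
  rewrite E. intros [<-|H]; [apply le_addr|]. apply le_trans with (ap lsumM w); auto. apply le_add.
Qed.

Lemma mem_upto (i n : D M ι) : ltM i n -> memM i (ap uptoM n).
Proof.
  ind n; [intros H; destruct (le_S0 _ H)|]. intros n IH H.
  assert (E : ap uptoM (sM n) = consM n (ap uptoM n)).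
  { unfold uptoM, upto. evs. rewrite Rec_S. evs. reflexivity. }
  rewrite E, mem_cons. rewrite lt_S in H. destruct (le_lt_eq _ _ H); auto.
Qed.

Lemma srch_spec (f : D M ty1) (n k : D M ι) : ltM n k -> ap f n <> zM ->
  ap f (ap (ap srchM f) k) <> zM /\ ltM (ap (ap srchM f) k) k.
Proof.
  intros H1 Hf. revert H1. ind k; [intros H; destruct (le_S0 _ H)|]. intros k IH H.
  assert (E : ap (ap srchM f) (sM k) = ap (ap (ap ifzM (ap f k)) (ap (ap srchM f) k)) k).
  { unfold srchM, srch. evs. rewrite Rec_S. evs. reflexivity. }
  rewrite E. destruct (num_case (ap f k)) as [Hk|[m Hk]].
  - rewrite Hk, ifz_0. rewrite lt_S in H. destruct (le_lt_eq _ _ H) as [->|H']; [tauto|].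
    destruct (IH H'). split; auto. apply le_Sr. assumption.
  - rewrite Hk, ifz_S, Hk. split; [apply succ_0|apply le_refl].
Qed.

End ListOps.

(** * Pairs *)

(* There are no product types: two types are made retracts of one type J, and then a pair is a
   function ι ⇒ J. *)

Record retr (J σ : ty) : Type := Retr {
  rin : tm nil (σ ⇒ J);
  rout : tm nil (J ⇒ σ);
  retr_eq : forall M, epa_model M -> forall a : D M σ, ap (ev enil rout) (ap (ev enil rin) a) = a
}.

Lemma retr_refl σ : retr σ σ.
Proof. refine (Retr σ σ (λ v0) (λ v0) _). intros M HM a. evs. reflexivity. Qed.

Lemma ev_tclose {M c τ} (e : env M c) (t : tm nil τ) : ev e (tclose t) = ev enil t.
Proof. apply ev_closed. Qed.

Ltac evc := repeat (evs; try rewrite ev_tclose).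

Lemma retr_arr ρ J σ : retr J σ -> retr (ρ ⇒ J) (ρ ⇒ σ).
Proof.
  intros [i p H]. refine (Retr _ _ (λ λ tclose i · (v1 · v0)) (λ λ tclose p · (v1 · v0)) _).
  intros M HM a. apply M_ext. intros x. evc. apply (H M HM).
Qed.

Lemma retr_const ρ J σ : retr J σ -> retr (ρ ⇒ J) σ.
Proof.
  intros [i p H]. refine (Retr _ _ (λ λ tclose i · v1) (λ tclose p · (v0 · dflt ρ)) _).
  intros M HM a. evc. apply (H M HM).
Qed.

Lemma retr_star J σ : retr J σ -> retr (J^*) (σ^*).
Proof.
  intros [i p H]. refine (Retr _ _ (λ lmap · tclose i · v0) (λ lmap · tclose p · v0) _).
  intros M HM w. evc.
  assert (Ev : forall c (e : env M c) σ τ, ev e (@lmap c σ τ) = lmapM) by reflexivity.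
  rewrite !Ev. lind w; [rewrite !map_nil; reflexivity|].
  intros a w E. rewrite !map_cons, E, H; auto.
Qed.

(** A number is represented by a sequence of that many default entries, and its length recovers
    it. *)
Lemma retr_num σ : retr (σ^*) ι.
Proof.
  refine (Retr _ _ (λ Rec · v0 · nil' · (λ λ cons' · dflt σ · v1)) len _).
  intros M HM a. evs.
  (* The step function must not mention [a] through its environment, since the induction is on
     [a]. *)
  replace (ev (econs a enil) _) with (@ev M nil enil (σ^* ⇒ ι ⇒ σ^*) (λ λ cons' · dflt σ · v1))
    by (do 2 (apply M_ext; intros); evs; reflexivity).
  ind a.
  - rewrite Rec_0. apply len_nil.
  - intros n H. rewrite Rec_S. evs. rewrite len_cons. congruence.
Qed.

(** An arrow on either side is absorbed by giving [J] the same argument type: one type is then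
    embedded pointwise, the other by constant functions. Numbers embed into sequences by length, and
    two sequence types are joined entrywise. *)
Lemma retr_join σ : forall τ, {J : ty & (retr J σ * retr J τ)%type}.
Proof.
  induction σ as [|σ1 _ σ2 IH|σ IH].
  - induction τ as [|τ1 _ τ2 [J [H1 H2]]|τ _].
    + exists ι%ty. split; apply retr_refl.
    + exists (τ1 ⇒ J)%ty. split; [apply retr_const, H1 | apply retr_arr, H2].
    + exists (τ^*)%ty. split; [apply retr_num | apply retr_refl].
  - intros τ. destruct (IH τ) as [J [H1 H2]].
    exists (σ1 ⇒ J)%ty. split; [apply retr_arr, H1 | apply retr_const, H2].
  - induction τ as [|τ1 _ τ2 [J [H1 H2]]|τ _].
    + exists (σ^*)%ty. split; [apply retr_refl | apply retr_num].
    + exists (τ1 ⇒ J)%ty. split; [apply retr_const, H1 | apply retr_arr, H2].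
    + destruct (IH τ) as [J [H1 H2]]. exists (J^*)%ty. split; apply retr_star; auto.
Qed.

Record pairs (σ τ : ty) : Type := Pairs {
  pty : ty;
  pmk : tm nil (σ ⇒ τ ⇒ pty);
  pp1 : tm nil (pty ⇒ σ);
  pp2 : tm nil (pty ⇒ τ);
  pp1_eq : forall M, epa_model M -> forall (a : D M σ) (b : D M τ),
    ap (ev enil pp1) (ap (ap (ev enil pmk) a) b) = a;
  pp2_eq : forall M, epa_model M -> forall (a : D M σ) (b : D M τ),
    ap (ev enil pp2) (ap (ap (ev enil pmk) a) b) = b
}.

(** The pair is the function that takes the first component at 0 and the second one elsewhere, both
    coded in the common type. *)
Lemma pairing σ τ : pairs σ τ.
Proof.
  destruct (retr_join σ τ) as [J [[i1 p1 H1] [i2 p2 H2]]].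
  refine (Pairs σ τ (ι ⇒ J) (λ λ λ ifz · v0 · (tclose i1 · v2) · (tclose i2 · v1))
    (λ tclose p1 · (v0 · zero)) (λ tclose p2 · (v0 · (succ · zero))) _ _); intros M HM a b; evc.
  - rewrite ifz_0. auto.
  - rewrite ifz_S. auto.
Qed.
Arguments pty {σ τ} p.
Arguments pmk {σ τ} p.
Arguments pp1 {σ τ} p.
Arguments pp2 {σ τ} p.

(** * Models of P *)

Lemma sat_le {M} (S : spred M) {L c} (e : env M c) (t u : tm c ι) :
  sat S (@le L c t u) e = leM (ev e t) (ev e u).
Proof. unfold le, leM. cbn [sat]. evs. reflexivity. Qed.
Lemma sat_lt {M} (S : spred M) {L c} (e : env M c) (t u : tm c ι) :
  sat S (@lt L c t u) e = ltM (ev e t) (ev e u).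
Proof. unfold lt. rewrite sat_le. reflexivity. Qed.
Lemma sat_mem {M} (S : spred M) {L c} (e : env M c) σ (x : tm c σ) (w : tm c (σ^*)) :
  sat S (@mem L c σ x w) e = memM (ev e x) (ev e w).
Proof.
  unfold mem, memM. rewrite sat_ex. f_equal. extensionality j.
  rewrite sat_and, sat_lt. cbn [sat]. evs. reflexivity.
Qed.

(** External induction is kept apart, as [ext_ind]: in the generic model it is reduced to normal
    forms, and their existence rests on the fields listed here. *)
Record pmodel (M : structure) (S : spred M) : Prop := PModel {
  pm_epa : epa_model M;
  pm_app : forall σ τ (f : D M (σ ⇒ τ)) a, S _ f -> S _ a -> S _ (ap f a);
  pm_cst : forall σ (k : cst σ), S _ (kc k);
  pm_hac : forall c ρ τ (φ : fm Int (τ :: ρ :: c)) e,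
    (forall x, S ρ x -> exists y, S τ y /\ isat φ (econs y (econs x e))) ->
    exists F, S _ F /\ forall x, S ρ x -> exists y, memM y (ap F x) /\ isat φ (econs y (econs x e));
  pm_ideal : forall c σ τ (φ : fm Int (σ :: τ :: c)) e,
    (forall w, S (σ^*)%ty w -> exists y, forall z, memM z w -> isat φ (econs z (econs y e))) ->
    exists y, forall z, S σ z -> isat φ (econs z (econs y e))
}.

Definition ext_ind {M} (S : spred M) : Prop := forall c (A : fm Ext (ι%ty :: c)) e,
  sat S A (econs zM e) ->
  (forall n, S ι%ty n -> sat S A (econs n e) -> sat S A (econs (sM n) e)) ->
  forall n, S ι%ty n -> sat S A (econs n e).

Lemma sat_upup {M} (S : spred M) {L c σ τ ρ} (A : fm L (σ :: τ :: c)) (x : D M σ) (y : D M τ) (z : D M ρ) e :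
  sat S (fsubst (up (up shift)) A) (econs x (econs y (econs z e))) = sat S A (econs x (econs y e)).
Proof. rewrite sat_subst, !esub_up. reflexivity. Qed.

Lemma pst_pmodel M S : pst_model M S -> pmodel M S /\ ext_ind S.
Proof.
  intros H.
  assert (HE : epa_model M).
  { intros c A HA e. rewrite <- (sat_emb S). apply H, P_epa, HA. }
  split; [split|]; auto.
  - intros σ τ f a Hf Ha.
    pose proof (H _ _ (P_st_app [(σ ⇒ τ)%ty; σ] σ τ v0 v1) (econs f (econs a enil))) as K.
    cbn [sat] in K. rewrite sat_and in K. exact (K (conj Hf Ha)).
  - intros σ k. exact (H _ _ (P_st_closed [] σ (tCst k)) enil).
  - intros c ρ τ φ e HX. pose proof (H _ _ (P_HAC c ρ τ φ) e) as K. cbn [sat] in K.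
    rewrite sat_exst in K. destruct K as [F [HF K]].
    + cbn [sat fAllSt st]. intros x Hx. rewrite sat_exst. destruct (HX x Hx) as [y [Hy Hφ]].
      exists y. split; auto. rewrite (sat_emb S nost). exact Hφ.
    + exists F. split; auto. intros x Hx. cbn [sat fAllSt] in K. specialize (K x Hx).
      rewrite sat_ex in K. destruct K as [y K]. exists y.
      rewrite sat_and, sat_mem, sat_upup, (sat_emb S nost) in K. exact K.
  - intros c σ τ φ e HX. pose proof (H _ _ (P_ideal c σ τ φ) e) as K. cbn [sat] in K.
    rewrite sat_ex in K. destruct K as [y K].
    + cbn [sat fAllSt st]. intros w Hw. rewrite sat_ex. destruct (HX w Hw) as [y Hy].
      exists y. cbn [sat]. intros z. rewrite sat_mem, sat_upup, (sat_emb S nost). apply Hy.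
    + exists y. intros z Hz. rewrite <- (sat_emb S). exact (K z Hz).
  - intros c A e H0 HS n Hn. pose proof (H _ _ (P_ind_st c A) e) as K. cbn [sat fAllSt st] in K.
    rewrite sat_inst in K. apply K; auto. intros m Hm HA. rewrite sat_subst, esub_scons.
    apply HS; auto.
Qed.

Lemma pmodel_closed M S : pmodel M S -> forall τ (t : tm nil τ), S _ (@ev M nil enil τ t).
Proof.
  intros H τ t. induction t; cbn.
  - destruct (var_nil v).
  - apply (pm_cst _ _ H).
  - apply (pm_app _ _ H); auto.
Qed.

Lemma pmodel_pst M S : pmodel M S -> ext_ind S -> pst_model M S.
Proof.
  intros H Hind c A HA. pose proof (pm_epa _ _ H) as HE. destruct HA; intros e.
  - rewrite (sat_emb S nost). apply HE, H0.
  - cbn [sat]. rewrite sat_and. cbn. intros [H1 <-]. exact H1.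
  - cbn. rewrite ev_tclose. apply pmodel_closed, H.
  - cbn [sat]. rewrite sat_and. cbn. intros [H1 H2]. apply (pm_app _ _ H); auto.
  - cbn [sat fAllSt st]. rewrite sat_inst. intros H0 HS. apply Hind; auto.
    intros n Hn Hs. specialize (HS n Hn Hs). rewrite sat_subst, esub_scons in HS. exact HS.
  - cbn [sat fAllSt st]. rewrite sat_exst. intros HX.
    destruct (pm_hac _ _ H c ρ τ φ e) as [F [HF K]].
    + intros x Hx. specialize (HX x Hx). rewrite sat_exst in HX. destruct HX as [y [Hy HX]].
      exists y. rewrite (sat_emb S nost) in HX. auto.
    + exists F. split; auto. cbn [sat fAllSt st]. intros x Hx. rewrite sat_ex.
      destruct (K x Hx) as [y Hy]. exists y. rewrite sat_and, sat_mem, sat_upup, (sat_emb S nost).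
      exact Hy.
  - cbn [sat fAllSt st]. intros HX. rewrite sat_ex.
    destruct (pm_ideal _ _ H c σ τ φ e) as [y K].
    + intros w Hw. specialize (HX w Hw). rewrite sat_ex in HX. destruct HX as [y HX].
      exists y. rewrite sat_all in HX. intros z Hz. specialize (HX z).
      rewrite sat_imp, sat_mem, sat_upup, (sat_emb S nost) in HX. auto.
    + exists y. cbn [sat fAllSt st]. intros z Hz. rewrite (sat_emb S nost). auto.
Qed.

Section PModel.
Context {M : structure} {S : spred M} (H : pmodel M S).
Local Instance pmE : epa_model M := pm_epa _ _ H.

Lemma hac_dfn ρ τ (P : D M ρ -> D M τ -> Prop) :
  dfn [τ; ρ] (fun e => P (e _ (vs vz)) (e _ vz)) ->
  (forall x, S ρ x -> exists y, S τ y /\ P x y) ->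
  exists F, S _ F /\ forall x, S ρ x -> exists y, memM y (ap F x) /\ P x y.
Proof.
  intros [d [A [e' HA]]] HP.
  destruct (pm_hac _ _ H d ρ τ A e') as [F [HF K]].
  - intros x Hx. destruct (HP x Hx) as [y [Hy Pxy]]. exists y. split; auto.
    apply (HA (econs y (econs x enil))), Pxy.
  - exists F. split; auto. intros x Hx. destruct (K x Hx) as [y [Hy Pxy]]. exists y. split; auto.
    apply (HA (econs y (econs x enil))), Pxy.
Qed.

Lemma ideal_dfn σ τ (P : D M σ -> D M τ -> Prop) :
  dfn [σ; τ] (fun e => P (e _ vz) (e _ (vs vz))) ->
  (forall w, S (σ^*)%ty w -> exists y, forall z, memM z w -> P z y) ->
  exists y, forall z, S σ z -> P z y.
Proof.
  intros [d [A [e' HA]]] HP.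
  destruct (pm_ideal _ _ H d σ τ A e') as [y K].
  - intros w Hw. destruct (HP w Hw) as [y Hy]. exists y. intros z Hz.
    apply (HA (econs z (econs y enil))), Hy, Hz.
  - exists y. intros z Hz. apply (HA (econs z (econs y enil))), K, Hz.
Qed.

(** In a model of P this follows from external induction ([ext_ind_mem]). In the generic model it
    comes directly from the definition of [SM] and is available before external induction. *)
Definition mem_closed : Prop := forall σ (x : D M σ) w, S _ w -> memM x w -> S _ x.

(** HAC moves the premise of an implication into normal form, and idealisation does the same for an
    unrestricted quantifier. Both return finite lists of candidates, and [mem_closed] makes their
    entries standard. *)
Lemma normal_form (Hmem : mem_closed) {c} (A : fm Ext c) : exists X Y (φ : fm Int (Y :: X :: c)), forall e,
  sat S A e <-> forall x, S X x -> exists y, S Y y /\ isat φ (econs y (econs x e)).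
Proof.
  assert (HC := pmodel_closed M S H). assert (Hap := pm_app _ _ H).
  assert (Hd : forall σ, S σ (ev enil (dflt σ))) by (intros; apply HC).
  induction A as [c σ t u|c i σ t|c|c A [XA [YA [φA HA]]] B [XB [YB [φB HB]]]|c σ A [XA [YA [φA HA]]]].
  - exists ι%ty, ι%ty, (fEq (wk (wk t)) (wk (wk u))). intros e. cbn [sat]. split.
    + intros E x _. exists zM. split; [apply (Hd ι%ty)|]. rewrite !ev_wk. exact E.
    + intros K. destruct (K zM (Hd ι%ty)) as [y [_ E]]. rewrite !ev_wk in E. exact E.
  (* [st t] is read as: some standard y equals t. The outer variable is a dummy. *)
  - exists ι%ty, σ, (fEq v0 (wk (wk t))). intros e. cbn [sat]. split.
    + intros E x _. exists (ev e t). rewrite !ev_wk. split; [exact E|reflexivity].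
    + intros K. destruct (K zM (Hd ι%ty)) as [y [Hy E]]. rewrite !ev_wk in E. cbn in E. subst. exact Hy.
  - exists ι%ty, ι%ty, fBot. intros e. cbn [sat]. split; [tauto|].
    intros K. destruct (K zM (Hd ι%ty)) as [y [_ E]]. exact E.
  (* For all standard F and x there are standard u and v such that, if F(u) contains an answer to u
     for A, then v answers x for B. *)
  - pose (PX := pairing (XA ⇒ YA^*) XB). pose (PY := pairing XA YB).
    exists (pty PX), (pty PY).
    exists (fImp (∃[YA] (mem v0 (tclose (pp1 PX) · v2 · (tclose (pp1 PY) · v1)) ∧
              fsubst (scons v0 (scons (tclose (pp1 PY) · v1) (fun _ x => tVar (vs (vs (vs x)))))) φA))
            (fsubst (scons (tclose (pp2 PY) · v0) (scons (tclose (pp2 PX) · v1) (fun _ x => tVar (vs (vs x))))) φB)).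
    intros e. cbn [sat]. rewrite HA, HB.
    assert (E : forall x y, isat (fImp (∃[YA] (mem v0 (tclose (pp1 PX) · v2 · (tclose (pp1 PY) · v1)) ∧
              fsubst (scons v0 (scons (tclose (pp1 PY) · v1) (fun _ x => tVar (vs (vs (vs x)))))) φA))
            (fsubst (scons (tclose (pp2 PY) · v0) (scons (tclose (pp2 PX) · v1) (fun _ x => tVar (vs (vs x))))) φB))
             (econs y (econs x e)) <->
       ((exists z, memM z (ap (ap (ev enil (pp1 PX)) x) (ap (ev enil (pp1 PY)) y)) /\
           isat φA (econs z (econs (ap (ev enil (pp1 PY)) y) e))) ->
         isat φB (econs (ap (ev enil (pp2 PY)) y) (econs (ap (ev enil (pp2 PX)) x) e)))).
    { intros x y. cbn [sat]. rewrite sat_ex, sat_subst, !esub_scons. evc.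
      change (esub (fun _ x0 => tVar (vs (vs x0))) (econs y (econs x e))) with e.
      assert (E' : forall z, isat (mem v0 (tclose (pp1 PX) · v2 · (tclose (pp1 PY) · v1)) ∧
              fsubst (scons v0 (scons (tclose (pp1 PY) · v1) (fun _ x => tVar (vs (vs (vs x)))))) φA) (econs z (econs y (econs x e)))
          <-> (memM z (ap (ap (ev enil (pp1 PX)) x) (ap (ev enil (pp1 PY)) y)) /\
           isat φA (econs z (econs (ap (ev enil (pp1 PY)) y) e)))).
      { intros z. rewrite sat_and, sat_mem, sat_subst, !esub_scons. evc. reflexivity. }
      split; intros K [z Hz]; apply K; exists z; apply E', Hz. }
    split.
    + intros K x Hx.
      (* If F answers every standard u, then A holds and B supplies v. Otherwise a u without an
         answer falsifies the premise, and v is a default value. *)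
      destruct (classic (forall u, S XA u -> exists y, memM y (ap (ap (ev enil (pp1 PX)) x) u) /\ isat φA (econs y (econs u e)))) as [HF|HF].
      * destruct (K) with (x := ap (ev enil (pp2 PX)) x) as [v [Hv Hφ]].
        -- intros u Hu. destruct (HF u Hu) as [y [Hy Hφ]]. exists y. split; auto.
           eapply Hmem; [|exact Hy]. auto.
        -- auto.
        -- exists (ap (ap (ev enil (pmk PY)) (ev enil (dflt XA))) v). split; [auto|].
           apply E. rewrite (pp2_eq _ _ PY M pmE). auto.
      * apply not_all_ex_not in HF as [u HF]. apply imply_to_and in HF as [Hu HF].
        exists (ap (ap (ev enil (pmk PY)) u) (ev enil (dflt YB))). split; [auto|].
        apply E. rewrite (pp1_eq _ _ PY M pmE). intros Hz. destruct (HF Hz).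
    + intros K HA' x Hx.
      destruct (pm_hac _ _ H _ _ _ φA e HA') as [F [HF HF']].
      destruct (K (ap (ap (ev enil (pmk PX)) F) x)) as [y [Hy Hφ]]; [auto|].
      exists (ap (ev enil (pp2 PY)) y). split; [auto|].
      pose proof (proj1 (E _ _) Hφ) as Hφ'.
      rewrite (pp1_eq _ _ PX M pmE), (pp2_eq _ _ PX M pmE) in Hφ'. apply Hφ'.
      apply HF'. auto.
  (* For each standard x, one standard list must contain an answer for every z. If no list did,
     idealisation would give a single z without a standard answer. *)
  - exists XA, (YA^*)%ty.
    exists (∀[σ] ∃[YA] (mem v0 v2 ∧ fsubst (scons v0 (scons v3 (scons v1 (fun _ x => tVar (vs (vs (vs (vs x)))))))) φA)).
    intros e. cbn [sat].
    assert (E : forall x w z, isat (∃[YA] (mem v0 v2 ∧ fsubst (scons v0 (scons v3 (scons v1 (fun _ x => tVar (vs (vs (vs (vs x)))))))) φA))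
        (econs z (econs w (econs x e))) <->
        exists y, memM y w /\ isat φA (econs y (econs x (econs z e)))).
    { intros x w z. rewrite sat_ex. split; intros [y Hy]; exists y;
      rewrite sat_and, sat_mem, sat_subst, !esub_scons in *; exact Hy. }
    split.
    + intros K x Hx. apply NNPP. intros HN.
      destruct (pm_ideal _ _ H _ YA σ (fNot (fsubst (scons v0 (scons v2 (scons v1 (fun _ x => tVar (vs (vs (vs x))))))) φA)) (econs x e)) as [z Hz].
      * intros w Hw. apply NNPP. intros HN'. apply HN. exists w. split; auto.
        intros z. apply (E x w z), NNPP. intros HN''. apply HN'. exists z. intros y Hy. rewrite sat_not, sat_subst, !esub_scons.
        intros HH. apply HN''. exists y. split; [exact Hy|exact HH].
      * destruct (proj1 (HA (econs z e)) (K z) x Hx) as [y [Hy Hφ]]. specialize (Hz y Hy).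
        rewrite sat_not, sat_subst, !esub_scons in Hz. apply Hz, Hφ.
    + intros K z. apply HA. intros x Hx. destruct (K x Hx) as [w [Hw HK]]. apply (E x w z) in HK.
      destruct HK as [y [Hy Hφ]]. exists y. split; eauto.
Qed.

Lemma ext_ind_intro (Hmem : mem_closed) :
  (forall c ρ τ (φ : fm Int (τ :: ρ :: ι%ty :: c)) e,
     let P n := forall x, S ρ x -> exists y, S τ y /\ isat φ (econs y (econs x (econs n e))) in
     P zM -> (forall n, S _ n -> P n -> P (sM n)) -> forall n, S _ n -> P n) ->
  ext_ind S.
Proof.
  intros Hi c A e H0 HS n Hn. destruct (normal_form Hmem A) as [X [Y [φ Hφ]]].
  apply Hφ. specialize (Hi c X Y φ e). cbv zeta in Hi. revert n Hn. apply Hi.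
  - apply Hφ, H0.
  - intros n Hn K. apply Hφ, HS; auto. apply Hφ, K.
Qed.

End PModel.

(** * Generic models of P *)

(** Terms that denote standard objects: an even parameter stands for a standard object, an odd one
    for an arbitrary object. *)
Fixpoint pstd {τ} (t : ptm τ) : Prop :=
  match t with
  | pPar _ k => Nat.Even k
  | pCst _ => True
  | pApp f a => pstd f /\ pstd a
  end.

Definition SM {M} (ρ : assign M) : spred M := fun σ y => exists w : ptm (σ^*), pstd w /\ memM y (pe ρ w).

Definition pclose {τ} (t : tm nil τ) : ptm τ := @ev PT nil enil τ t.

Lemma pe_pclose {M τ} (ρ : assign M) (t : tm nil τ) : pe ρ (pclose t) = ev enil t.
Proof. unfold pclose. rewrite pe_ev. f_equal. apply env_nil. Qed.

Lemma pstd_pclose τ (t : tm nil τ) : pstd (pclose t).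
Proof. induction t; cbn; auto. destruct (var_nil v). Qed.

Lemma pstd_odd τ (t : ptm τ) k : pstd t -> Nat.Odd k -> pfresh k t.
Proof.
  intros H Hk. induction t; cbn in *; [|tauto|tauto].
  intros ->. exact (Nat.Even_Odd_False k H Hk).
Qed.

(** Bracket abstraction over a parameter. It turns a list found for a generic standard object into a
    function of that object. *)
Fixpoint plam (σ : ty) (k : nat) {τ} (t : ptm τ) : ptm (σ ⇒ τ) :=
  match t with
  | pPar τ j =>
      match ty_eq_dec σ τ with
      | left E => if Nat.eq_dec j k then eq_rect σ (fun τ => ptm (σ ⇒ τ)) (pclose tI) τ E
                  else pApp (pCst (cK τ σ)) (pPar τ j)
      | right _ => pApp (pCst (cK τ σ)) (pPar τ j)
      end
  | pCst c => pApp (pCst (cK _ σ)) (pCst c)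
  | pApp f a => pApp (pApp (pCst (cS _ _ _)) (plam σ k f)) (plam σ k a)
  end.

Lemma pstd_plam σ k τ (t : ptm τ) : pstd t -> pstd (plam σ k t).
Proof.
  induction t; cbn; intros H.
  - destruct (ty_eq_dec σ σ0) as [<-|]; [destruct Nat.eq_dec|]; cbn; auto.
  - auto.
  - tauto.
Qed.

Lemma pe_plam {M} {HM : epa_model M} (ρ : assign M) σ k τ (t : ptm τ) x :
  ap (pe ρ (plam σ k t)) x = pe (upd ρ σ k x) t.
Proof.
  induction t; cbn.
  - unfold upd. destruct (ty_eq_dec σ σ0) as [<-|]; [destruct Nat.eq_dec|]; cbn;
      rewrite ?S_eq, ?K_eq; reflexivity.
  - apply K_eq.
  - rewrite S_eq, IHt1, IHt2. reflexivity.
Qed.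

Lemma efresh_econs k c σ (t : ptm σ) (e : env PT c) :
  pfresh k t -> efresh k e -> efresh k (econs (t : D PT σ) e).
Proof.
  intros Ht He τ y. revert t e Ht He.
  refine (match y in var e τ return
    match e as e return var e τ -> Prop with
    | nil => fun _ => True
    | σ :: c => fun x => forall (w : ptm σ) (e : env PT c), pfresh k w -> efresh k e ->
       pfresh k (econs (w : D PT σ) e τ x : ptm τ) end y
    with vz => _ | vs z => _ end); auto.
  intros w e _ H. exact (H _ z).
Qed.

Section Standard.
Context {M : structure} {HM : epa_model M} (ρ : assign M).

Lemma SM_pstd τ (t : ptm τ) : pstd t -> SM ρ τ (pe ρ t).
Proof.
  intros H. exists (pApp (pApp (pCst (cCons τ)) t) (pCst (cNil τ))). split; [cbn; auto|].
  cbn. apply mem_cons. auto.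
Qed.

(** If [w] is an entry of the list named by [u], then the entries of [w] are entries of the
    concatenation of all lists in [u]. *)
Lemma SM_mem : @mem_closed M (SM ρ).
Proof.
  intros σ x w [u [Hu Hw]] Hx. exists (pApp (pclose (λ lbind · (λ v0) · v0)) u).
  split; [split; auto using pstd_pclose|]. cbn. rewrite pe_pclose. evs.
  apply (mem_bind _ _ _ w); auto. evs. exact Hx.
Qed.

(** The value is an entry of the list of all values of functions in one list at arguments in the
    other. *)
Lemma SM_app σ τ (f : D M (σ ⇒ τ)) a : SM ρ _ f -> SM ρ _ a -> SM ρ _ (ap f a).
Proof.
  intros [u [Hu Hf]] [v [Hv Ha]].
  exists (pApp (pApp (pclose (λ λ lbind · (λ lmap · v0 · v1) · v1)) u) v).
  split; [repeat split; auto using pstd_pclose|]. cbn. rewrite pe_pclose. evs.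
  apply (mem_bind _ _ _ f); auto. evs. apply mem_map, Ha.
Qed.

Lemma SM_closed τ (t : tm nil τ) : SM ρ _ (ev enil t).
Proof. rewrite <- (pe_pclose ρ). apply SM_pstd, pstd_pclose. Qed.

Lemma SM_cst τ (k : cst τ) : SM ρ _ (kc k).
Proof. exact (SM_closed τ (tCst k)). Qed.

(** Reinterpreting the even parameters by standard objects creates no new standard objects, so
    requirements survive it. *)
Lemma SM_sub (ρ' : assign M) : (forall τ k, Nat.Even k -> SM ρ τ (ρ' τ k)) ->
  forall σ y, SM ρ' σ y -> SM ρ σ y.
Proof.
  intros H σ y [w [Hw Hy]]. apply (SM_mem σ y (pe ρ' w)); auto.
  clear Hy. induction w; cbn in *; auto using SM_cst. apply SM_app; tauto.
Qed.

Lemma SM_upd σ k x : (Nat.Even k -> SM ρ σ x) -> forall τ y, SM (upd ρ σ k x) τ y -> SM ρ τ y.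
Proof.
  intros H. apply SM_sub. intros τ j Hj.
  destruct (ty_eq_dec τ σ) as [->|]; [destruct (Nat.eq_dec j k) as [->|]|].
  - rewrite upd_same. auto.
  - rewrite upd_other by auto. exact (SM_pstd _ (pPar σ j) Hj).
  - rewrite upd_other by auto. exact (SM_pstd _ (pPar τ j) Hj).
Qed.

End Standard.

(* A condition consists of finitely many internal facts and of finitely many requirements
   "θ y for all standard y". *)
Record req : Type := Req { rc : ctx; rty : ty; rA : fm Int (rty :: rc); re : env PT rc }.
Arguments Req {rc rty} rA re.

Definition rtrue {M} (ρ : assign M) (r : req) (y : D M (rty r)) : Prop :=
  isat (rA r) (econs y (penv ρ (re r))).

Record cond : Type := Cond { facts : list (closure Int); reqs : list req }.
Definition cext (p q : cond) : Prop := incl (facts p) (facts q) /\ incl (reqs p) (reqs q).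
Definition addf (x : closure Int) (p : cond) : cond := Cond (x :: facts p) (reqs p).
Definition addr (r : req) (p : cond) : cond := Cond (facts p) (r :: reqs p).

Record realizes {M} (ρ : assign M) (p : cond) : Prop := Realizes {
  rz_facts : forall x, In x (facts p) -> ctrue nost ρ x;
  rz_reqs : forall r, In r (reqs p) -> forall y, SM ρ _ y -> rtrue ρ r y
}.
Definition Cons (p : cond) : Prop := exists M (ρ : assign M), epa_model M /\ realizes ρ p.
Definition pfr (k : nat) (p : cond) : Prop :=
  (forall x, In x (facts p) -> efresh k (ce x)) /\ (forall r, In r (reqs p) -> efresh k (re r)).

Lemma pfr_ex p : exists N, forall k, N <= k -> pfr k p.
Proof.
  destruct p as [l rs]. destruct (cfresh_ex l) as [N HN].
  assert (H : exists N, forall k, N <= k -> forall r, In r rs -> efresh k (re r)).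
  { clear. induction rs as [|r rs [N HN]].
    - exists 0. intros ? ? ? [].
    - destruct (efresh_ex (re r)) as [N' HN']. exists (N + N').
      intros k Hk x [<- | Hx]; [apply HN'; lia | apply HN; auto; lia]. }
  destruct H as [N' HN']. exists (N + N'). intros k Hk. split; [apply HN; lia | apply HN'; lia].
Qed.

Lemma realizes_ext {M} (ρ : assign M) p q : cext p q -> realizes ρ q -> realizes ρ p.
Proof. intros [H1 H2] [K1 K2]. split; auto. Qed.

Lemma realizes_addf {M} (ρ : assign M) x p : realizes ρ (addf x p) <-> ctrue nost ρ x /\ realizes ρ p.
Proof.
  split.
  - intros [K1 K2]. split; [apply K1; left; auto|]. split; auto. intros y Hy. apply K1. right. auto.
  - intros [K0 [K1 K2]]. split; auto. intros y [<- | Hy]; auto.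
Qed.

Lemma realizes_addr {M} (ρ : assign M) r p :
  realizes ρ (addr r p) <-> (forall y, SM ρ _ y -> rtrue ρ r y) /\ realizes ρ p.
Proof.
  split.
  - intros [K1 K2]. split; [apply K2; left; auto|]. split; auto. intros y Hy. apply K2. right. auto.
  - intros [K0 [K1 K2]]. split; auto. intros y [<- | Hy]; auto.
Qed.

(** Facts and requirements do not mention [k]. Changing an even parameter could still enlarge the
    class of standard objects, hence the condition on [x]. *)
Lemma realizes_upd {M} {HM : epa_model M} (ρ : assign M) p σ k x :
  pfr k p -> (Nat.Even k -> SM ρ σ x) -> realizes ρ p -> realizes (upd ρ σ k x) p.
Proof.
  intros [F1 F2] Hx [K1 K2]. split.
  - intros y Hy. unfold ctrue. rewrite penv_fresh by auto. apply K1, Hy.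
  - intros r Hr y Hy. unfold rtrue. rewrite penv_fresh by auto. apply (K2 r Hr).
    eapply SM_upd; eauto.
Qed.

(** The internal instance of a requirement at one list. Over all standard lists [w], these instances
    together say the same as [r]. *)
Definition rcl (r : req) (w : ptm ((rty r)^*)) : closure Int :=
  Cl (∀[rty r] (mem v0 v1 ⊃ fsubst (up shift) (rA r))) (econs (w : D PT _) (re r)).

Lemma rcl_true {M} (ρ : assign M) r w :
  ctrue nost ρ (rcl r w) <-> forall y, memM y (pe ρ w) -> rtrue ρ r y.
Proof.
  unfold ctrue, rcl, rtrue. cbn [cc cA ce]. rewrite penv_econs, sat_all.
  assert (E : forall y, isat (mem v0 v1 ⊃ fsubst (up shift) (rA r)) (econs y (econs (pe ρ w) (penv ρ (re r))))
      = (memM y (pe ρ w) -> isat (rA r) (econs y (penv ρ (re r)))))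
    by (intros; rewrite sat_imp, sat_mem, sat_subst, esub_up; reflexivity).
  split; intros H y; [rewrite <- E | rewrite E]; apply H.
Qed.

Lemma compact1 (p : cond) (r : req) :
  (forall w, pstd w -> exists M (ρ : assign M), epa_model M /\ realizes ρ p /\
     forall y, memM y (pe ρ w) -> rtrue ρ r y) ->
  Cons (addr r p).
Proof.
  intros H.
  destruct (pfr_ex (addr r p)) as [b Hb].
  destruct (epa_compact (fun x => In x (facts p) \/
     exists r' w, In r' (reqs (addr r p)) /\ pstd w /\ x = rcl r' w) b) as [M [ρ [HM Hρ]]].
  - intros x k [Hx|[r' [w [Hr' [Hw ->]]]]] Hk Ho.
    + apply (proj1 (Hb k Hk)), Hx.
    + apply efresh_econs; [apply pstd_odd; auto | apply (proj2 (Hb k Hk)), Hr'].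
  - intros l Hl.
    (* Instances of the old requirements hold in every realization of p. Finitely many instances of
       the new one are covered by the concatenation of their lists. *)
    assert (K : exists w, pstd w /\ forall M (ρ : assign M), epa_model M -> realizes ρ p ->
       (forall y, memM y (pe ρ w) -> rtrue ρ r y) -> forall x, In x l -> ctrue nost ρ x).
    { induction l as [|x l IH].
      - exists (pCst (cNil _)). split; [exact I|]. intros M ρ _ _ _ ? [].
      - destruct IH as [w [Hw Hl']]; [intros; apply Hl; right; auto|].
        destruct (Hl x (or_introl eq_refl)) as [Hx|[r' [w' [[<- | Hr'] [Hw' ->]]]]].
        + exists w. split; auto. intros M ρ HM Hp Hy z [<- | Hz]; [apply Hp, Hx | eapply Hl'; eauto].
        + exists (pApp (pApp (pclose append) w') w). split; [cbn; auto using pstd_pclose|].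
          intros M ρ HM Hp Hy z Hz.
          assert (Hy' : forall y, memM y (pe ρ w') \/ memM y (pe ρ w) -> rtrue ρ r y).
          { intros y Hmy. apply Hy. cbn. rewrite pe_pclose. apply mem_app, Hmy. }
          destruct Hz as [<- | Hz]; [apply rcl_true; auto | eapply Hl'; eauto].
        + exists w. split; auto. intros M ρ HM Hp Hy z [<- | Hz]; [|eapply Hl'; eauto].
          apply rcl_true. intros y Hmy. apply (rz_reqs _ _ Hp r' Hr'). exists w'. auto. }
    destruct K as [w [Hw K]]. destruct (H w Hw) as [M [ρ [HM [Hp Hy]]]].
    exists M, ρ. split; auto.
  - exists M, ρ. split; auto. split.
    + intros x Hx. apply Hρ. left. exact Hx.
    + intros r' Hr' y [w [Hw Hy]].
      assert (T : ctrue nost ρ (rcl r' w)) by (apply Hρ; right; eauto).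
      rewrite rcl_true in T. apply T, Hy.
Qed.

(** The source of all extracted terms: an inadmissible requirement is violated within one standard
    list, the same in all realizations of [p]. *)
Lemma not_cons_addr p r : ~ Cons (addr r p) ->
  exists w, pstd w /\ forall M (ρ : assign M), epa_model M -> realizes ρ p ->
    exists y, memM y (pe ρ w) /\ ~ rtrue ρ r y.
Proof.
  intros H. apply NNPP. intros K. apply H, compact1. intros w Hw. apply NNPP. intros K'.
  apply K. exists w. split; auto. intros M ρ HM Hp. apply NNPP. intros K''.
  apply K'. exists M, ρ. repeat split; try apply Hp; auto.
  intros y Hy. apply NNPP. intros Hr. apply K''. eauto.
Qed.

Lemma even_fresh (N : nat) : exists k, N <= k /\ Nat.Even k.
Proof. exists (2 * N). split; [lia | exists N; reflexivity]. Qed.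

Lemma odd_fresh (N : nat) : exists k, N <= k /\ Nat.Odd k.
Proof. exists (2 * N + 1). split; [lia | exists N; reflexivity]. Qed.

(** * The tasks of the generic construction and their density *)

Definition task_dec {c} (A : fm Int c) (e : env PT c) (q : cond) : Prop :=
  In (Cl A e) (facts q) \/ In (Cl (fNot A) e) (facts q) /\
    match A with
    | fAll σ B => fun e => exists t : D PT σ, In (Cl (fNot B) (econs t e)) (facts q)
    | _ => fun _ => True
    end e.

(** Either a standard x without a standard answer defeats the premise of HAC, or a term names a
    choice function for all realizations of the condition. *)
Definition task_hac {c ρ τ} (φ : fm Int (τ :: ρ :: c)) (e : env PT c) (q : cond) : Prop :=
  (exists k, Nat.Even k /\ In (Req (fNot φ) (econs (pPar ρ k : D PT ρ) e)) (reqs q)) \/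
  (exists F : ptm (ρ ⇒ τ^*), pstd F /\ forall M (r : assign M), epa_model M -> realizes r q ->
     forall x, SM r _ x -> exists y, memM y (ap (pe r F) x) /\ isat φ (econs y (econs x (penv r e)))).

(** Either a parameter names an ideal y, or one standard list defeats every y and with it the
    premise of idealisation. *)
Definition task_ideal {c σ τ} (φ : fm Int (σ :: τ :: c)) (e : env PT c) (q : cond) : Prop :=
  (exists k, In (Req φ (econs (pPar τ k : D PT τ) e)) (reqs q)) \/
  (exists w : ptm (σ^*), pstd w /\ forall M (r : assign M), epa_model M -> realizes r q ->
     forall y, exists z, memM z (pe r w) /\ ~ isat φ (econs z (econs y (penv r e)))).

Definition hacf {c ρ τ} (φ : fm Int (τ :: ρ :: c)) : fm Int (ρ :: (ρ ⇒ τ^*)%ty :: c) :=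
  ∃[τ] (mem v0 (v2 · v1) ∧ fsubst (up (up shift)) φ).

Lemma sat_hacf {M} {c ρ τ} (φ : fm Int (τ :: ρ :: c)) (x : D M ρ) F e :
  isat (hacf φ) (econs x (econs F e)) <-> exists y, memM y (ap F x) /\ isat φ (econs y (econs x e)).
Proof.
  unfold hacf. rewrite sat_ex. split; intros [y Hy]; exists y; rewrite sat_and, sat_mem, sat_upup in *; exact Hy.
Qed.

(** Three outcomes: a challenge at 0 without an answer; a stage [k0] whose challenges are all
    answered by a function [k1] while a challenge [k2] at the next stage has no answer; or one term
    that answers all challenges at all standard stages. The first two defeat the premises of
    induction. *)
Definition task_ind {c ρ τ} (φ : fm Int (τ :: ρ :: ι%ty :: c)) (e : env PT c) (q : cond) : Prop :=
  (exists k, Nat.Even k /\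
     In (Req (fNot φ) (econs (pPar ρ k : D PT ρ) (econs (zM : D PT ι) e))) (reqs q)) \/
  (exists k0 k1 k2, Nat.Even k0 /\ Nat.Even k1 /\ Nat.Even k2 /\
     In (Req (hacf φ) (econs (pPar _ k1 : D PT (ρ ⇒ τ^*)) (econs (pPar ι k0 : D PT ι) e))) (reqs q) /\
     In (Req (fNot φ) (econs (pPar ρ k2 : D PT ρ) (econs (sM (pPar ι k0 : D PT ι)) e))) (reqs q)) \/
  (exists G : ptm (ι ⇒ ρ ⇒ τ^*), pstd G /\ forall M (r : assign M), epa_model M -> realizes r q ->
     forall n x, SM r _ n -> SM r _ x ->
     exists y, memM y (ap (ap (pe r G) n) x) /\ isat φ (econs y (econs x (econs n (penv r e))))).

Lemma cext_refl p : cext p p.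
Proof. split; apply incl_refl. Qed.
Lemma cext_trans p q r : cext p q -> cext q r -> cext p r.
Proof. intros [] []. split; eapply incl_tran; eauto. Qed.
Lemma cext_addf x p : cext p (addf x p).
Proof. split; [apply incl_tl|]; apply incl_refl. Qed.
Lemma cext_addr x p : cext p (addr x p).
Proof. split; [|apply incl_tl]; apply incl_refl. Qed.
#[local] Hint Resolve cext_refl cext_addf cext_addr : core.

Lemma task_dec_ext c (A : fm Int c) e p q : cext p q -> task_dec A e p -> task_dec A e q.
Proof.
  intros [H _] [K|[K1 K2]]; [left; auto|right]. split; [auto|]. destruct A; auto.
  destruct K2 as [t Ht]. exists t. auto.
Qed.
Lemma task_hac_ext c ρ τ (φ : fm Int (τ :: ρ :: c)) e p q : cext p q -> task_hac φ e p -> task_hac φ e q.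
Proof.
  intros H [[k [Hk K]]|[F [HF K]]]; [left|right].
  - exists k. split; auto. apply H, K.
  - exists F. split; auto. intros M r HM Hr. apply K; auto. eapply realizes_ext; eauto.
Qed.
Lemma task_ideal_ext c σ τ (φ : fm Int (σ :: τ :: c)) e p q : cext p q -> task_ideal φ e p -> task_ideal φ e q.
Proof.
  intros H [[k K]|[F [HF K]]]; [left|right].
  - exists k. apply H, K.
  - exists F. split; auto. intros M r HM Hr. apply K; auto. eapply realizes_ext; eauto.
Qed.

Lemma dense_dec c (A : fm Int c) e p : Cons p -> exists q, cext p q /\ Cons q /\ task_dec A e q.
Proof.
  intros [M [r [HM Hr]]]. destruct (classic (isat A (penv r e))) as [HA|HA].
  - exists (addf (Cl A e) p). split; [auto|split].
    + exists M, r. split; auto. apply realizes_addf. auto.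
    + left. left. reflexivity.
  - assert (Hr' : realizes r (addf (Cl (fNot A) e) p)) by (apply realizes_addf; auto).
    destruct A as [| | | |σ B].
    1-4: match type of Hr' with realizes _ ?q => exists q end; split; [auto|];
      split; [exists M, r; auto | right; split; [left; reflexivity | exact I]].
    rewrite sat_all in HA. apply not_all_ex_not in HA as [a Ha].
    (* The counterexample need not be standard, so its name is odd. *)
    destruct (pfr_ex (addf (Cl (fNot (fAll σ B)) e) p)) as [N HN]. destruct (odd_fresh N) as [k [Hk Ho]].
    exists (addf (Cl (fNot B) (econs (pPar σ k : D PT σ) e)) (addf (Cl (fNot (fAll σ B)) e) p)). split; [|split].
    + eapply cext_trans; [|apply cext_addf]. auto.
    + exists M, (upd r σ k a). split; auto. apply realizes_addf. split.
      * unfold ctrue. cbn [cc cA ce]. rewrite penv_econs. cbn [pe]. rewrite upd_same, penv_fresh; [exact Ha|].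
        apply (proj1 (HN k Hk) (Cl (fNot (fAll σ B)) e)). left. reflexivity.
      * apply realizes_upd; auto. intros He. destruct (Nat.Even_Odd_False _ He Ho).
    + right. split; [right; left; reflexivity|]. eexists. left. reflexivity.
Qed.

Lemma dense_hac c ρ τ (φ : fm Int (τ :: ρ :: c)) e p :
  Cons p -> exists q, cext p q /\ Cons q /\ task_hac φ e q.
Proof.
  intros Hp. destruct (pfr_ex p) as [N HN]. destruct (efresh_ex e) as [N' HN'].
  destruct (even_fresh (N + N')) as [k [Hk He]].
  set (r0 := Req (fNot φ) (econs (pPar ρ k : D PT ρ) e)).
  destruct (classic (Cons (addr r0 p))) as [HC|HC].
  - exists (addr r0 p). split; [auto|split; auto].
    left. exists k. split; auto. left. reflexivity.
  - exists p. split; auto. split; auto. right.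
    apply not_cons_addr in HC as [w [Hw K]]. exists (plam ρ k w). split; [apply pstd_plam, Hw|].
    intros M r HM Hr x Hx.
    destruct (K M (upd r ρ k x) HM) as [y [Hy Hy']].
    { apply realizes_upd; auto. apply HN. lia. }
    exists y. rewrite pe_plam. split; auto. apply NNPP. intros HN1. apply Hy'.
    unfold rtrue, r0. cbn [rc rty rA re]. rewrite penv_econs. cbn [pe].
    rewrite upd_same, penv_fresh by (apply HN'; lia). exact HN1.
Qed.

Lemma dense_ideal c σ τ (φ : fm Int (σ :: τ :: c)) e p :
  Cons p -> exists q, cext p q /\ Cons q /\ task_ideal φ e q.
Proof.
  intros Hp. destruct (pfr_ex p) as [N HN]. destruct (efresh_ex e) as [N' HN'].
  destruct (odd_fresh (N + N')) as [k [Hk Ho]].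
  set (r0 := Req φ (econs (pPar τ k : D PT τ) e)).
  destruct (classic (Cons (addr r0 p))) as [HC|HC].
  - exists (addr r0 p). split; [auto|split; auto].
    left. exists k. left. reflexivity.
  - exists p. split; auto. split; auto. right.
    apply not_cons_addr in HC as [w [Hw K]]. exists w. split; [exact Hw|].
    intros M r HM Hr y.
    destruct (K M (upd r τ k y) HM) as [z [Hz Hz']].
    { apply realizes_upd; auto; [apply HN; lia|]. intros He. destruct (Nat.Even_Odd_False _ He Ho). }
    (* The list is named without the odd parameter that stands for y, so a single list works for all
       y. *)
    rewrite pe_fresh in Hz by (apply pstd_odd; auto).
    exists z. split; auto. intros HN1. apply Hz'.
    unfold rtrue, r0. cbn [rc rty rA re]. rewrite penv_econs. cbn [pe].
    rewrite upd_same, penv_fresh by (apply HN'; lia). exact HN1.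
Qed.

Lemma realizes_sub {M} {HM : epa_model M} (r r' : assign M) p :
  (forall x, In x (facts p) -> penv r' (ce x) = penv r (ce x)) ->
  (forall x, In x (reqs p) -> penv r' (re x) = penv r (re x)) ->
  (forall τ k, Nat.Even k -> SM r τ (r' τ k)) -> realizes r p -> realizes r' p.
Proof.
  intros F1 F2 HS [K1 K2]. split.
  - intros y Hy. unfold ctrue. rewrite F1 by auto. apply K1, Hy.
  - intros x Hr y Hy. unfold rtrue. rewrite F2 by auto. apply (K2 x Hr).
    eapply SM_sub; eauto.
Qed.

Lemma SM_upd_all {M} (r g : assign M) σ k x :
  (forall τ j, Nat.Even j -> SM r τ (g τ j)) -> SM r σ x ->
  forall τ j, Nat.Even j -> SM r τ (upd g σ k x τ j).
Proof.
  intros H Hx τ j Hj.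
  destruct (ty_eq_dec τ σ) as [->|]; [destruct (Nat.eq_dec j k) as [->|]|].
  - rewrite upd_same. auto.
  - rewrite upd_other by auto. auto.
  - rewrite upd_other by auto. auto.
Qed.

Lemma mon_mon {M} {HM : epa_model M} (x y : D M ι) : leM x y -> ap (ap monM y) (ap (ap monM y) x) = x.
Proof.
  intros H. pose proof (mon_add (ap (ap monM y) x) x) as K.
  rewrite add_comm, add_mon in K by exact H. exact K.
Qed.

(* [gterm F t n] iterates the step [t] from [F]; [lterm t g n x j] lists the challenges at stage n - j
   on which the challenge [x] at stage n depends. *)
Definition gterm {ρ τ} : tm nil ((ρ ⇒ τ^*) ⇒ (ι ⇒ (ρ ⇒ τ^*) ⇒ ρ ⇒ τ^*) ⇒ ι ⇒ ρ ⇒ τ^*) :=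
  λ λ λ Rec · v0 · v2 · (λ λ λ v4 · v1 · v2 · v0).
Definition lterm {ρ τ} : tm nil ((ι ⇒ (ρ ⇒ τ^*) ⇒ ρ ⇒ ρ^*) ⇒ (ι ⇒ ρ ⇒ τ^*) ⇒ ι ⇒ ρ ⇒ ι ⇒ ρ^*) :=
  λ λ λ λ λ Rec · v0 · (cons' · v1 · nil') ·
    (λ λ lbind · (v6 · (pred · (monus · v4 · v0)) · (v5 · (pred · (monus · v4 · v0)))) · v1).

Section Iteration.
Context {M : structure} {HM : epa_model M} {ρ τ : ty}.

Lemma gterm_0 F (t : D M (ι ⇒ (ρ ⇒ τ^*) ⇒ ρ ⇒ τ^*)) : ap (ap (ap (ev enil gterm) F) t) zM = F.
Proof. unfold gterm. evs. apply Rec_0. Qed.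
Lemma gterm_S F (t : D M (ι ⇒ (ρ ⇒ τ^*) ⇒ ρ ⇒ τ^*)) n u :
  ap (ap (ap (ap (ev enil gterm) F) t) (sM n)) u = ap (ap (ap t n) (ap (ap (ap (ev enil gterm) F) t) n)) u.
Proof. unfold gterm. evs. rewrite Rec_S. evs. reflexivity. Qed.
Lemma lterm_0 (t : D M (ι ⇒ (ρ ⇒ τ^*) ⇒ ρ ⇒ ρ^*)) g n x :
  ap (ap (ap (ap (ap (ev enil lterm) t) g) n) x) zM = consM x nilM.
Proof. unfold lterm. evs. apply Rec_0. Qed.
Lemma lterm_S (t : D M (ι ⇒ (ρ ⇒ τ^*) ⇒ ρ ⇒ ρ^*)) g n x j :
  ap (ap (ap (ap (ap (ev enil lterm) t) g) n) x) (sM j) =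
  ap (ap lbindM (ap (ap t (ap predM (ap (ap monM n) j))) (ap g (ap predM (ap (ap monM n) j)))))
    (ap (ap (ap (ap (ap (ev enil lterm) t) g) n) x) j).
Proof. unfold lterm. evs. rewrite Rec_S. evs. reflexivity. Qed.
End Iteration.

Ltac smapp := match goal with |- SM _ _ (ap _ _) => apply SM_app end.

(** If neither counterexample can be added, compactness gives lists of answers at 0 and, from an
    answering function at stage m, lists of answers at stage m + 1. Iterating this with the recursor
    answers all stages. Only finitely many challenges at each earlier stage matter for a given one,
    so correctness is an internal statement and internal induction proves it. *)
Lemma dense_ind c ρ τ (φ : fm Int (τ :: ρ :: ι%ty :: c)) e p :
  Cons p -> exists q, cext p q /\ Cons q /\ task_ind φ e q.
Proof.
  intros Hp. destruct (pfr_ex p) as [N HN]. destruct (efresh_ex e) as [N' HN'].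
  destruct (even_fresh (N + N')) as [k [Hk He]].
  assert (Hfr : forall j, k <= j -> pfr j p) by (intros; apply HN; lia).
  assert (Hfe : forall j, k <= j -> efresh j e) by (intros; apply HN'; lia).
  set (r1 := Req (fNot φ) (econs (pPar ρ k : D PT ρ) (econs (zM : D PT ι) e))).
  destruct (classic (Cons (addr r1 p))) as [HC|HC].
  { exists (addr r1 p). split; [apply cext_addr|split; auto].
    left. exists k. split; auto. left. reflexivity. }
  apply not_cons_addr in HC as [w0 [Hw0 K0]].
  pose (k1 := k + 2). pose (k2 := k + 4).
  assert (He1 : Nat.Even k1) by (destruct He as [m Hm]; exists (m + 1); unfold k1; lia).
  assert (He2 : Nat.Even k2) by (destruct He as [m Hm]; exists (m + 2); unfold k2; lia).
  set (q1 := Req (hacf φ) (econs (pPar _ k1 : D PT (ρ ⇒ τ^*)) (econs (pPar ι k : D PT ι) e))).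
  set (q2 := Req (fNot φ) (econs (pPar ρ k2 : D PT ρ) (econs (sM (pPar ι k : D PT ι)) e))).
  destruct (classic (Cons (addr q1 (addr q2 p)))) as [HC|HC].
  { exists (addr q1 (addr q2 p)). split; [eapply cext_trans; apply cext_addr|split; auto].
    right. left. exists k, k1, k2. repeat split; auto; cbn; auto. }
  apply not_cons_addr in HC as [w1 [Hw1 K1]].
  (* The hypothesis that the function answers all standard challenges is cut down to the list [w1].
     It becomes an internal fact, under which [w2] must contain an answer. *)
  assert (HC : ~ Cons (addr q2 (addf (rcl q1 w1) p))).
  { intros [M [r [HM Hr]]]. rewrite realizes_addr, realizes_addf, rcl_true in Hr.
    destruct Hr as [R1 [R2 R3]]. destruct (K1 M r HM) as [y [Hy Hy']].
    - apply realizes_addr. auto.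
    - auto. }
  apply not_cons_addr in HC as [w2 [Hw2 K2]].
  exists p. split; [apply cext_refl|split; auto]. right. right.
  cbn [rty r1 q1 q2] in w0, w1, w2.
  pose (F0 := plam ρ k w0).
  pose (t1 := plam ι k (plam (ρ ⇒ τ^*) k1 (plam ρ k2 w1))).
  pose (t2 := plam ι k (plam (ρ ⇒ τ^*) k1 (plam ρ k2 w2))).
  assert (P0 : pstd F0) by (apply pstd_plam, Hw0).
  assert (P1 : pstd t1) by (do 3 apply pstd_plam; exact Hw1).
  assert (P2 : pstd t2) by (do 3 apply pstd_plam; exact Hw2).
  exists (pApp (pApp (pclose gterm) F0) t2).
  split; [repeat split; auto using pstd_pclose|].
  intros M r HM Hr n0 x0 Hn0 Hx0. cbn [pe]. rewrite pe_pclose. cbn [ap PT].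
  assert (B0 : forall x, SM r _ x -> exists y, memM y (ap (pe r F0) x) /\
      isat φ (econs y (econs x (econs zM (penv r e))))).
  { intros x Hx. destruct (K0 M (upd r ρ k x) HM) as [y [Hy Hy']].
    { apply realizes_upd; auto. }
    exists y. unfold F0. rewrite pe_plam. split; auto. apply NNPP. intros HN1. apply Hy'.
    unfold rtrue, r1. cbn [rc rty rA re]. rewrite !penv_econs. cbn [pe].
    rewrite upd_same, penv_fresh by auto. exact HN1. }
  (* The successor step: to answer u at stage m + 1, Y need only answer the challenges in [t1 m Y u]
     at stage m. *)
  assert (BS : forall m Y u, SM r _ m -> SM r _ Y -> SM r _ u ->
      (forall x, memM x (ap (ap (ap (pe r t1) m) Y) u) ->
         exists y, memM y (ap Y x) /\ isat φ (econs y (econs x (econs m (penv r e))))) ->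
      exists v, memM v (ap (ap (ap (pe r t2) m) Y) u) /\
         isat φ (econs v (econs u (econs (sM m) (penv r e))))).
  { intros m Y u Hm HY Hu HX. unfold t1 in HX. rewrite !pe_plam in HX.
    unfold t2. rewrite !pe_plam.
    set (r' := upd (upd (upd r ι%ty k m) (ρ ⇒ τ^*)%ty k1 Y) ρ k2 u) in *.
    assert (E0 : r' ι%ty k = m).
    { unfold r'. rewrite upd_other by (right; unfold k2; lia).
      rewrite upd_other by (right; unfold k1; lia). apply upd_same. }
    assert (E1 : r' _ k1 = Y).
    { unfold r'. rewrite upd_other by (right; unfold k1, k2; lia). apply upd_same. }
    assert (E2 : r' ρ k2 = u) by apply upd_same.
    assert (Ee : forall c (e : env PT c), efresh k e -> efresh k1 e -> efresh k2 e -> penv r' e = penv r e).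
    { intros c' e' F0' F1 F2. unfold r'. rewrite !penv_fresh; auto. }
    assert (Hee : penv r' e = penv r e) by (apply Ee; apply Hfe; unfold k1, k2; lia).
    destruct (K2 M r' HM) as [v [Hv Hv']].
    - apply realizes_addf. split.
      + apply rcl_true. intros x Hx. unfold rtrue, q1. cbn [rc rty rA re].
        rewrite !penv_econs. apply sat_hacf. cbn [pe]. rewrite E0, E1, Hee. apply HX, Hx.
      + assert (Hf0 := Hfr k ltac:(lia)). assert (Hf1 := Hfr k1 ltac:(unfold k1; lia)).
        assert (Hf2 := Hfr k2 ltac:(unfold k2; lia)).
        apply (realizes_sub r); auto.
        * intros x Hx. apply Ee; [apply Hf0 | apply Hf1 | apply Hf2]; exact Hx.
        * intros x Hx. apply Ee; [apply Hf0 | apply Hf1 | apply Hf2]; exact Hx.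
        * do 3 (apply SM_upd_all; [|assumption]). intros τ' j Hj. exact (SM_pstd r _ (pPar τ' j) Hj).
    - exists v. split; auto. apply NNPP. intros HN1. apply Hv'.
      unfold rtrue, q2. cbn [rc rty rA re]. rewrite !penv_econs. cbn [pe ap kc PT]. rewrite E0, E2, Hee. exact HN1. }
  assert (S0 : SM r _ (pe r F0)) by (apply SM_pstd, P0).
  assert (S1 : SM r _ (pe r t1)) by (apply SM_pstd, P1).
  assert (S2 : SM r _ (pe r t2)) by (apply SM_pstd, P2).
  set (g := ap (ap (ev enil gterm) (pe r F0)) (pe r t2)).
  assert (Sg : SM r _ g) by (unfold g; repeat smapp; auto using SM_closed).
  set (l := ap (ap (ap (ap (ev enil lterm) (pe r t1)) g) n0) x0).
  assert (Sl : SM r _ l) by (unfold l; repeat smapp; auto using SM_closed).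
  (* Internal induction on the stage, restricted to the challenges on which [x0] at [n0] depends.
     Stages up to [n0] and entries of [l] at standard arguments are standard, so [B0] and [BS]
     apply. *)
  assert (Claim : forall i, leM i n0 -> forall u, memM u (ap l (ap (ap monM n0) i)) ->
     exists y, memM y (ap (ap g i) u) /\ isat φ (econs y (econs u (econs i (penv r e))))).
  { intros i. ind i.
    - apply dfn_sat. repeat (apply rep_econs; [apply rep_var|]). intros; apply rep_const.
    - intros _ u Hu. rewrite mon_0 in Hu. unfold g. rewrite gterm_0. apply B0.
      apply (SM_mem r) with (ap l n0); auto. apply SM_app; auto.
    - intros i IH Hi u Hu. destruct (lt_mon _ _ Hi) as [z [E1 E2]]. rewrite E2 in Hu.
      assert (Si : SM r _ i).
      { apply (SM_mem r) with (ap uptoM n0); [|apply mem_upto, Hi].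
        apply SM_app; auto. apply (SM_closed r _ upto). }
      assert (Sz : SM r _ z).
      { rewrite <- E2. repeat smapp; auto using SM_cst. apply (SM_closed r _ monus). }
      unfold g. rewrite gterm_S. fold g. apply BS; auto.
      + apply SM_app; auto.
      + apply (SM_mem r) with (ap l z); auto. apply SM_app; auto.
      (* Here z = n0 - (i + 1), so the stage pred (n0 - z) that [lterm] consults is i. *)
      + intros x Hx. apply IH; [apply lt_le, Hi|]. rewrite E1. unfold l. rewrite lterm_S.
        fold l. rewrite <- E2, mon_mon, pred_S, E2 by exact Hi. eapply mem_bind; eauto. }
  apply Claim; [apply le_refl|]. rewrite (le_refl n0 : _ = _). unfold l. rewrite lterm_0.
  apply mem_cons. auto.
Qed.

Lemma sat_con_rules : con_rules (fun l : list (closure Int) =>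
  exists M (r : assign M), epa_model M /\ forall x, In x l -> ctrue nost r x).
Proof.
  split; intros; intros [M [r [HM Hr]]];
  match type of Hr with forall x, In x (?a :: ?l) -> _ =>
    pose proof (Hr a (or_introl eq_refl)) as T1; try pose proof (Hr _ (or_intror (or_introl eq_refl))) as T2;
    try pose proof (Hr _ (or_intror (or_intror (or_introl eq_refl)))) as T3
  end; clear Hr; unfold ctrue in *; cbn [cc cA ce sat fNot] in *; try tauto; try congruence.
  - apply T2. rewrite penv_econs. apply T1.
  - apply T2. rewrite <- !pe_ev in *. congruence.
  - apply T3. cbn. congruence.
Qed.

(** One closure indexes all tasks for its formula. For HAC, idealisation and induction the leading
    variables are those of the scheme, so their values in the environment are dropped by [etl]. *)
Definition task (x : closure Int) (q : cond) : Prop :=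
  task_dec (cA x) (ce x) q /\
  (match cc x as c return fm Int c -> env PT c -> Prop with
   | τ :: ρ :: c => fun φ e => task_hac φ (etl (etl e)) q /\ task_ideal φ (etl (etl e)) q
   | _ => fun _ _ => True
   end (cA x) (ce x)) /\
  (match cc x as c return fm Int c -> env PT c -> Prop with
   | τ :: ρ :: tyN :: c => fun φ e => task_ind φ (etl (etl (etl e))) q
   | _ => fun _ _ => True
   end (cA x) (ce x)).

Lemma dense_task x p : Cons p -> exists q, cext p q /\ Cons q /\ task x q.
Proof.
  intros Hp. destruct x as [c A e]. unfold task. cbn [cc cA ce].
  destruct (dense_dec c A e p Hp) as [q1 [H1 [C1 T1]]].
  destruct c as [|τ [|ρ c]]; [exists q1; auto | exists q1; auto |].
  destruct (dense_hac _ _ _ A (etl (etl e)) q1 C1) as [q2 [H2 [C2 T2]]].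
  destruct (dense_ideal _ _ _ A (etl (etl e)) q2 C2) as [q3 [H3 [C3 T3]]].
  assert (H13 : cext q1 q3) by eauto using cext_trans.
  assert (Hfin : exists q, cext q3 q /\ Cons q /\
    match c as c return fm Int (τ :: ρ :: c) -> env PT (τ :: ρ :: c) -> Prop with
    | tyN :: c => fun φ e => task_ind φ (etl (etl (etl e))) q
    | _ => fun _ _ => True end A e).
  { destruct c as [|[| |] c]; try (exists q3; split; [apply cext_refl|auto]; fail).
    apply dense_ind, C3. }
  destruct Hfin as [q4 [H4 [C4 T4]]]. exists q4. repeat split; auto.
  - eapply incl_tran; [apply H1|]. eapply incl_tran; [apply H13|apply H4].
  - eapply incl_tran; [apply H1|]. eapply incl_tran; [apply H13|apply H4].
  - eapply task_dec_ext; [|exact T1]. eauto using cext_trans.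
  - eapply task_hac_ext; [|exact T2]. eauto using cext_trans.
  - eapply task_ideal_ext; [|exact T3]. auto.
Qed.

Theorem generic_model (p0 : cond) : Cons p0 ->
  exists M (r : assign M), epa_model M /\ realizes r p0 /\ pmodel M (SM r) /\
    @mem_closed M (SM r) /\ ext_ind (SM r).
Proof.
  intros Hp0.
  destruct (@generic {p | Cons p} Int (fun p q => cext (proj1_sig p) (proj1_sig q))
    (fun x q => task x (proj1_sig q)) (exist _ p0 Hp0)) as [f [Hf0 [Hf Ht]]].
  { intros p; apply cext_refl. }
  { intros x [p Hp]. destruct (dense_task x p Hp) as [q [H1 [H2 H3]]]. exists (exist _ q H2). auto. }
  pose (F n := proj1_sig (f n)).
  assert (HF : forall n, Cons (F n)) by (intros n; exact (proj2_sig (f n))).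
  assert (Hmono : forall n m, n <= m -> cext (F n) (F m)).
  { induction 1; [apply cext_refl | eapply cext_trans; [eassumption|apply Hf]]. }
  pose (Th := fun x => exists n, In x (facts (F n))).
  assert (Hall : forall l, (forall x, In x l -> Th x) -> exists n, incl l (facts (F n))).
  { induction l as [|x l IH]; intros H.
    - exists 0. intros ? [].
    - destruct IH as [n Hn]; [intros; apply H; right; auto|]. destruct (H x (or_introl eq_refl)) as [n' Hn'].
      exists (n + n'). intros y [<- | Hy].
      + apply (Hmono n'); [lia|auto].
      + apply (Hmono n); [lia|auto]. }
  pose (Con := fun l : list (closure Int) =>
    exists M (r : assign M), epa_model M /\ forall x, In x l -> ctrue nost r x).
  assert (Th_con : forall l, (forall x, In x l -> Th x) -> Con l).
  { intros l H. destruct (Hall l H) as [n Hn]. destruct (HF n) as [M [r [HM Hr]]].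
    exists M, r. split; auto. intros x Hx. apply Hr, Hn, Hx. }
  assert (Th_dec : forall c (A : fm Int c) e, Th (Cl A e) \/ Th (Cl (fNot A) e)).
  { intros c A e. destruct (Ht (Cl A e)) as [n [[H|[H _]] _]]; [left|right]; exists n; auto. }
  assert (Th_wit : forall c σ (A : fm Int (σ :: c)) e, Th (Cl (fNot (fAll σ A)) e) ->
    exists t : D PT σ, Th (Cl (fNot A) (econs t e))).
  { intros c σ A e H. destruct (Ht (Cl (fAll σ A) e)) as [n [[H'|[_ [t H']]] _]].
    - exfalso. refine (r_neg _ sat_con_rules _ (fAll σ A) e (Th_con _ _)).
      intros x [<- | [<- | []]]; [exists n|]; auto.
    - exists t, n. exact H'. }
  destruct (henkin_model Con Th Th_con Th_dec Th_wit sat_con_rules) as [M [S [r [Hsurj Htr]]]].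
  assert (Htruth : forall c (A : fm Int c) e, isat A (penv r e) <-> Th (Cl A e)).
  { intros. rewrite <- (sat_emb S nost), (sat_emb S S). apply Htr. }
  assert (HM : epa_model M).
  { intros c A HA e. destruct (Hsurj c e) as [e' ->]. apply Htruth.
    destruct (Th_dec c A e') as [|H]; auto. exfalso.
    destruct (Th_con [Cl (fNot A) e']) as [M' [r' [HM' Hr']]]; [intros x [<- | []]; auto|].
    apply (Hr' _ (or_introl eq_refl)). apply HM', HA. }
  (* A requirement passes to the limit through its instances: the negation of [rcl q w] cannot
     become a fact, since a later condition containing both would have no realization. *)
  assert (Hrz : forall n, realizes r (F n)).
  { intros n. split.
    - intros [c A e] Hx. apply Htruth. exists n. exact Hx.
    - intros q Hq y [w [Hw Hy]].
      assert (T : ctrue nost r (rcl q w)).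
      { apply Htruth. destruct (Th_dec _ (cA (rcl q w)) (ce (rcl q w))) as [HT|[m HT]]; [exact HT|]. exfalso.
        destruct (HF (n + m)) as [M' [r' [HM' Hr']]].
        refine (rz_facts _ _ Hr' (Cl (fNot (cA (rcl q w))) (ce (rcl q w))) _ _).
        - apply (Hmono m); [lia|exact HT].
        - change (ctrue nost r' (rcl q w)). apply rcl_true. intros y' Hy'.
          apply (rz_reqs _ _ Hr'); [apply (Hmono n); [lia|exact Hq]|]. exists w. auto. }
      rewrite rcl_true in T. auto. }
  assert (Hmem := SM_mem r).
  assert (Hpar : forall σ k, Nat.Even k -> SM r σ (r σ k)) by (intros σ k Hk; exact (SM_pstd r _ (pPar σ k) Hk)).
  assert (HP : pmodel M (SM r)).
  { split; auto using SM_app, SM_cst.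
    - intros c ρ τ φ e HX. destruct (Hsurj c e) as [e' ->].
      (* The parameters 0 are placeholders for the two variables of the scheme. *)
      destruct (Ht (Cl φ (econs (pPar τ 0 : D PT τ) (econs (pPar ρ 0 : D PT ρ) e')))) as [n [_ [[T _] _]]].
      destruct T as [[k [Hk T]]|[G [HG T]]].
      + exfalso. destruct (HX (r ρ k) (Hpar ρ k Hk)) as [y [Hy Hφ]].
        pose proof (rz_reqs _ _ (Hrz n) _ T y Hy) as K. unfold rtrue in K. cbn [rc rty rA re] in K.
        rewrite penv_econs in K. exact (K Hφ).
      + exists (pe r G). split; [apply SM_pstd, HG|]. intros x Hx. exact (T M r HM (Hrz n) x Hx).
    - intros c σ τ φ e HX. destruct (Hsurj c e) as [e' ->].
      destruct (Ht (Cl φ (econs (pPar σ 0 : D PT σ) (econs (pPar τ 0 : D PT τ) e')))) as [n [_ [[_ T] _]]].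
      destruct T as [[k T]|[w [Hw T]]].
      + exists (r τ k). intros z Hz. pose proof (rz_reqs _ _ (Hrz n) _ T z Hz) as K. unfold rtrue in K.
        cbn [rc rty rA re] in K. rewrite penv_econs in K. exact K.
      + exfalso. destruct (HX (pe r w)) as [y Hy]; [apply SM_pstd, Hw|].
        destruct (T M r HM (Hrz n) y) as [z [Hz Hz']]. exact (Hz' (Hy z Hz)). }
  exists M, r. split; [auto|]. split; [|split; [auto|split; [auto|]]].
  { pose proof (Hrz 0) as H0. unfold F in H0. rewrite Hf0 in H0. exact H0. }
  apply (ext_ind_intro HP Hmem). intros c ρ τ φ e P P0 PS. destruct (Hsurj c e) as [e' ->].
  destruct (Ht (Cl φ (econs (pPar τ 0 : D PT τ) (econs (pPar ρ 0 : D PT ρ) (econs (pPar ι 0 : D PT ι) e'))))) as [n [_ [_ T]]].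
  destruct T as [[k [Hk T]]|[[k0 [k1 [k2 [E0 [E1 [E2 [T1 T2]]]]]]]|[G [HG T]]]].
  - exfalso. destruct (P0 (r ρ k) (Hpar ρ k Hk)) as [y [Hy Hφ]].
    pose proof (rz_reqs _ _ (Hrz n) _ T y Hy) as K. unfold rtrue in K. cbn [rc rty rA re] in K.
    rewrite !penv_econs in K. exact (K Hφ).
  - exfalso. destruct (PS (r ι%ty k0) (Hpar _ k0 E0)) with (x := r ρ k2) as [y [Hy Hφ]]; auto.
    + intros x Hx. pose proof (rz_reqs _ _ (Hrz n) _ T1 x Hx) as K. unfold rtrue in K. cbn [rc rty rA re] in K.
      rewrite !penv_econs, sat_hacf in K. destruct K as [y [Hy Hφ]]. exists y. split; [|exact Hφ].
      eapply Hmem; [|exact Hy]. apply SM_app; auto. exact (Hpar _ k1 E1).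
    + pose proof (rz_reqs _ _ (Hrz n) _ T2 y Hy) as K. unfold rtrue in K. cbn [rc rty rA re] in K.
      rewrite !penv_econs in K. exact (K Hφ).
  - intros m Hm x Hx. destruct (T M r HM (Hrz n) m x Hm Hx) as [y [Hy Hφ]]. exists y. split; [|exact Hφ].
    eapply Hmem; [|exact Hy]. repeat smapp; auto. apply SM_pstd, HG.
Qed.

(** * The meaning of the formulas of the theorem in a structure *)

Notation oneM := (sM zM).

Definition le1M {M} (f : D M ty1) : Prop := forall n, leM (ap f n) oneM.
Definition approxM {M} (S : spred M) (f g : D M ty1) : Prop := forall n, S ι%ty n -> ap f n = ap g n.
Definition inCM {M} (Y : D M ty2) : Prop :=
  forall f, exists N, forall g, ap (ap segcM g) N = ap (ap segcM f) N -> ap Y f = ap Y g.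
Definition STPM {M} (S : spred M) : Prop :=
  forall f, le1M f -> exists g, S ty1 g /\ le1M g /\ approxM S f g.
Definition NPCM {M} (S : spred M) : Prop :=
  forall Y, S ty2 Y -> inCM Y -> forall f, S ty1 f -> forall g, approxM S f g -> ap Y f = ap Y g.
Definition GHp {M} (Γ : D M (ty2 ⇒ ι ⇒ ι)) Z t : Prop := ap (ap Γ Z) t = ap Z (ap (ap (ap GHM Γ) Z) t).
Definition GHstM {M} (S : spred M) (Γ : D M (ty2 ⇒ ι ⇒ ι)) : Prop :=
  forall Z, S ty2 Z -> inCM Z -> forall t, S ι%ty t -> GHp Γ Z t.
Definition CAM {M} (S : spred M) (Γ : D M (ty2 ⇒ ι ⇒ ι)) : Prop :=
  forall Y, S ty2 Y -> inCM Y -> forall s, S ι%ty s -> forall N, ~ S ι%ty N ->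
    ap (ap (ap GfM Y) s) N = ap (ap (ap HfM Y) s) N /\ ap (ap (ap HfM Y) s) N = ap (ap Γ Y) s.
Definition inTM {M} (s : D M ι) (T : D M ty1) : Prop := ap T s = oneM.
Definition bintreeM {M} (T : D M ty1) : Prop :=
  le1M T /\ forall s, inTM s T ->
    (forall n, ltM n (ap lhM s) -> leM (ap (ap padM s) n) oneM) /\
    (forall n, leM n (ap lhM s) -> inTM (ap (ap inicM s) n) T).
Definition SCFM {M} (Θ1 : D M (ty2 ⇒ ι)) (Θ2 : D M (ty2 ⇒ ty1^*)) (W : D M ty2) : Prop :=
  forall T, bintreeM T ->
    (forall α, memM α (ap Θ2 W) -> le1M α -> ~ inTM (ap (ap segcM α) (ap W α)) T) ->
    forall β, le1M β -> exists i, leM i (ap Θ1 W) /\ ~ inTM (ap (ap segcM β) i) T.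
Definition MPCM {M} (Ψ : D M (ty2 ⇒ ty1 ⇒ ι)) (V : D M ty2) (f : D M ty1) : Prop :=
  forall g, ap (ap segcM f) (ap (ap Ψ V) f) = ap (ap segcM g) (ap (ap Ψ V) f) -> ap V f = ap V g.
Definition mem2M {M σ τ} (x : D M σ) (y : D M τ) (w : D M (σ^*)) (w' : D M (τ^*)) : Prop :=
  exists j, ltM j (ap lenM w) /\ ltM j (ap lenM w') /\ ap (ap nthM w) j = x /\ ap (ap nthM w') j = y.

Lemma all_ext {A : Type} (P Q : A -> Prop) : (forall a, P a = Q a) -> (forall a, P a) = (forall a, Q a).
Proof. intros H. replace Q with P; [reflexivity|]. extensionality a. apply H. Qed.
Lemma ex_ext {A : Type} (P Q : A -> Prop) : (forall a, P a = Q a) -> (exists a, P a) = (exists a, Q a).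
Proof. intros H. replace Q with P; [reflexivity|]. extensionality a. apply H. Qed.
Lemma imp_ext (P P' Q Q' : Prop) : P = P' -> Q = Q' -> (P -> Q) = (P' -> Q').
Proof. congruence. Qed.
Lemma and_ext (P P' Q Q' : Prop) : P = P' -> Q = Q' -> (P /\ Q) = (P' /\ Q').
Proof. congruence. Qed.

Ltac satx := lazymatch goal with
  | |- sat _ (fAnd _ _) _ = _ => rewrite sat_and; apply and_ext
  | |- sat _ (fExSt _ _) _ = _ => rewrite sat_exst; apply ex_ext; intro; apply and_ext; [reflexivity|]
  | |- sat _ (fEx _ _) _ = _ => rewrite sat_ex; apply ex_ext; intro
  | |- sat _ (fAllSt _ _) _ = _ => rewrite sat_allst; apply all_ext; intro; apply imp_ext; [reflexivity|]
  | |- sat _ (fNot _) _ = _ => rewrite sat_not; apply imp_ext; [|reflexivity]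
  | |- sat _ (fAll _ _) _ = _ => rewrite sat_all; apply all_ext; intro
  | |- sat _ (fImp _ _) _ = _ => rewrite sat_imp; apply imp_ext
  | |- sat _ (fEq _ _) _ = _ => cbn [sat]; evc; reflexivity
  | |- sat _ (le _ _) _ = _ => rewrite sat_le; evc; reflexivity
  | |- sat _ (lt _ _) _ = _ => rewrite sat_lt; evc; reflexivity
  | |- sat _ (mem _ _) _ = _ => rewrite sat_mem; evc; reflexivity
  end.

Section SatFormulas.
Context {M : structure} (S : spred M) {L : lang}.
Lemma sat_le1 c (e : env M c) f : sat S (@le1 L c f) e = le1M (ev e f).
Proof. unfold le1, le1M. repeat satx. Qed.
Lemma sat_inC c (e : env M c) Y : sat S (@inC L c Y) e = inCM (ev e Y).
Proof. unfold inC, inCM. repeat satx. Qed.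
Lemma sat_GH c (e : env M c) Γ Z t : sat S (@GH L c Γ Z t) e = GHp (ev e Γ) (ev e Z) (ev e t).
Proof. unfold GH, GHp. repeat satx. Qed.
Lemma sat_inT c (e : env M c) s T : sat S (@inT L c s T) e = inTM (ev e s) (ev e T).
Proof. unfold inT, inTM. repeat satx. Qed.
Lemma sat_bintree c (e : env M c) T : sat S (@bintree L c T) e = bintreeM (ev e T).
Proof.
  unfold bintree, bintreeM. satx; [apply sat_le1|]. repeat satx; rewrite sat_inT; evs; reflexivity.
Qed.
Lemma sat_SCF c (e : env M c) Θ1 Θ2 W : sat S (@SCF L c Θ1 Θ2 W) e = SCFM (ev e Θ1) (ev e Θ2) (ev e W).
Proof.
  unfold SCF, SCFM. repeat satx;
  rewrite ?sat_bintree, ?sat_le1, ?sat_inT; evs; reflexivity.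
Qed.
Lemma sat_MPC c (e : env M c) Ψ V f : sat S (@MPC L c Ψ V f) e = MPCM (ev e Ψ) (ev e V) (ev e f).
Proof. unfold MPC, MPCM. repeat satx. Qed.
Lemma sat_mem2 c (e : env M c) σ τ (x : tm c σ) (y : tm c τ) w w' :
  sat S (@mem2 L c σ τ x y w w') e = mem2M (ev e x) (ev e y) (ev e w) (ev e w').
Proof. unfold mem2, mem2M. repeat satx. Qed.
End SatFormulas.

Lemma sat_star {M} (S : spred M) :
  sat S star enil = forall Γ, GHstM S Γ /\ STPM S /\ NPCM S -> CAM S Γ.
Proof.
  unfold star, GHst, STP, NPC, CA, approx, GHstM, STPM, NPCM, CAM, approxM.
  repeat satx; rewrite ?sat_inC, ?sat_le1, ?sat_GH; evs; reflexivity.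
Qed.

Definition HERbodyM {M} (i : iterms) (o : tm nil (tyHER ι)) (Θ1 : D M (ty2 ⇒ ι)) Θ2 Ψ Γ Y (s : D M ι) : Prop :=
  let at5 τ (t : tm nil (tyHER τ)) := ap (ap (ap (ap (ap (@ev M nil enil _ t) Y) s) Θ1) Θ2) Ψ in
  (forall Z t, mem2M Z t (at5 _ (i1Z i)) (at5 _ (i1t i)) -> inCM Z -> GHp Γ Z t) /\
  (forall W, memM W (at5 _ (i2W i)) -> SCFM Θ1 Θ2 W) /\
  (forall V f, mem2M V f (at5 _ (i3V i)) (at5 _ (i3f i)) -> inCM V -> MPCM Ψ V f) ->
  forall m, leM (at5 _ o) m -> ap (ap (ap GfM Y) s) m = ap (ap Γ Y) s.

Lemma sat_HER {M} (i : iterms) o :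
  isat (HER i o) (@enil M) = forall Θ1 Θ2 Ψ Γ Y, inCM Y -> forall s, HERbodyM (M := M) i o Θ1 Θ2 Ψ Γ Y s.
Proof.
  unfold HER, HERbody, HERbodyM, atYsΞ, HERctx. cbv zeta.
  repeat satx; rewrite ?sat_inC, ?sat_mem2, ?sat_GH, ?sat_SCF, ?sat_MPC, ?sat_le; evc; reflexivity.
Qed.

(** * From (⋆) to its Herbrandisation *)

Section StandardPart.
Context {M : structure} {S : spred M} (HP : pmodel M S) (Hmem : @mem_closed M S).
Local Instance HMp : epa_model M := pm_epa _ _ HP.

Lemma S_lt (m n : D M ι) : S _ n -> ltM m n -> S _ m.
Proof.
  intros Hn Hm. apply (Hmem _ m (ap uptoM n)); [|apply mem_upto, Hm].
  apply (pm_app _ _ HP); auto. apply (pmodel_closed _ _ HP _ upto).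
Qed.

Lemma approx_segc (f g : D M ty1) n : S _ n -> approxM S f g -> ap (ap segcM f) n = ap (ap segcM g) n.
Proof. intros Hn H. apply segc_ext. intros i Hi. apply H. eapply S_lt; eauto. Qed.

(* The tree of the initial segments of f of length at most K. *)
Definition segtree (f : D M ty1) (K : D M ι) : D M ty1 :=
  ev (econs K (econs f enil))
    (λ ifz · (add · (add · (monus · v0 · (segc · v2 · (lh · v0))) · (monus · (segc · v2 · (lh · v0)) · v0))
                  · (monus · (lh · v0) · v1)) · (succ · zero) · zero).

(** The tested sum of truncated differences vanishes exactly if each summand does; the two opposite
    differences give equality. *)
Lemma segtree_spec f K s : inTM s (segtree f K) <-> s = ap (ap segcM f) (ap lhM s) /\ leM (ap lhM s) K.
Proof.
  unfold inTM, segtree. evs. set (x := ap (ap segcM f) (ap lhM s)).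
  destruct (num_case (ap (ap addM (ap (ap addM (ap (ap monM s) x)) (ap (ap monM x) s))) (ap (ap monM (ap lhM s)) K))) as [E|[k E]]; rewrite E.
  - rewrite ifz_0. split; [intros _|auto].
    assert (Hz : forall a b : D M ι, ap (ap addM a) b = zM -> a = zM /\ b = zM).
    { intros a b Hab. split; apply le_0_inv; rewrite <- Hab; [apply le_add|apply le_addr]. }
    apply Hz in E as [E1 E2]. apply Hz in E1 as [E1 E3]. split; [|exact E2]. apply le_antisym; assumption.
  - rewrite ifz_S. split; [intros K0; symmetry in K0; destruct (succ_0 _ K0)|].
    intros [E1 E2]. exfalso. rewrite <- E1, (le_refl s : _ = _), E2, !add_0 in E. symmetry in E. exact (succ_0 _ E).
Qed.

Lemma segtree_bintree f K : le1M f -> bintreeM (segtree f K).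
Proof.
  intros Hf. split.
  - intros s. unfold segtree. evs.
    match goal with |- leM (ap (ap (ap ifzM ?x) _) _) _ => destruct (num_case x) as [->|[k ->]] end.
    + rewrite ifz_0. apply le_refl.
    + rewrite ifz_S. apply le_0.
  - intros s Hs. apply segtree_spec in Hs as [E1 E2]. split.
    + intros n Hn. rewrite E1, pad_segc by exact Hn. apply Hf.
    + intros n Hn. apply segtree_spec. rewrite E1, inic_segc by exact Hn. rewrite lh_segc.
      split; [reflexivity|]. eapply le_trans; eauto.
Qed.

(* If f is not infinitesimally close to a standard sequence, then HAC yields a standard W which
   separates f from every standard α at height W(α), against SCF for the tree of f. *)
Lemma STP_of_SCF Θ1 Θ2 : S _ Θ1 -> S _ Θ2 -> (forall W, S ty2 W -> SCFM Θ1 Θ2 W) -> STPM S.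
Proof.
  intros S1 S2 HW f Hf. apply NNPP. intros HN.
  (* [le1M] is written out because [dfn] works on the visible logical structure. *)
  destruct (hac_dfn HP ty1 ι%ty (fun g n => (forall k, leM (ap g k) oneM) -> ap f n <> ap g n)) as [F [SF HF]].
  - dfn.
  - intros g Sg. destruct (classic (le1M g)) as [Hg|Hg].
    + apply NNPP. intros HN'. apply HN. exists g. repeat split; auto. intros n Sn.
      apply NNPP. intros E. apply HN'. exists n. auto.
    + exists zM. split; [apply (pm_cst _ _ HP)|]. intros Hg'. destruct (Hg Hg').
  (* The sum bounds all candidates in F(α), and the successor brings the index itself into the
     segment of length W(α). *)
  - pose (W := ap (ev enil (λ λ succ · (lsum · (v1 · v0))) : D M ((ty1 ⇒ ι^*) ⇒ ty2)) F).
    assert (SW : S _ W) by (apply (pm_app _ _ HP); auto; apply (pmodel_closed _ _ HP)).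
    assert (EW : forall α, ap W α = sM (ap lsumM (ap F α))) by (intros; unfold W; evs; reflexivity).
    (* Cut at height Θ1(W), the tree contains the segments of f at all heights that SCF could
       name. *)
    destruct (HW W SW (segtree f (ap Θ1 W)) (segtree_bintree _ _ Hf)) with (β := f) as [i [Hi Hi']]; auto.
    + intros α Hα Hα1 HT. apply segtree_spec in HT as [HT _]. rewrite lh_segc in HT.
      assert (Sα : S _ α) by (apply (Hmem _ _ _ (pm_app _ _ HP _ _ _ _ S2 SW) Hα)).
      destruct (HF α Sα) as [n [Hn Hn']]. apply (Hn' Hα1).
      rewrite segc_ext in HT. symmetry. apply HT. rewrite EW. apply lt_S, le_sum, Hn.
    + apply Hi', segtree_spec. rewrite lh_segc. auto.
Qed.

(** The modulus at standard arguments is a standard number, so infinitesimally close sequences agree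
    up to it. *)
Lemma NPC_of_MPC Ψ : S _ Ψ -> (forall V f, S _ V -> S _ f -> inCM V -> MPCM Ψ V f) -> NPCM S.
Proof.
  intros SΨ H Y SY HY f Sf g Hfg. apply (H Y f SY Sf HY). apply approx_segc; auto.
  repeat apply (pm_app _ _ HP); auto.
Qed.

End StandardPart.

(** * Extraction of the terms i and o *)

(** Trades a requirement for its instance at one list. Once all requirements are traded, the
    inconsistency concerns internal facts only and is the validity of HER. *)
Lemma not_cons_step fs r rs : ~ Cons (Cond fs (r :: rs)) ->
  exists w, pstd w /\ ~ Cons (Cond (rcl r w :: fs) rs).
Proof.
  intros H. apply (not_cons_addr (Cond fs rs)) in H as [w [Hw K]]. exists w. split; auto.
  intros [M [ρ [HM Hr]]]. apply (realizes_addf ρ (rcl r w) (Cond fs rs)) in Hr as [H1 H2].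
  rewrite rcl_true in H1. destruct (K M ρ HM H2) as [y [Hy Hy']]. auto.
Qed.

Definition ctx5 : ctx := [ty2 ⇒ ty1 ⇒ ι; ty2 ⇒ ty1^*; ty2 ⇒ ι; ι; ty2]%ty.
(** The five standard arguments have different types, so each can be the parameter 0 of its type.
    All remaining parameters get closed default values, which leaves terms in these five
    variables. *)
Definition assign5 : assign (TM ctx5) :=
  upd (F := tm ctx5) (upd (F := tm ctx5) (upd (F := tm ctx5) (upd (F := tm ctx5) (upd (F := tm ctx5)
    (fun σ _ => dflt σ) ty2 0 v4) ι 0 v3) (ty2 ⇒ ι) 0 v2) (ty2 ⇒ ty1^*) 0 v1) (ty2 ⇒ ty1 ⇒ ι) 0 v0.
Definition abs5 {τ} (w : ptm τ) : tm nil (tyHER τ) := λ λ λ λ λ (@pe (TM ctx5) assign5 τ w : tm ctx5 τ).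

Definition env5 {M} (Y : D M ty2) (s : D M ι) (Θ1 : D M (ty2 ⇒ ι)) (Θ2 : D M (ty2 ⇒ ty1^*))
  (Ψ : D M (ty2 ⇒ ty1 ⇒ ι)) : env M ctx5 := econs Ψ (econs Θ2 (econs Θ1 (econs s (econs Y enil)))).
Definition assignM {M} (Y : D M ty2) s Θ1 Θ2 Ψ (Γ : D M (ty2 ⇒ ι ⇒ ι)) (N : D M ι) : assign M :=
  upd (F := D M) (upd (F := D M) (fun σ k => ev (env5 Y s Θ1 Θ2 Ψ) (assign5 σ k : tm ctx5 σ)) (ty2 ⇒ ι ⇒ ι) 1 Γ) ι 1 N.

(** Γ and N are odd parameters and cannot occur in a standard term, so the extracted terms do not
    depend on them. *)
Lemma abs5_ev {M} {HM : epa_model M} (Y : D M ty2) s Θ1 Θ2 Ψ Γ N τ (w : ptm τ) : pstd w ->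
  ap (ap (ap (ap (ap (ev enil (abs5 w)) Y) s) Θ1) Θ2) Ψ = pe (assignM Y s Θ1 Θ2 Ψ Γ N) w.
Proof.
  intros Hw. unfold abs5, assignM, tyHER. rewrite !pe_fresh by (apply pstd_odd; [exact Hw | exists 0; reflexivity]).
  rewrite !ev_lam. apply ev_pe.
Qed.

Ltac updt := repeat first [rewrite upd_same | rewrite upd_other by (first [left; discriminate | right; discriminate])].

Lemma assignM_eq {M} (Y : D M ty2) s Θ1 Θ2 Ψ Γ N : let r := assignM Y s Θ1 Θ2 Ψ Γ N in
  r ty2 0 = Y /\ r ι%ty 0 = s /\ r (ty2 ⇒ ι)%ty 0 = Θ1 /\ r (ty2 ⇒ ty1^*)%ty 0 = Θ2 /\
  r (ty2 ⇒ ty1 ⇒ ι)%ty 0 = Ψ /\ r (ty2 ⇒ ι ⇒ ι)%ty 1 = Γ /\ r ι%ty 1 = N.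
Proof. unfold assignM, assign5. cbv zeta. repeat split; updt; reflexivity. Qed.

Definition par {σ} (k : nat) : D PT σ := pPar σ k.

Definition pairZt := pairing ty2 ι.
Definition pairVf := pairing ty2 ty1.

(** The failure of the conclusion of HER, with Y and s as standard and Γ and N as arbitrary
    parameters. *)
Definition fact0 : closure Int :=
  Cl (inC v0 ∧ ¬ (Gfun · v0 · v1 · v3 ≡ v2 · v0 · v1))
    (econs (@par ty2 0) (econs (@par ι 0) (econs (@par (ty2 ⇒ ι ⇒ ι) 1) (econs (@par ι 1) enil)))).
Definition reqGH : req :=
  Req (rty := pty pairZt) (inC (tclose (pp1 pairZt) · v0) ⊃ GH v1 (tclose (pp1 pairZt) · v0) (tclose (pp2 pairZt) · v0))
    (econs (@par (ty2 ⇒ ι ⇒ ι) 1) enil).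
Definition reqSCF : req :=
  Req (rty := ty2) (SCF v1 v2 v0) (econs (@par (ty2 ⇒ ι) 0) (econs (@par (ty2 ⇒ ty1^*) 0) enil)).
Definition reqMPC : req :=
  Req (rty := pty pairVf) (inC (tclose (pp1 pairVf) · v0) ⊃ MPC v1 (tclose (pp1 pairVf) · v0) (tclose (pp2 pairVf) · v0))
    (econs (@par (ty2 ⇒ ty1 ⇒ ι) 0) enil).
Definition reqN : req := Req (rty := ι) (le v0 v1) (econs (@par ι 1) enil).

Section Meaning.
Context {M : structure} (r : assign M).
Lemma fact0_true : ctrue nost r fact0 <->
  inCM (r ty2 0) /\ ap (ap (ap GfM (r ty2 0)) (r ι%ty 0)) (r ι%ty 1) <> ap (ap (r (ty2 ⇒ ι ⇒ ι)%ty 1) (r ty2 0)) (r ι%ty 0).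
Proof.
  unfold ctrue, fact0. cbn [cc cA ce]. rewrite !penv_econs, sat_and, sat_inC, sat_not. cbn [sat]. evs. reflexivity.
Qed.
Lemma reqGH_true q : rtrue r reqGH q <->
  (inCM (ap (ev enil (pp1 pairZt)) q) ->
   GHp (r (ty2 ⇒ ι ⇒ ι)%ty 1) (ap (ev enil (pp1 pairZt)) q) (ap (ev enil (pp2 pairZt)) q)).
Proof.
  unfold rtrue, reqGH. cbn [rc rty rA re]. rewrite !penv_econs, sat_imp, sat_inC, sat_GH. evc. reflexivity.
Qed.
Lemma reqSCF_true W : rtrue r reqSCF W <-> SCFM (r (ty2 ⇒ ι)%ty 0) (r (ty2 ⇒ ty1^*)%ty 0) W.
Proof. unfold rtrue, reqSCF. cbn [rc rty rA re]. rewrite !penv_econs, sat_SCF. evc. reflexivity. Qed.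
Lemma reqMPC_true q : rtrue r reqMPC q <->
  (inCM (ap (ev enil (pp1 pairVf)) q) ->
   MPCM (r (ty2 ⇒ ty1 ⇒ ι)%ty 0) (ap (ev enil (pp1 pairVf)) q) (ap (ev enil (pp2 pairVf)) q)).
Proof.
  unfold rtrue, reqMPC. cbn [rc rty rA re]. rewrite !penv_econs, sat_imp, sat_inC, sat_MPC. evc. reflexivity.
Qed.
Lemma reqN_true n : rtrue r reqN n <-> leM n (r ι%ty 1).
Proof. unfold rtrue, reqN. cbn [rc rty rA re]. rewrite !penv_econs, sat_le. evc. reflexivity. Qed.
End Meaning.

Lemma mem2_map {M} {HM : epa_model M} σ τ ρ (f : D M (ρ ⇒ σ)) (g : D M (ρ ⇒ τ)) q w :
  memM q w -> mem2M (ap f q) (ap g q) (ap (ap lmapM f) w) (ap (ap lmapM g) w).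
Proof. intros [j [Hj <-]]. exists j. rewrite !len_map, !nth_map; auto. Qed.

Lemma star_not_cons : P_proves star -> ~ Cons (Cond [fact0] [reqN; reqMPC; reqSCF; reqGH]).
Proof.
  intros Hstar HC. destruct (generic_model _ HC) as [M [r [HM [Hr [HP [Hmem Hind]]]]]].
  pose proof (prv_sound pst_ax (SM r) (pmodel_pst _ _ HP Hind) _ _ _ Hstar enil) as H.
  rewrite sat_star in H. specialize (H ltac:(intros B [])).
  destruct Hr as [Hf Hq]. cbn [facts reqs] in Hf, Hq.
  specialize (Hf _ (or_introl eq_refl)). rewrite fact0_true in Hf. destruct Hf as [HY HG].
  assert (Hpar : forall σ, SM r σ (r σ 0)).
  { intros σ. apply (SM_pstd r _ (pPar σ 0)). exists 0. reflexivity. }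
  assert (QN : forall n, SM r _ n -> leM n (r ι%ty 1)).
  { intros n Hn. apply (proj1 (reqN_true r n)), (Hq reqN); [left; reflexivity | exact Hn]. }
  assert (QM : forall V f, SM r _ V -> SM r _ f -> inCM V -> MPCM (r (ty2 ⇒ ty1 ⇒ ι)%ty 0) V f).
  { intros V f HV Hf HVC.
    assert (K : rtrue r reqMPC (ap (ap (ev enil (pmk pairVf)) V) f)).
    { apply (Hq reqMPC); [right; left; reflexivity|]. repeat smapp; auto using SM_closed. }
    rewrite reqMPC_true, (pp1_eq _ _ pairVf _ HM), (pp2_eq _ _ pairVf _ HM) in K. auto. }
  assert (QS : forall W, SM r _ W -> SCFM (r (ty2 ⇒ ι)%ty 0) (r (ty2 ⇒ ty1^*)%ty 0) W).
  { intros W HW. apply (proj1 (reqSCF_true r W)), (Hq reqSCF); [right; right; left; reflexivity | exact HW]. }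
  assert (QG : GHstM (SM r) (r (ty2 ⇒ ι ⇒ ι)%ty 1)).
  { intros Z HZ HZC t Ht.
    assert (K : rtrue r reqGH (ap (ap (ev enil (pmk pairZt)) Z) t)).
    { apply (Hq reqGH); [right; right; right; left; reflexivity|]. repeat smapp; auto using SM_closed. }
    rewrite reqGH_true, (pp1_eq _ _ pairZt _ HM), (pp2_eq _ _ pairZt _ HM) in K. auto. }
  destruct (H _ (conj QG (conj (STP_of_SCF HP Hmem _ _ (Hpar _) (Hpar _) QS)
    (NPC_of_MPC HP Hmem _ (Hpar _) QM))) _ (Hpar _) HY _ (Hpar _) (r ι%ty 1)) as [E1 E2].
  (* Were N standard, its successor would be too, and [reqN] would place it below N. *)
  - intros HN. apply (lt_irrefl (r ι%ty 1)). apply QN. smapp; auto using SM_cst.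
  - apply HG. congruence.
Qed.

Lemma HER_of_star : P_proves star ->
  exists (i : iterms) (o : tm nil (tyHER ι)), EPA_proves (HER i o).
Proof.
  intros Hstar. pose proof (star_not_cons Hstar) as HC.
  apply not_cons_step in HC as [w4 [W4 HC]]. apply not_cons_step in HC as [w3 [W3 HC]].
  apply not_cons_step in HC as [w2 [W2 HC]]. apply not_cons_step in HC as [w1 [W1 HC]].
  cbn [rty reqGH reqSCF reqMPC reqN] in w1, w2, w3, w4, W1, W2, W3, W4.
  pose (mapp := fun σ τ (f : tm nil (σ ⇒ τ)) (w : ptm (σ^*)) => pApp (pApp (pclose lmap) (pclose f)) w).
  assert (Hmapp : forall σ τ f w, pstd w -> pstd (mapp σ τ f w)).
  { intros. repeat split; auto using pstd_pclose. }
  (* Lists of pairs are split into their two component lists. The bound o is the sum of the list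
     found for [reqN], which dominates its entries. *)
  exists (ITerms (abs5 (mapp _ _ (pp1 pairZt) w1)) (abs5 (mapp _ _ (pp2 pairZt) w1)) (abs5 w2)
    (abs5 (mapp _ _ (pp1 pairVf) w3)) (abs5 (mapp _ _ (pp2 pairVf) w3))), (abs5 (pApp (pclose lsum) w4)).
  apply epa_complete. intros M HM. rewrite sat_HER.
  intros Θ1 Θ2 Ψ Γ Y HY s. unfold HERbodyM. cbn [i1Z i1t i2W i3V i3f].
  intros [H1 [H2 H3]] N HN. apply NNPP. intros HG. apply HC.
  set (r := assignM Y s Θ1 Θ2 Ψ Γ N).
  destruct (assignM_eq Y s Θ1 Θ2 Ψ Γ N) as [EY [Es [EΘ1 [EΘ2 [EΨ [EΓ EN]]]]]]. fold r in EY, Es, EΘ1, EΘ2, EΨ, EΓ, EN.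
  assert (Hl : pstd (pApp (pclose lsum) w4)) by (split; auto using pstd_pclose).
  pose proof (fun τ w => @abs5_ev M HM Y s Θ1 Θ2 Ψ Γ N τ w) as E. fold r in E.
  rewrite (E _ (mapp _ _ (pp1 pairZt) w1)), (E _ (mapp _ _ (pp2 pairZt) w1)) in H1 by auto.
  rewrite (E _ w2) in H2 by auto. rewrite (E _ (pApp (pclose lsum) w4)) in HN by auto.
  rewrite (E _ (mapp _ _ (pp1 pairVf) w3)), (E _ (mapp _ _ (pp2 pairVf) w3)) in H3 by auto.
  unfold mapp in H1, H3. cbn [pe] in H1, H3, HN.
  repeat setoid_rewrite pe_pclose in H1. repeat setoid_rewrite pe_pclose in H3. rewrite pe_pclose in HN.
  exists M, r. split; auto. split; [|intros ? []].
  cbn [facts]. intros x [<- | [<- | [<- | [<- | [<- | []]]]]].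
  - apply rcl_true. intros q Hq. apply reqGH_true. rewrite EΓ. intros HZ. apply H1; auto.
    apply mem2_map, Hq.
  - apply rcl_true. intros W HW. apply reqSCF_true. rewrite EΘ1, EΘ2. apply H2, HW.
  - apply rcl_true. intros q Hq. apply reqMPC_true. rewrite EΨ. intros HZ. apply H3; auto.
    apply mem2_map, Hq.
  - apply rcl_true. intros n Hn. apply reqN_true. rewrite EN.
    eapply le_trans; [|exact HN]. apply le_sum, Hn.
  - apply fact0_true. rewrite EY, Es, EΓ, EN. auto.
Qed.

(** * From the Herbrandisation to (⋆) *)

(** External induction shows that numbers below a standard number are standard. An entry is then the
    value of [nth'] at a standard sequence and a standard index. *)
Lemma ext_ind_mem {M} {S : spred M} : pmodel M S -> ext_ind S -> @mem_closed M S.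
Proof.
  intros HP Hind σ x w Hw [j [Hj <-]]. pose proof (pm_epa _ _ HP) as HM.
  assert (H : forall n, S ι%ty n -> forall m, leM m n -> S ι%ty m).
  { intros n Hn. pose proof (Hind [] (∀[ι] (le v0 v1 ⊃ st v0)) enil) as K.
    assert (E : forall n, sat S (∀[ι] (le v0 v1 ⊃ st v0)) (econs n enil) = forall m : D M ι, leM m n -> S _ m).
    { intros n'. repeat satx. reflexivity. }
    rewrite <- E. apply K; auto.
    - rewrite E. intros m Hm. apply le_0_inv in Hm as ->. apply (pm_cst _ _ HP).
    - intros n' Hn'. rewrite !E. intros IH m Hm. destruct (le_lt_eq _ _ Hm) as [->|Hlt].
      + apply (pm_app _ _ HP); auto. apply (pm_cst _ _ HP).
      + apply IH, lt_S, Hlt. }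
  apply (pm_app _ _ HP); [apply (pm_app _ _ HP); auto; apply (pmodel_closed _ _ HP _ nth')|].
  apply (H (ap lenM w)); [|apply lt_le, Hj].
  apply (pm_app _ _ HP); auto. apply (pmodel_closed _ _ HP _ len).
Qed.

(** * A standard special fan functional and a standard modulus of continuity *)

Section Reverse.
Context {M : structure} {S : spred M} (HP : pmodel M S) (Hind : ext_ind S).
Local Instance HMr : epa_model M := pm_epa _ _ HP.
Let Hmem : @mem_closed M S := ext_ind_mem HP Hind.
Let Sap := pm_app _ _ HP.

Lemma S_ev c (e : env M c) τ (t : tm c τ) : (forall σ x, S _ (e σ x)) -> S _ (ev e t).
Proof.
  intros H. induction t; cbn; auto. apply (pm_cst _ _ HP).
Qed.

Lemma S_enil σ (x : var nil σ) : S _ (@enil M σ x).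
Proof. destruct (var_nil x). Qed.

Lemma S_econs c σ (a : D M σ) (e : env M c) :
  S _ a -> (forall σ x, S _ (e σ x)) -> forall τ x, S _ (econs a e τ x).
Proof.
  intros Ha He τ x. revert a e Ha He.
  refine (match x in var c' τ return
      match c' as c' return var c' τ -> Prop with nil => fun _ => True
      | σ :: c => fun x => forall (a : D M σ) (e : env M c), S _ a ->
         (forall σ x, S _ (e σ x)) -> S _ (econs a e τ x) end x
      with vz => _ | vs y => _ end); intros a e Ha He; [exact Ha | exact (He _ y)].
Qed.

Ltac sev := repeat match goal with
  | |- S _ (ap _ _) => apply Sap
  | |- S _ (ev _ _) => apply S_ev
  | |- forall σ x, S σ (econs _ _ σ x) => apply S_econs
  | |- forall σ x, S σ (enil σ x) => exact S_enil
  | |- S _ (kc _) => apply (pm_cst _ _ HP)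
  end; try assumption; auto.

(** For standard W, the neighbourhoods of length W(α) of finitely many α cover the binary sequences.
    Otherwise idealisation gives a binary β outside the neighbourhoods of all standard binary α,
    against its standard part. *)
Lemma special_fan : STPM S -> exists Θ1 Θ2, S _ Θ1 /\ S _ Θ2 /\ forall W, S ty2 W -> SCFM Θ1 Θ2 W.
Proof.
  intros HS.
  destruct (hac_dfn HP ty2 (ty1^*)%ty (fun W w => forall β, (forall n, leM (ap β n) oneM) ->
     exists α, memM α w /\ (forall n, leM (ap α n) oneM) /\
       ap (ap segcM α) (ap W α) = ap (ap segcM β) (ap W α))) as [F [SF HF]].
  - dfn.
  - intros W SW. apply NNPP. intros HN.
    destruct (ideal_dfn HP ty1 ty1 (fun α β => (forall n, leM (ap β n) oneM) /\
       ((forall n, leM (ap α n) oneM) -> ap (ap segcM α) (ap W α) <> ap (ap segcM β) (ap W α)))) as [β Hβ].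
    + dfn.
    + intros w Sw. apply NNPP. intros HN'. apply HN. exists w. split; auto. intros β Hβ.
      apply NNPP. intros HN''. apply HN'. exists β. intros α Hα. split; auto. intros Hα1 E.
      apply HN''. exists α. auto.
    + assert (H1 : le1M β) by (refine (proj1 (Hβ (ev enil (dflt ty1)) _)); sev).
      destruct (HS β H1) as [α [Sα [Hα Hβα]]]. apply (proj2 (Hβ α Sα) Hα). symmetry.
      apply (approx_segc HP Hmem); auto.
  (* HAC gives a list of candidate covers. Their concatenation still covers, and Θ1 bounds the W(α)
     by their sum. *)
  - pose (Θ2 := ap (ev enil (λ λ lbind · (λ v0) · (v1 · v0)) : D M ((ty2 ⇒ (ty1^*)^*) ⇒ ty2 ⇒ ty1^*)) F).
    pose (Θ1 := ap (ev enil (λ λ lsum · (lmap · v0 · (v1 · v0))) : D M ((ty2 ⇒ ty1^*) ⇒ ty2 ⇒ ι)) Θ2).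
    assert (S2 : S _ Θ2) by (unfold Θ2; sev).
    exists Θ1, Θ2. split; [unfold Θ1; sev|]. split; auto.
    assert (E1 : forall W, ap Θ1 W = ap lsumM (ap (ap lmapM W) (ap Θ2 W))).
    { intros. unfold Θ1. evs. reflexivity. }
    intros W SW T _ HT β Hβ. destruct (HF W SW) as [w [Hw Hw']].
    destruct (Hw' β Hβ) as [α [Hα [Hα1 E]]].
    assert (HΘ : memM α (ap Θ2 W)).
    { unfold Θ2. evs. apply (mem_bind _ _ _ w); auto. evs. exact Hα. }
    exists (ap W α). rewrite E1. split.
    + apply le_sum, mem_map, HΘ.
    + rewrite <- E. apply HT; auto.
Qed.

(** If no standard n were a modulus of V at f, idealisation would give a g infinitesimally close to
    f with another value, against NPC. HAC is applied to the pair of V and f. *)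
Lemma modulus : NPCM S -> exists Ψ, S _ Ψ /\ forall V f, S _ V -> S _ f -> inCM V -> MPCM Ψ V f.
Proof.
  intros HN.
  pose (V_ := ev enil (pp1 pairVf) : D M (pty pairVf ⇒ ty2)).
  pose (f_ := ev enil (pp2 pairVf) : D M (pty pairVf ⇒ ty1)).
  destruct (hac_dfn HP (pty pairVf) ι%ty (fun q n =>
     (forall f, exists N, forall g, ap (ap segcM g) N = ap (ap segcM f) N -> ap (ap V_ q) f = ap (ap V_ q) g) ->
     forall g, ap (ap segcM (ap f_ q)) n = ap (ap segcM g) n -> ap (ap V_ q) (ap f_ q) = ap (ap V_ q) g)) as [F [SF HF]].
  - dfn.
  - intros q Sq. set (V := ap V_ q). set (f := ap f_ q).
    assert (SV : S _ V) by (unfold V, V_; sev). assert (Sf : S _ f) by (unfold f, f_; sev).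
    apply NNPP. intros HN1.
    assert (HV : inCM V).
    { apply NNPP. intros HV. apply HN1. exists zM. split; [sev|]. intros HV'. destruct (HV HV'). }
    destruct (ideal_dfn HP ι%ty ty1 (fun n g => ap (ap segcM f) n = ap (ap segcM g) n /\ ap V f <> ap V g)) as [g Hg].
    + dfn.
    (* Agreement up to the sum implies agreement up to every entry, so one g serves the whole
       list. *)
    + intros w Sw. apply NNPP. intros HN2. apply HN1. exists (ap lsumM w). split; [unfold lsumM; sev|].
      intros _ g Hg. apply NNPP. intros HN3. apply HN2. exists g. intros n Hn. split; auto.
      rewrite segc_ext in Hg |- *. intros i Hi. apply Hg. eapply lt_le_trans; [exact Hi|]. apply le_sum, Hn.
    + apply (proj2 (Hg zM ltac:(sev))). apply HN; auto.
      intros n Sn. destruct (Hg (sM n) ltac:(sev)) as [E _]. rewrite segc_ext in E. apply E, le_refl.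
  - pose (Ψ := ap (ev enil (λ λ λ lsum · (v2 · (tclose (pmk pairVf) · v1 · v0))) : D M ((pty pairVf ⇒ ι^*) ⇒ ty2 ⇒ ty1 ⇒ ι)) F).
    exists Ψ. split; [unfold Ψ; sev|]. intros V f SV Sf HV g Hg.
    pose (q := ap (ap (ev enil (pmk pairVf)) V) f).
    assert (E1 : ap V_ q = V) by (apply (pp1_eq _ _ pairVf), HMr).
    assert (E2 : ap f_ q = f) by (apply (pp2_eq _ _ pairVf), HMr).
    destruct (HF q ltac:(unfold q; sev)) as [n [Hn K]]. rewrite E1, E2 in K. apply K; auto.
    assert (E : ap (ap Ψ V) f = ap lsumM (ap F q)) by (unfold Ψ; evc; reflexivity).
    rewrite E in Hg. rewrite segc_ext in Hg |- *. intros i Hi. apply Hg.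
    eapply lt_le_trans; [exact Hi|]. apply le_sum, Hn.
Qed.

(** * The agreement of G, H and Γ *)

Lemma add_le_mono (x y z : D M ι) : leM x y -> leM (ap (ap addM x) z) (ap (ap addM y) z).
Proof.
  intros H. ind z; [rewrite !add_0; exact H|]. intros n IH. rewrite !add_S. apply le_SS, IH.
Qed.

Lemma ext_lt s a (h : D M ty1) i : ltM i (ap lhM s) -> ap (ap (ap extM (ap (ap snocM s) a)) h) i = ap (ap padM s) i.
Proof.
  rewrite lh_eq, ext_eq, dec_snoc, cat_app, pad_eq, nth_cat. apply cat_lt.
Qed.

(** A common prefix only shifts the tails to the right, so agreement below [K] is kept. *)
Lemma ext_agree s a (h h' : D M ty1) K :
  (forall k, ltM k K -> ap h k = ap h' k) ->
  forall i, ltM i K -> ap (ap (ap extM (ap (ap snocM s) a)) h) i = ap (ap (ap extM (ap (ap snocM s) a)) h') i.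
Proof.
  intros H i Hi. rewrite !ext_eq. set (w := ap decM _).
  destruct (le_or_lt (ap lenM w) i) as [Hle|Hlt]; [|apply cat_lt, Hlt].
  rewrite <- (add_mon _ _ Hle), !cat_ge. apply H. eapply le_lt_trans; [|exact Hi].
  rewrite <- (add_mon _ _ Hle) at 2. apply le_addr.
Qed.

Context (i : iterms) (o : tm nil (tyHER ι)) (HH : isat (HER i o) (@enil M)).
Context (Γ : D M (ty2 ⇒ ι ⇒ ι)) (HGH : GHstM S Γ) (HSTP : STPM S) (HNPC : NPCM S).

Lemma CA_of_HER : CAM S Γ.
Proof.
  destruct (special_fan HSTP) as [Θ1 [Θ2 [SΘ1 [SΘ2 HSCF]]]]. destruct (modulus HNPC) as [Ψ [SΨ HMPC]].
  intros Y SY HY.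
  pose (e := econs Ψ (econs Θ2 (econs Θ1 (econs Y enil)))).
  pose (ob := ev e (λ tclose o · v4 · v0 · v3 · v2 · v1)).
  assert (Sob : S _ ob) by (unfold ob, e; sev).
  assert (HG : forall s, S _ s -> forall m, leM (ap ob s) m -> ap (ap (ap GfM Y) s) m = ap (ap Γ Y) s).
  { intros s Ss m Hm. pose proof HH as K. rewrite sat_HER in K.
    specialize (K Θ1 Θ2 Ψ Γ Y HY s). unfold HERbodyM in K. cbv zeta in K. apply K.
    (* The lists i(Y,s,Ξ) are values of closed terms at standard arguments, so their entries are
       standard and the hypotheses on Γ, Θ and Ψ cover them. *)
    - split; [|split].
      + intros Z t [j [Hj [Hj' [<- <-]]]] HZ. apply HGH; auto.
        * eapply Hmem; [|exists j; split; [exact Hj|reflexivity]]. sev.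
        * eapply Hmem; [|exists j; split; [exact Hj'|reflexivity]]. sev.
      + intros W HW. apply HSCF. eapply Hmem; [|exact HW]. sev.
      + intros V f [j [Hj [Hj' [<- <-]]]] HV. apply HMPC; auto.
        * eapply Hmem; [|exists j; split; [exact Hj|reflexivity]]. sev.
        * eapply Hmem; [|exists j; split; [exact Hj'|reflexivity]]. sev.
    - unfold ob, e in Hm. revert Hm. rewrite ev_lam. cbn [ev econs]. rewrite ev_tclose. exact (fun H => H). }
  clearbody ob.
  (* A standard substitute for Γ(Y,.), which need not be standard: G evaluated at its own bound,
     equal to Γ at standard s. *)
  pose (g := ev (econs ob (econs Y enil)) (λ Gfun · v2 · v0 · (v1 · v0))).
  assert (Sg : S _ g) by (unfold g; sev).
  assert (Eg : forall s, S _ s -> ap g s = ap (ap Γ Y) s).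
  { intros s Ss. unfold g. evs. apply HG; auto. apply le_refl. }
  clearbody g.
  pose (fS := ev (econs g enil) (λ ext · (snoc · v0 · zero) · (λ v2 · (snoc · v1 · (succ · v0))))).
  assert (SfS : S _ fS) by (unfold fS; sev).
  assert (EfS : forall s, ap fS s = ap (ap extM (ap (ap snocM s) zM))
     (ev (econs s (econs g enil)) (λ v2 · (snoc · v1 · (succ · v0))))).
  { intros. unfold fS. evs. reflexivity. }
  clearbody fS.
  assert (Ssnoc : forall s n, S _ s -> S _ n -> S _ (ap (ap snocM s) (sM n))).
  { intros s n Ss Sn. unfold snocM. sev. }
  (* Γ satisfies its recursion equation, and replacing Γ by g changes the argument of Y only at
     nonstandard places, which NPC ignores. *)
  assert (EY : forall s, S _ s -> ap g s = ap Y (ap fS s)).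
  { intros s Ss. rewrite Eg by auto. rewrite (HGH Y SY HY s Ss). symmetry. apply HNPC; try solve [sev].
    intros n Sn. rewrite EfS, GHstep_eq. apply (ext_agree s zM _ _ (sM n)); [|apply le_refl].
    intros k Hk. evs. apply Eg, Ssnoc; auto. apply (S_lt HP Hmem k (sM n)); auto. sev. }
  intros s Ss N HN.
  assert (HlN : forall n, S _ n -> ltM n N).
  { intros n Sn. destruct (le_or_lt N n) as [Hle|]; auto. exfalso. apply HN.
    apply (S_lt HP Hmem N (sM n)); [sev|apply lt_S, Hle]. }
  assert (HGN : ap (ap (ap GfM Y) s) N = ap (ap Γ Y) s).
  { apply HG; auto. apply lt_le, HlN. sev. }
  enough (HHN : ap (ap (ap HfM Y) s) N = ap g s).
  { rewrite HGN, HHN, Eg by auto. auto. }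
  apply NNPP. intros Hbad.
  pose (Hseq := fun t => ap (ap extM (ap (ap snocM t) zM))
    (ap nthM (ap (ap segM
      (ev (econs N (econs t (econs Y enil))) (λ Hfun · v3 · (snoc · v2 · (succ · v0)) · v1))) N))).
  assert (EH : forall t, S _ t -> ap (ap (ap HfM Y) t) N = ap Y (Hseq t)).
  { intros t St. apply H_step, HlN. unfold lhM. sev. }
  (* β decides where H(Y,.,N) and g differ; b is its standard part *)
  pose (β := ev (econs g (econs N (econs Y enil))) (λ ifz · (add · (monus · (Hfun · v3 · v0 · v2) · (v1 · v0))
     · (monus · (v1 · v0) · (Hfun · v3 · v0 · v2))) · zero · (succ · zero))).
  assert (Eβ : forall t, ap β t = zM <-> ap (ap (ap HfM Y) t) N = ap g t).
  { intros t. unfold β. evs. set (x := ap (ap (ap HfM Y) t) N). set (y := ap g t).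
    destruct (num_case (ap (ap addM (ap (ap monM x) y)) (ap (ap monM y) x))) as [E|[k E]]; rewrite E.
    - rewrite ifz_0. split; auto. intros _. apply le_antisym; apply le_0_inv; rewrite <- E; [apply le_add|apply le_addr].
    - rewrite ifz_S. split; [intros K; destruct (succ_0 _ K)|]. intros E'. exfalso.
      rewrite E', (le_refl y : _ = _), add_0 in E. symmetry in E. exact (succ_0 _ E). }
  destruct (HSTP β) as [b [Sb [_ Hb]]].
  { intros t. unfold β. evs.
    match goal with |- leM (ap (ap (ap ifzM ?x) _) _) _ => destruct (num_case x) as [->|[k ->]] end.
    - rewrite ifz_0. apply le_0.
    - rewrite ifz_S. apply le_refl. }
  clearbody β.
  assert (Eb : forall t, S _ t -> ap b t = zM <-> ap (ap (ap HfM Y) t) N = ap g t).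
  { intros t St. rewrite <- (Hb t St). apply Eβ. }
  (* From t the path moves to some t*(n+1) marked by b, with n searched below the modulus Ψ(Y,
     fS(t)). Everything in the recursion is standard. *)
  pose (p := ev (econs b (econs fS (econs Ψ (econs Y (econs s enil)))))
    (λ Rec · v0 · v5 · (λ λ snoc · v1 · (succ · (srch · (λ v4 · (snoc · v2 · (succ · v0))) · (v5 · v6 · (v4 · v1))))))).
  assert (Sp : S _ p) by (unfold p; sev).
  assert (p0 : ap p zM = s) by (unfold p; evs; apply Rec_0).
  assert (pS : forall k, exists n, ap p (sM k) = ap (ap snocM (ap p k)) (sM n) /\
     ((exists n', ltM n' (ap (ap Ψ Y) (ap fS (ap p k))) /\ ap b (ap (ap snocM (ap p k)) (sM n')) <> zM) ->
      ap b (ap p (sM k)) <> zM)).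
  { intros k.
    pose (h := ev (econs (ap p k) (econs b enil)) (λ v2 · (snoc · v1 · (succ · v0)))).
    assert (Eh : forall n, ap h n = ap b (ap (ap snocM (ap p k)) (sM n))) by (intros; unfold h; evs; reflexivity).
    pose (n := ap (ap srchM h) (ap (ap Ψ Y) (ap fS (ap p k)))).
    assert (E : ap p (sM k) = ap (ap snocM (ap p k)) (sM n)).
    { unfold p at 1. evs. rewrite Rec_S. evs.
      match goal with |- ap (ap snocM ?t) _ = _ => replace t with (ap p k) by (unfold p; evs; reflexivity) end.
      unfold n. change (ev _ srch) with (@srchM M). do 4 f_equal. }
    exists n. split; [exact E|]. intros [n' [Hn' Hb']]. rewrite <- Eh in Hb'.
    rewrite E, <- Eh. exact (proj1 (srch_spec h n' _ Hn' Hb')). }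
  clearbody p.
  assert (Spk : forall k, S _ k -> S _ (ap p k)) by (intros; sev).
  (* External induction, although the formula is internal: b is correct at standard arguments only.
     If no successor below the modulus were marked, the arguments of Y for H and for g would agree
     up to it, and so would the values at p(k). *)
  assert (Hpath : forall k, S _ k -> ap b (ap p k) <> zM).
  { intros k Sk. pose proof (Hind [ty1; ty1] (¬ (v1 · (v2 · v0) ≡ zero)) (econs b (econs p enil))) as K.
    cbn [sat fNot ev econs zero] in K. refine (K _ _ k Sk).
    - rewrite p0. rewrite Eb by auto. exact Hbad.
    - clear k Sk. intros k Sk IH. revert IH. destruct (pS k) as [n [_ Hn]]. intros IH. apply Hn. apply NNPP. intros HN1. apply IH.
      apply (proj2 (Eb _ (Spk _ Sk))). rewrite EH, EY by auto. symmetry. apply HMPC; try solve [sev].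
      rewrite segc_ext. intros j Hj. rewrite EfS. unfold Hseq. refine (ext_agree _ _ _ _ _ _ j Hj). intros m Hm.
      assert (Sm : S _ m).
      { refine (S_lt HP Hmem m _ _ Hm). sev. }
      rewrite nth_seg by (apply HlN, Sm). evs. symmetry. apply Eb; auto. apply NNPP. intros HN2. apply HN1. eauto. }
  assert (lhp : forall k, ap lhM (ap p k) = ap (ap addM (ap lhM s)) k).
  { intros k. ind k; [rewrite p0, add_0; reflexivity|]. intros k IH.
    destruct (pS k) as [n [-> _]]. rewrite lh_snoc, IH, add_S. reflexivity. }
  assert (padp : forall k d j, ltM j (ap lhM (ap p k)) -> ap (ap padM (ap p (ap (ap addM k) d))) j = ap (ap padM (ap p k)) j).
  { intros k d j Hj. ind d; [rewrite add_0; reflexivity|]. intros d IH. rewrite add_S.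
    destruct (pS (ap (ap addM k) d)) as [n [-> _]]. rewrite <- IH.
    rewrite !pad_eq, !nth_cat, dec_snoc, cat_app. apply cat_lt. rewrite <- lh_eq.
    eapply lt_le_trans; [exact Hj|]. rewrite !lhp. rewrite (add_comm _ (ap (ap addM k) d)), (add_comm _ k).
    apply add_le_mono, le_add. }
  (* The limit of the path: p(j+1) has length greater than j and already fixes entry j. *)
  pose (α := ev (econs p enil) (λ pad · (v1 · (succ · v0)) · v0)).
  assert (Sα : S _ α) by (unfold α; sev).
  assert (Eα : forall k j, ltM j (ap lhM (ap p k)) -> ap α j = ap (ap padM (ap p k)) j).
  { intros k j Hj. unfold α. evs. destruct (le_or_lt k (sM j)) as [Hle|Hlt].
    - rewrite <- (add_mon _ _ Hle). apply padp, Hj.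
    - rewrite <- (add_mon _ _ (lt_le _ _ Hlt)). symmetry. apply padp. rewrite lhp. apply le_addr. }
  clearbody α.
  (* This point is at least as long as the modulus of Y at α, so Y takes the value Y(α) on every
     extension of t. Hence H and g agree at t, against [Hpath]. *)
  pose (t := ap p (ap (ap Ψ Y) α)).
  assert (St : S _ t) by (unfold t; sev).
  assert (Hlt : forall j, ltM j (ap (ap Ψ Y) α) -> ltM j (ap lhM t)).
  { intros j Hj. unfold t. rewrite lhp. eapply lt_le_trans; [exact Hj|apply le_addr]. }
  assert (Et : forall h, ap Y α = ap Y (ap (ap extM (ap (ap snocM t) zM)) h)).
  { intros h. apply HMPC; auto. apply segc_ext. intros j Hj. rewrite ext_lt by auto.
    apply Eα, Hlt, Hj. }
  apply (Hpath (ap (ap Ψ Y) α)); [sev|]. fold t. apply Eb; auto.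
  rewrite EH, EY, EfS by auto. unfold Hseq. rewrite <- !Et. reflexivity.
Qed.

End Reverse.

Lemma star_of_HER (i : iterms) (o : tm nil (tyHER ι)) : EPA_proves (HER i o) -> P_proves star.
Proof.
  intros H. apply pst_complete. intros M S HS. apply pst_pmodel in HS as [HP Hind].
  rewrite sat_star. intros Γ [HG [HSTP HNPC]].
  apply (CA_of_HER HP Hind i o); auto.
  apply (prv_sound epa_ax nost (pm_epa _ _ HP) _ _ _ H). intros B [].
Qed.

Theorem theorem4p7 :
  (P_proves star ->
     exists (i : iterms) (o : tm nil (tyHER tyN)), EPA_proves (HER i o))
  /\
  (forall (i : iterms) (o : tm nil (tyHER tyN)),
     EPA_proves (HER i o) -> P_proves star).
Proof. exact (conj HER_of_star star_of_HER). Qed.
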